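(* Let $q\in\Bbbk^*$. Then, up to isomorphism, the maximal cocommutative quotients of $\underline{\mathrm{aut}}^r(A_q(2))$ are the following: (1) the group algebra of $\mathbb{Z}^2$; (2) the Hopf algebras $\mathcal{A}(0,q)$ and $\mathcal{A}(0,q^{-1})$; (3) the group algebra of $\Gamma=\langle f,g\mid f^2=g^2\rangle$ (only if $q=-1$). Consequently, if $C$ is a cocommutative Hopf algebra which right coacts on $A_q(2)$ inner-faithfully (compatibly with its $\mathbb{N}$-grading), then $C$ is a quotient of one of the Hopf algebras on the list above.
   Context: $\Bbbk$ is an algebraically closed field of characteristic zero. $A_q(2)=\Bbbk\langle x_1,x_2\rangle/(x_2x_1-qx_1x_2)$, with its $\mathbb{N}$-grading in which $x_1,x_2$ have degree $1$. A Hopf algebra $H$ right coacts on an algebra $A$ if $A$ is a right $H$-comodule via a map $\rho:A\to A\otimes H$ that is an algebra homomorphism. All coactions on $A_q(2)$ are required to preserve the $\mathbb{N}$-grading: $\rho(A_k)\subseteq A_k\otimes H$. The coaction is inner-faithful if $\rho(A)\not\subseteq A\otimes H'$ for every proper Hopf subalgebra $H'\subsetneq H$. $\underline{\mathrm{aut}}^r(A)$ denotes the universal right coacting Hopf algebra of a quadratic algebra $A$: it has a grading-compatible right coaction $\rho:A\to A\otimes\underline{\mathrm{aut}}^r(A)$ such that for every Hopf algebra $H$ with a grading-compatible right coaction $\rho':A\to A\otimes H$ there is a unique Hopf algebra homomorphism $\phi:\underline{\mathrm{aut}}^r(A)\to H$ with $(\mathrm{id}_A\otimes\phi)\circ\rho=\rho'$.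 A maximal cocommutative quotient of a Hopf algebra $H$ is a quotient $H/I$, with $I$ a Hopf ideal, such that $H/I$ is cocommutative and $H/I'$ is not cocommutative for any Hopf ideal $I'\subsetneq I$. For $q\in\Bbbk^*$, $\mathcal{A}(0,q)=\Bbbk\langle x^{\pm1},y\rangle/(yx-qxy)$ is the Hopf algebra in which $x$ is group-like and $y$ is primitive ($\Delta(y)=y\otimes1+1\otimes y$). *)

(* Defs.v *)
From HB Require Import structures.
From mathcomp Require Import all_boot all_order all_algebra.
From mathcomp Require Import generic_quotient finmap boolp classical_sets monalg.

Set Implicit Arguments.
Unset Strict Implicit.
Unset Printing Implicit Defensive.

Import GRing.Theory.
Local Open Scope quotient_scope.
Local Open Scope ring_scope.

Section Linear.
Context (k : fieldType).
Implicit Types U V W : lmodType k.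

Definition bilinear_map U V W (beta : U -> V -> W) : Prop :=
  (forall v, linear (beta^~ v)) /\ (forall u, linear (beta u)).

Lemma linP0 U V (f : U -> V) : linear f -> f 0 = 0.
Proof. by move=> fl; have := fl (-1) 0 0; rewrite scaler0 addr0 scaleN1r addNr. Qed.

Lemma linPD U V (f : U -> V) : linear f -> {morph f : x y / x + y}.
Proof. by move=> fl x y; have := fl 1 x y; rewrite !scale1r. Qed.

Lemma linPZ U V (f : U -> V) c : linear f -> {morph f : x / c *: x}.
Proof. by move=> fl x; have := fl c x 0; rewrite (linP0 fl) !addr0. Qed.

Lemma linPN U V (f : U -> V) : linear f -> {morph f : x / - x}.
Proof. by move=> fl x; rewrite -scaleN1r (linPZ _ fl) scaleN1r. Qed.

Lemma linPB U V (f : U -> V) : linear f -> {morph f : x y / x - y}.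
Proof. by move=> fl x y; rewrite (linPD fl) (linPN fl). Qed.

Lemma linP_sum U V (f : U -> V) (T : Type) (s : seq T) (F : T -> U) :
  linear f -> f (\sum_(i <- s) F i) = \sum_(i <- s) f (F i).
Proof.
move=> fl; elim: s => [|x s IH]; first by rewrite !big_nil linP0.
by rewrite !big_cons (linPD fl) IH.
Qed.

Lemma linP_comp U V W (g : V -> W) (f : U -> V) :
  linear g -> linear f -> linear (fun x => g (f x)).
Proof. by move=> gl fl c x y; rewrite fl gl. Qed.

Lemma linP_comb U V (f g : U -> V) (c : k) :
  linear f -> linear g -> linear (fun x => c *: f x + g x).
Proof.
by move=> fl gl d x y; rewrite fl gl !scalerDr !scalerA [c * d]mulrC addrACA.
Qed.

Lemma linP_id U : linear (@id U).
Proof. by []. Qed.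

Lemma linP_mull (A : algType k) (a : A) : linear (fun x : A => a * x).
Proof. by move=> c x y; rewrite mulrDr scalerAr. Qed.

Lemma linP_mulr (A : algType k) (a : A) : linear (fun x : A => x * a).
Proof. by move=> c x y; rewrite mulrDl scalerAl. Qed.

Lemma linP_scale U (u : U) : linear (fun c : k^o => c *: u).
Proof. by move=> c x y; rewrite scalerDl scalerA. Qed.

Lemma linP_scaler U (c : k) : linear (fun u : U => c *: u).
Proof. by move=> d x y; rewrite scalerDr !scalerA mulrC. Qed.

(* Over a field, a nonzero vector is detected by a linear form. *)
Lemma linear_form_exists V (v : V) : v != 0 ->
  exists f : V -> k^o, linear f /\ f v = 1.
Proof.
move=> v0.
pose P (W : set V) := (forall c x y, W x -> W y -> W (c *: x + y)) /\ ~ W v.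
have [|W [[Wl Wv] Wmax]] := @Zorn_bigcup V P.
  move=> F FP Ft; split=> [c x y [X FX Xx] [Y FY Yy]|[X FX]]; last first.
    by have [_] := FP _ FX.
  have [XY|YX] := Ft _ _ FX FY.
  - by exists Y => //; have [+ _] := FP _ FY; apply=> //; apply: XY.
  - by exists X => //; have [+ _] := FP _ FX; apply=> //; apply: YX.
have W0 : W 0.
  apply: contrapT => nW0.
  have We x : ~ W x by move=> Wx; have := Wl (-1) x x Wx Wx; rewrite scaleN1r addNr.
  apply: (Wmax [set 0]%classic).
    by split=> [x /We//|/(_ 0 erefl)/We].
  split=> [c x y -> ->|/esym/eqP]; first by rewrite scaler0 addr0.
  by rewrite eq_sym (negPf v0).
have WZ c x : W x -> W (c *: x) by move=> Wx; rewrite -[_ *: _]addr0; exact: Wl.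
have WB x y : W x -> W y -> W (x - y).
  by move=> Wx Wy; rewrite addrC -scaleN1r; exact: Wl.
have dec u : exists c, W (u - c *: v).
  apply: contrapT => nu.
  pose W' := [set x | exists c, W (x - c *: u)]%classic.
  apply: (Wmax W'); first split.
  - by move=> x Wx; exists 0; rewrite scale0r subr0.
  - move=> W'W; apply: nu; exists 0; rewrite scale0r subr0; apply: W'W.
    by exists 1; rewrite scale1r subrr.
  split=> [c x y [a Wa] [b Wb]|[c Wc]].
    exists (c * a + b); rewrite scalerDl -scalerA opprD addrACA -scalerBr.
    exact: Wl.
  have c0 : c != 0 by apply/eqP => c0; move: Wc; rewrite c0 scale0r subr0.
  apply: nu; exists c^-1.
  have := WZ (- c^-1) _ Wc.
  by rewrite scalerBr scalerA mulNr mulVf // !scaleNr scale1r opprK addrC.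
have cinj c d u : W (u - c *: v) -> W (u - d *: v) -> c = d.
  move=> /WB h /h.
  rewrite opprB addrC addrA subrK -scalerBl => Wcd.
  apply/eqP; rewrite eq_sym -subr_eq0; apply: contrapT => /negP cd; apply: Wv.
  by have := WZ (d - c)^-1 _ Wcd; rewrite scalerA mulVf // scale1r.
pose f u : k^o := sval (cid (dec u)).
have fP u : W (u - f u *: v) by rewrite /f; case: cid.
exists f; split=> [c x y|]; last first.
  by apply: (cinj _ _ v) => //; rewrite scale1r subrr.
apply: (cinj _ _ (c *: x + y)) => //.
rewrite scalerDl -scalerA opprD addrACA -scalerBr; exact: Wl.
Qed.

End Linear.
#[global] Hint Resolve linP_id : core.

(* Linear extension of a map defined on the basis [M] of [{malg k[M]}]. *)
HB.lock Definition mext (k : fieldType) (M : choiceType) (V : lmodType k)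
    (f : M -> V) (p : {malg k[M]}) : V :=
  \sum_(m <- msupp p) p@_m *: f m.

Section LinExt.
Context (k : fieldType) (M : choiceType) (V : lmodType k).

Lemma mextEw (f : M -> V) (d : {fset M}) (p : {malg k[M]}) :
  (msupp p `<=` d)%fset -> mext f p = \sum_(m <- d) p@_m *: f m.
Proof.
move=> le; rewrite mext.unlock (big_fset_incl _ le) //=.
by move=> m _ /mcoeff_outdom ->; rewrite scale0r.
Qed.

Lemma mext_linear (f : M -> V) : linear (mext f).
Proof.
move=> c p q.
pose d := (msupp p `|` msupp q `|` msupp (c *: p + q))%fset.
rewrite !(@mextEw f d) ?scaler_sumr -?big_split /=.
- by apply: eq_bigr => m _; rewrite mcoeffD mcoeffZ scalerDl scalerA.
- by rewrite /d -fsetUA fsetUCA fsubsetUl.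
- by rewrite /d -fsetUA fsubsetUl.
- by rewrite /d fsubsetUr.
Qed.

Lemma mextU (f : M -> V) m : mext f << m >> = f m.
Proof.
rewrite (@mextEw f [fset m]%fset) ?msuppU_le //.
by rewrite big_seq_fset1 mcoeffUU scale1r.
Qed.

Lemma malg_linP (f g : {malg k[M]} -> V) : linear f -> linear g ->
  (forall m, f << m >> = g << m >>) -> f =1 g.
Proof.
move=> fl gl fg p; rewrite [p]monalgE (linP_sum _ _ fl) (linP_sum _ _ gl).
apply: eq_bigr => m _.
have -> : << p@_m *g m >> = p@_m *: << m >> :> {malg k[M]}.
  by apply/malgP=> x; rewrite mcoeffZ !mcoeffU mulrnAr mulr1.
by rewrite (linPZ _ fl) (linPZ _ gl) fg.
Qed.

Lemma mext_linear2 (W : lmodType k) (F : W -> M -> V) p :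
  (forall m, linear (F^~ m)) -> linear (fun w => mext (F w) p).
Proof.
move=> Fl c x y; rewrite mext.unlock scaler_sumr -big_split; apply: eq_bigr => m _ /=.
by rewrite Fl scalerDr !scalerA mulrC.
Qed.
End LinExt.

(* The monoid algebra k[M]: the free vector space on [M], with the product
   extending that of [M] bilinearly.  (The ring structure that [monalg] puts on
   [{malg k[M]}] requires [M] to have no nontrivial units.) *)
Definition monoid_alg (k : fieldType) (M : monoidType) := {malg k[M]}.

HB.instance Definition _ (k : fieldType) (M : monoidType) :=
  GRing.Lmodule.on (monoid_alg k M).

HB.lock Definition mmon (k : fieldType) (M : monoidType) (m : M) : monoid_alg k M :=
  << m >>.

HB.lock Definition mmul_alg (k : fieldType) (M : monoidType)
    (p q : monoid_alg k M) : monoid_alg k M :=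
  mext (fun m => mext (fun n => mmon k (m * n)%g) q) p.

Section MonoidAlg.
Context (k : fieldType) (M : monoidType).
Local Notation kM := (monoid_alg k M).
Local Notation mmon := (@mmon k M).
Local Notation mmul_alg := (@mmul_alg k M).

Lemma monoid_alg_linP (V : lmodType k) (f g : kM -> V) :
  linear f -> linear g -> (forall m, f (mmon m) = g (mmon m)) -> f =1 g.
Proof. by rewrite mmon.unlock; apply: malg_linP. Qed.

Lemma mext_mmon (V : lmodType k) (f : M -> V) m : mext f (mmon m) = f m.
Proof. by rewrite mmon.unlock; apply: mextU. Qed.

Lemma mmul_algl q : linear (mmul_alg^~ q).
Proof. by rewrite mmul_alg.unlock; apply: (@mext_linear k M kM). Qed.
Lemma mmul_algr p : linear (mmul_alg p).
Proof.
by rewrite mmul_alg.unlock; apply: (@mext_linear2 k M kM) => m; apply: mext_linear.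
Qed.
Lemma mmul_algU m n : mmul_alg (mmon m) (mmon n) = mmon (m * n)%g.
Proof. by rewrite mmul_alg.unlock !mext_mmon. Qed.

Lemma mmul_algA : associative mmul_alg.
Proof.
move=> p q r; move: p; apply: (monoid_alg_linP
    (f := fun p => mmul_alg p (mmul_alg q r))
    (g := fun p => mmul_alg (mmul_alg p q) r)) => [||m].
- exact: mmul_algl.
- exact: (linP_comp (mmul_algl r) (mmul_algl q)).
move: q; apply: (monoid_alg_linP
    (f := fun q => mmul_alg (mmon m) (mmul_alg q r))
    (g := fun q => mmul_alg (mmul_alg (mmon m) q) r)) => [||n].
- exact: (linP_comp (mmul_algr (mmon m)) (mmul_algl r)).
- exact: (linP_comp (mmul_algl r) (mmul_algr (mmon m))).
move: r; apply: (monoid_alg_linP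
    (f := fun r => mmul_alg (mmon m) (mmul_alg (mmon n) r))
    (g := mmul_alg (mmul_alg (mmon m) (mmon n)))) => [||o].
- exact: (linP_comp (mmul_algr (mmon m)) (mmul_algr (mmon n))).
- exact: mmul_algr.
by rewrite !mmul_algU mulgA.
Qed.

Lemma mmul_alg1p : left_id (mmon 1%g) mmul_alg.
Proof.
apply: (monoid_alg_linP (f := mmul_alg (mmon 1%g)) (g := id)) => [||m] //.
  exact: mmul_algr.
by rewrite mmul_algU mul1g.
Qed.
Lemma mmul_algp1 : right_id (mmon 1%g) mmul_alg.
Proof.
apply: (monoid_alg_linP (f := mmul_alg^~ (mmon 1%g)) (g := id)) => [||m] //.
  exact: mmul_algl.
by rewrite mmul_algU mulg1.
Qed.
Lemma mmul_algDl : left_distributive mmul_alg +%R.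
Proof. by move=> p q r; rewrite (linPD (mmul_algl r)). Qed.
Lemma mmul_algDr : right_distributive mmul_alg +%R.
Proof. by move=> p q r; rewrite (linPD (mmul_algr p)). Qed.
Lemma mmul_alg_neq0 : mmon 1%g != 0.
Proof. by rewrite mmon.unlock monalgU_eq0 oner_eq0. Qed.

HB.instance Definition _ := GRing.Zmodule_isNzRing.Build kM
  mmul_algA mmul_alg1p mmul_algp1 mmul_algDl mmul_algDr mmul_alg_neq0.

Lemma mscaleAl (c : k) (p q : kM) : c *: (p * q) = (c *: p) * q.
Proof. by rewrite [RHS](linPZ _ (mmul_algl q)). Qed.
HB.instance Definition _ := GRing.Lmodule_isLalgebra.Build k kM mscaleAl.
Lemma mscaleAr (c : k) (p q : kM) : c *: (p * q) = p * (c *: q).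
Proof. by rewrite [RHS](linPZ _ (mmul_algr p)). Qed.
HB.instance Definition _ := GRing.Lalgebra_isAlgebra.Build k kM mscaleAr.

Lemma mmonM m n : mmon (m * n)%g = mmon m * mmon n.
Proof. by rewrite -mmul_algU. Qed.
Lemma mmon1 : mmon 1%g = 1. Proof. by []. Qed.

Lemma mext_monoid_morphism (A : algType k) (f : M -> A) :
  f 1%g = 1 -> (forall m n, f (m * n)%g = f m * f n) ->
  monoid_morphism (mext f : kM -> A).
Proof.
move=> f1 fM; split=> [|p q]; first by rewrite -mmon1 mext_mmon.
have el := mext_linear f.
move: p; apply: (monoid_alg_linP (f := fun p => mext f (p * q))
    (g := fun p => mext f p * mext f q)) => [||m].
- by apply: (linP_comp el); apply: linP_mulr.
- by apply: (linP_comp (linP_mulr _)).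
move: q; apply: (monoid_alg_linP (f := fun q => mext f (mmon m * q))
    (g := fun q => mext f (mmon m) * mext f q)) => [||n].
- by apply: (linP_comp el); apply: linP_mull.
- by apply: (linP_comp (linP_mull _)).
by rewrite -mmonM !mext_mmon fM.
Qed.

End MonoidAlg.

(* Proper two-sided ideals, and the quotient algebra. *)
Record pideal (k : fieldType) (A : algType k) := PIdeal {
  pideal_mem :> A -> Prop;
  pideal0 : pideal_mem 0;
  pidealD : forall x y, pideal_mem x -> pideal_mem y -> pideal_mem (x + y);
  pidealMl : forall a x, pideal_mem x -> pideal_mem (a * x);
  pidealMr : forall a x, pideal_mem x -> pideal_mem (x * a);
  pideal_proper : ~ pideal_mem 1
}.

Section Quotient.
Context (k : fieldType) (A : algType k) (I : pideal A).

Lemma pidealZ c x : I x -> I (c *: x).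
Proof. by move=> Ix; rewrite -[x]mul1r scalerAl; apply: pidealMl. Qed.
Lemma pidealN x : I x -> I (- x).
Proof. by move=> Ix; rewrite -scaleN1r; apply: pidealZ. Qed.

Definition pideal_eqv : rel A := fun x y => `[< I (x - y) >].

Lemma pideal_eqv_refl : reflexive pideal_eqv.
Proof. by move=> x; apply/asboolP; rewrite subrr; apply: pideal0. Qed.
Lemma pideal_eqv_sym : symmetric pideal_eqv.
Proof.
by move=> x y; apply/asboolP/asboolP => /pidealN; rewrite opprB.
Qed.
Lemma pideal_eqv_trans : transitive pideal_eqv.
Proof.
move=> y x z /asboolP xy /asboolP yz; apply/asboolP.
by rewrite -(subrK y x) -addrA; apply: pidealD.
Qed.

Canonical pideal_equiv :=
  EquivRel pideal_eqv pideal_eqv_refl pideal_eqv_sym pideal_eqv_trans.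

Definition quot := {eq_quot pideal_equiv}.
HB.instance Definition _ := Choice.on quot.

End Quotient.

HB.lock Definition qpi (k : fieldType) (A : algType k) (I : pideal A) (x : A) : quot I :=
  \pi_(quot I)%qT x.
HB.lock Definition qrepr (k : fieldType) (A : algType k) (I : pideal A) (u : quot I) : A :=
  generic_quotient.repr u.
HB.lock Definition qadd (k : fieldType) (A : algType k) (I : pideal A)
  (u v : quot I) : quot I := qpi I (qrepr u + qrepr v).
HB.lock Definition qopp (k : fieldType) (A : algType k) (I : pideal A)
  (u : quot I) : quot I := qpi I (- qrepr u).
HB.lock Definition qmul (k : fieldType) (A : algType k) (I : pideal A)
  (u v : quot I) : quot I := qpi I (qrepr u * qrepr v).
HB.lock Definition qscale (k : fieldType) (A : algType k) (I : pideal A)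
  (c : k) (u : quot I) : quot I := qpi I (c *: qrepr u).

Section QuotientAlg.
Context (k : fieldType) (A : algType k) (I : pideal A).
Local Notation quot := (quot I).
Local Notation qpi := (@qpi k A I).
Local Notation qrepr := (@qrepr k A I).
Local Notation qadd := (@qadd k A I).
Local Notation qopp := (@qopp k A I).
Local Notation qmul := (@qmul k A I).
Local Notation qscale := (@qscale k A I).

Lemma qreprK u : qpi (qrepr u) = u.
Proof. by rewrite qpi.unlock qrepr.unlock; apply: reprK. Qed.
Lemma qpiP x y : qpi x = qpi y <-> I (x - y).
Proof.
rewrite qpi.unlock; split=> [/eqP|Ixy]; first by rewrite eqmodE => /asboolP.
by apply/eqP; rewrite eqmodE; apply/asboolP.
Qed.
Lemma qrepr_pi x : I (qrepr (qpi x) - x).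
Proof. by apply/qpiP; rewrite qreprK. Qed.

Definition qlift (T : Type) (f : A -> T) (u : quot) : T := f (qrepr u).
Lemma qliftE (V : lmodType k) (f : A -> V) :
  linear f -> (forall x, I x -> f x = 0) -> forall x, qlift f (qpi x) = f x.
Proof.
move=> fl fI x; apply/eqP; rewrite -subr_eq0 -(linPB fl); apply/eqP/fI.
exact: qrepr_pi.
Qed.

Lemma qaddE x y : qadd (qpi x) (qpi y) = qpi (x + y).
Proof.
by rewrite qadd.unlock; apply/qpiP; rewrite opprD addrACA; apply: pidealD; apply: qrepr_pi.
Qed.
Lemma qoppE x : qopp (qpi x) = qpi (- x).
Proof. by rewrite qopp.unlock; apply/qpiP; rewrite -opprD; apply/pidealN/qrepr_pi. Qed.
Lemma qmulE x y : qmul (qpi x) (qpi y) = qpi (x * y).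
Proof.
rewrite qmul.unlock; apply/qpiP; rewrite -[X in X - _](subrK (x * qrepr (qpi y))) -mulrBl -addrA.
rewrite -mulrBr; apply: pidealD; last exact/pidealMl/qrepr_pi.
exact/pidealMr/qrepr_pi.
Qed.
Lemma qscaleE c x : qscale c (qpi x) = qpi (c *: x).
Proof. by rewrite qscale.unlock; apply/qpiP; rewrite -scalerBr; apply/pidealZ/qrepr_pi. Qed.

Lemma qpi_ind (P : quot -> Prop) : (forall x, P (qpi x)) -> forall u, P u.
Proof. by move=> Pp u; rewrite -[u]qreprK. Qed.

Lemma qaddA : associative qadd.
Proof.
elim/qpi_ind=> x; elim/qpi_ind=> y; elim/qpi_ind=> z.
by rewrite !qaddE addrA.
Qed.
Lemma qaddC : commutative qadd.
Proof. by elim/qpi_ind=> x; elim/qpi_ind=> y; rewrite !qaddE addrC. Qed.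
Lemma qadd0 : left_id (qpi 0) qadd.
Proof. by elim/qpi_ind=> x; rewrite qaddE add0r. Qed.
Lemma qaddN : left_inverse (qpi 0) qopp qadd.
Proof. by elim/qpi_ind=> x; rewrite qoppE qaddE addNr. Qed.
HB.instance Definition _ := GRing.isZmodule.Build quot qaddA qaddC qadd0 qaddN.

Lemma qpiD x y : qpi x + qpi y = qpi (x + y). Proof. exact: qaddE. Qed.

Lemma qmulA : associative qmul.
Proof.
elim/qpi_ind=> x; elim/qpi_ind=> y; elim/qpi_ind=> z.
by rewrite !qmulE mulrA.
Qed.
Lemma qmul1 : left_id (qpi 1) qmul.
Proof. by elim/qpi_ind=> x; rewrite qmulE mul1r. Qed.
Lemma qmulr1 : right_id (qpi 1) qmul.
Proof. by elim/qpi_ind=> x; rewrite qmulE mulr1. Qed.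
Lemma qmulDl : left_distributive qmul qadd.
Proof.
elim/qpi_ind=> x; elim/qpi_ind=> y; elim/qpi_ind=> z.
by rewrite !(qmulE, qaddE) mulrDl.
Qed.
Lemma qmulDr : right_distributive qmul qadd.
Proof.
elim/qpi_ind=> x; elim/qpi_ind=> y; elim/qpi_ind=> z.
by rewrite !(qmulE, qaddE) mulrDr.
Qed.
Lemma qone_neq0 : qpi 1 != qpi 0.
Proof. by apply/eqP => /qpiP; rewrite subr0; apply: pideal_proper. Qed.
HB.instance Definition _ := GRing.Zmodule_isNzRing.Build quot
  qmulA qmul1 qmulr1 qmulDl qmulDr qone_neq0.
Lemma qpiM x y : qpi x * qpi y = qpi (x * y). Proof. exact: qmulE. Qed.

Lemma qscaleA a b u : qscale a (qscale b u) = qscale (a * b) u.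
Proof. by elim/qpi_ind: u => x; rewrite !qscaleE scalerA. Qed.
Lemma qscale1 : left_id 1 qscale.
Proof. by elim/qpi_ind=> x; rewrite qscaleE scale1r. Qed.
Lemma qscaleDr : right_distributive qscale +%R.
Proof.
move=> c; elim/qpi_ind=> x; elim/qpi_ind=> y.
by rewrite !(qscaleE, qpiD) scalerDr.
Qed.
Lemma qscaleDl u : {morph qscale^~ u : a b / a + b}.
Proof. by elim/qpi_ind: u => x a b; rewrite !(qscaleE, qpiD) scalerDl. Qed.
HB.instance Definition _ := GRing.Zmodule_isLmodule.Build k quot
  qscaleA qscale1 qscaleDr qscaleDl.
Lemma qpiZ c x : c *: qpi x = qpi (c *: x). Proof. exact: qscaleE. Qed.

Lemma qscaleAl c (u v : quot) : c *: (u * v) = (c *: u) * v.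
Proof.
by elim/qpi_ind: u => x; elim/qpi_ind: v => y; rewrite !(qpiZ, qpiM) scalerAl.
Qed.
HB.instance Definition _ := GRing.Lmodule_isLalgebra.Build k quot qscaleAl.
Lemma qscaleAr c (u v : quot) : c *: (u * v) = u * (c *: v).
Proof.
by elim/qpi_ind: u => x; elim/qpi_ind: v => y; rewrite !(qpiZ, qpiM) scalerAr.
Qed.
HB.instance Definition _ := GRing.Lalgebra_isAlgebra.Build k quot qscaleAr.

Lemma qpi_linear : linear qpi.
Proof. by move=> c x y; rewrite qpiZ qpiD. Qed.
Lemma qpi_monoid_morphism : monoid_morphism qpi.
Proof. by split=> // x y; rewrite qpiM. Qed.
HB.instance Definition _ := GRing.isLinear.Build k A quot _ qpi qpi_linear.
HB.instance Definition _ := GRing.isMonoidMorphism.Build A quot qpi qpi_monoid_morphism.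

Lemma qlift_linear (V : lmodType k) (f : A -> V) :
  linear f -> (forall x, I x -> f x = 0) -> linear (qlift f).
Proof.
move=> fl fI c u v; elim/qpi_ind: u => x; elim/qpi_ind: v => y.
by rewrite qpiZ qpiD !qliftE // fl.
Qed.
Lemma qlift_monoid_morphism (B : algType k) (f : A -> B) :
  linear f -> monoid_morphism f -> (forall x, I x -> f x = 0) ->
  monoid_morphism (qlift f).
Proof.
move=> fl [f1 fM] fI; split; first by rewrite -(rmorph1 qpi) qliftE //.
by elim/qpi_ind=> x; elim/qpi_ind=> y; rewrite qpiM !qliftE // fM.
Qed.

End QuotientAlg.

(* The two-sided ideal generated by a set [S]. *)
Inductive ideal_span (k : fieldType) (A : algType k) (S : A -> Prop) : A -> Prop :=
| ideal_span0 : ideal_span S 0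
| ideal_span_cons a s b x : S s -> ideal_span S x -> ideal_span S (a * s * b + x).

Section IdealSpan.
Context (k : fieldType) (A : algType k) (S : A -> Prop).

Lemma ideal_spanD x y : ideal_span S x -> ideal_span S y -> ideal_span S (x + y).
Proof.
move=> + Sy; elim=> [|a s b {}x Ss _ IH]; first by rewrite add0r.
by rewrite -addrA; apply: ideal_span_cons.
Qed.
Lemma ideal_spanMl c x : ideal_span S x -> ideal_span S (c * x).
Proof.
elim=> [|a s b {}x Ss _ IH]; first by rewrite mulr0; apply: ideal_span0.
by rewrite mulrDr !mulrA; apply: ideal_span_cons.
Qed.
Lemma ideal_spanMr c x : ideal_span S x -> ideal_span S (x * c).
Proof.
elim=> [|a s b {}x Ss _ IH]; first by rewrite mul0r; apply: ideal_span0.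
by rewrite mulrDl -(mulrA (a * s)); apply: ideal_span_cons.
Qed.
Lemma ideal_span_in s : S s -> ideal_span S s.
Proof.
move=> Ss; rewrite -[s]addr0 -[s]mulr1 -[s]mul1r.
by apply: ideal_span_cons => //; apply: ideal_span0.
Qed.

Definition gen_ideal (proper : ~ ideal_span S 1) : pideal A :=
  PIdeal (ideal_span0 S) ideal_spanD ideal_spanMl ideal_spanMr proper.

Lemma ideal_span_kill (B : algType k) (f : A -> B) :
  linear f -> monoid_morphism f -> (forall s, S s -> f s = 0) ->
  forall x, ideal_span S x -> f x = 0.
Proof.
move=> fl [_ fM] fS x; elim=> [|a s b {}x Ss _ IH]; first exact: linP0.
by rewrite (linPD fl) IH !fM (fS s) // mulr0 mul0r addr0.
Qed.
End IdealSpan.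

(* The tensor product of two algebras: the free vector space on [A * B] modulo
   the bilinearity relations.  The product [(a, b) (a', b') = (a a', b b')]
   makes the free vector space a monoid algebra, and the linear span of the
   relations is already a two-sided ideal of it. *)
Section ProdMonoid.
Context (k : fieldType) (A B : algType k).

Definition pair_monoid : Type := (A * B)%type.
HB.instance Definition _ := Choice.on pair_monoid.

Definition pair_mul (x y : pair_monoid) : pair_monoid := (x.1 * y.1, x.2 * y.2).
Definition pair_one : pair_monoid := (1, 1).
Lemma pair_mulA : associative pair_mul.
Proof. by move=> x y z; rewrite /pair_mul !mulrA. Qed.
Lemma pair_mul1 : left_id pair_one pair_mul.
Proof. by case=> a b; rewrite /pair_mul !mul1r. Qed.
Lemma pair_mulr1 : right_id pair_one pair_mul.
Proof. by case=> a b; rewrite /pair_mul !mulr1. Qed.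
HB.instance Definition _ :=
  isMonoid.Build pair_monoid pair_mulA pair_mul1 pair_mulr1.

Definition pairmon (a : A) (b : B) : monoid_alg k pair_monoid :=
  mmon k ((a, b) : pair_monoid).

Inductive bilinear_rel : monoid_alg k pair_monoid -> Prop :=
| bilinear_rel_addl a a' b :
    bilinear_rel (pairmon (a + a') b - pairmon a b - pairmon a' b)
| bilinear_rel_addr a b b' :
    bilinear_rel (pairmon a (b + b') - pairmon a b - pairmon a b')
| bilinear_rel_scalel c a b : bilinear_rel (pairmon (c *: a) b - c *: pairmon a b)
| bilinear_rel_scaler c a b : bilinear_rel (pairmon a (c *: b) - c *: pairmon a b).

Definition bext (V : lmodType k) (beta : A -> B -> V) :
    monoid_alg k pair_monoid -> V :=
  mext (fun ab : pair_monoid => beta ab.1 ab.2).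

Lemma bext_pairmon (V : lmodType k) (beta : A -> B -> V) a b : bext beta (pairmon a b) = beta a b.
Proof. exact: mext_mmon. Qed.

Lemma bext_linear (V : lmodType k) (beta : A -> B -> V) : linear (bext beta).
Proof. exact: mext_linear. Qed.

Lemma bext_rel (V : lmodType k) (beta : A -> B -> V) : bilinear_map beta ->
  forall r, bilinear_rel r -> bext beta r = 0.
Proof.
move=> [bl br] _ [a a' b|a b b'|c a b|c a b];
  rewrite ?(linPB (bext_linear beta), linPZ _ (bext_linear beta)) !bext_pairmon.
- by rewrite (linPD (bl b)) /= addrAC addrK subrr.
- by rewrite (linPD (br a)) /= addrAC addrK subrr.
- by rewrite (linPZ _ (bl b)) subrr.
- by rewrite (linPZ _ (br a)) subrr.
Qed.

Lemma bext_span (V : lmodType k) (beta : A -> B -> V) : bilinear_map beta ->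
  forall x, ideal_span bilinear_rel x -> bext beta x = 0.
Proof.
move=> bil x; elim=> [|a s b {}x Ss _ IH]; first exact/linP0/bext_linear.
have el := @bext_linear _ beta.
rewrite (linPD el) IH addr0 {x IH}.
move: a; apply: (monoid_alg_linP (f := fun a => bext beta (a * s * b)) (g := fun=> 0)) => [||[a1 a2]].
- by apply: (linP_comp el); apply: (linP_comp (linP_mulr b)); apply: linP_mulr.
- by move=> c x y; rewrite scaler0 addr0.
move: b; apply: (monoid_alg_linP (f := fun b => bext beta (pairmon a1 a2 * s * b))
   (g := fun=> 0)) => [||[b1 b2]].
- by apply: (linP_comp el); apply: linP_mull.
- by move=> c x y; rewrite scaler0 addr0.
pose beta' a b := beta (a1 * a * b1) (a2 * b * b2).
have bil' : bilinear_map beta'.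
  case: bil => bl br; split=> [v|u].
    apply: (linP_comp (bl _)).
    by apply: (linP_comp (linP_mulr b1)); apply: linP_mull.
  apply: (linP_comp (br _)).
  by apply: (linP_comp (linP_mulr b2)); apply: linP_mull.
rewrite -(bext_rel bil' Ss); move: s {Ss}.
apply: (monoid_alg_linP (g := bext beta')) => [||[s1 s2]].
- by apply: (linP_comp el); apply: (linP_comp (linP_mulr _)); apply: linP_mull.
- exact: bext_linear.
by rewrite -!mmonM /bext !mext_mmon.
Qed.

Lemma bilinear_rel_proper : ~ ideal_span bilinear_rel 1.
Proof.
have [f [fl f1]] := @linear_form_exists k A 1 (oner_neq0 _).
have [g [gl g1]] := @linear_form_exists k B 1 (oner_neq0 _).
pose beta a b : k^o := f a * g b.
have bil : bilinear_map beta.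
  split=> [b|a].
    by apply: (linP_comp (g := fun x : k^o => x * g b)) => //; apply: (@linP_mulr k k^o).
  by apply: (linP_comp (g := fun x : k^o => f a * x)) => //; apply: (@linP_mull k k^o).
move=> /(bext_span bil); rewrite [bext _ _]bext_pairmon /beta f1 g1 mulr1.
by apply/eqP/oner_neq0.
Qed.

Definition bilinear_ideal := gen_ideal bilinear_rel_proper.
End ProdMonoid.

(* The algebra [tensor A B], the pure tensors [tens a b], and the map
   [tlift beta] on [tensor A B] induced by [beta] (meaningful when [beta] is
   bilinear, see [tliftE] below) are packed in one locked record, so that
   unification never unfolds the construction. *)
Record tensor_data (k : fieldType) (A B : algType k) := TensorData {
  tensor_alg : algType k;
  tensor_pure : A -> B -> tensor_alg;
  tensor_lift : forall V : lmodType k, (A -> B -> V) -> tensor_alg -> V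
}.

HB.lock Definition tensor_pack (k : fieldType) (A B : algType k) :=
  @TensorData k A B (quot (bilinear_ideal A B))
    (fun a b => qpi (bilinear_ideal A B) (pairmon a b))
    (fun V beta => qlift (bext beta)).

Section Tensor.
Context (k : fieldType).
Implicit Types A B C D : algType k.

Definition tensor A B : algType k := tensor_alg (tensor_pack A B).

Definition tens A B (a : A) (b : B) : tensor A B :=
  tensor_pure (tensor_pack A B) a b.

Definition tlift A B (V : lmodType k) (beta : A -> B -> V) (t : tensor A B) : V :=
  tensor_lift beta t.

Lemma tlift_spec A B (V : lmodType k) (beta : A -> B -> V) :
  bilinear_map beta ->
  linear (tlift beta) /\ forall a b, tlift beta (tens a b) = beta a b.
Proof.
move=> bil; rewrite /tlift /tens /tensor tensor_pack.unlock /=.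
have bl := @bext_linear _ _ _ _ beta; have b0 := bext_span bil.
split=> [|a b]; first exact: (qlift_linear (I := bilinear_ideal A B) bl b0).
by rewrite -[RHS](bext_pairmon beta); apply: (qliftE (I := bilinear_ideal A B) bl b0).
Qed.

Lemma tliftE A B (V : lmodType k) (beta : A -> B -> V) a b :
  bilinear_map beta -> tlift beta (tens a b) = beta a b.
Proof. by move=> /tlift_spec[]. Qed.

Lemma tlift_linear A B (V : lmodType k) (beta : A -> B -> V) :
  bilinear_map beta -> linear (tlift beta).
Proof. by move=> /tlift_spec[]. Qed.

Lemma tens_bilinear A B : bilinear_map (@tens A B).
Proof.
rewrite /tens /tensor tensor_pack.unlock /=.
have rel r : bilinear_rel r -> qpi (bilinear_ideal A B) r = 0.
  by move=> rr; apply/qpiP; rewrite subr0; apply: ideal_span_in.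
split=> [b c a a'|a c b b'].
  have /eqP := rel _ (bilinear_rel_scalel c a b).
  have /eqP := rel _ (bilinear_rel_addl (c *: a) a' b).
  rewrite !linearB linearZ /= !subr_eq0 subr_eq => /eqP Dab /eqP Zab.
  by rewrite Dab Zab addrC.
have /eqP := rel _ (bilinear_rel_scaler c a b).
have /eqP := rel _ (bilinear_rel_addr a (c *: b) b').
rewrite !linearB linearZ /= !subr_eq0 subr_eq => /eqP Dab /eqP Zab.
by rewrite Dab Zab addrC.
Qed.

Lemma tensM A B (a a' : A) (b b' : B) :
  tens a b * tens a' b' = tens (a * a') (b * b').
Proof. by rewrite /tens /tensor tensor_pack.unlock /= qpiM -mmonM. Qed.

Lemma tens1 A B : tens (1 : A) (1 : B) = 1.
Proof. by rewrite /tens /tensor tensor_pack.unlock. Qed.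

Lemma tensor_linP A B (V : lmodType k) (f g : tensor A B -> V) :
  linear f -> linear g -> (forall a b, f (tens a b) = g (tens a b)) -> f =1 g.
Proof.
move: f g; rewrite /tens /tensor tensor_pack.unlock /= => f g fl gl fg.
elim/qpi_ind=> x; move: x.
apply: (monoid_alg_linP (f := fun x => f (qpi _ x)) (g := fun x => g (qpi _ x))) => [||[a b]].
- by apply: (linP_comp fl); apply: qpi_linear.
- by apply: (linP_comp gl); apply: qpi_linear.
exact: fg.
Qed.

Definition tmap A B C D (f : A -> C) (g : B -> D) : tensor A B -> tensor C D :=
  tlift (fun a b => tens (f a) (g b)).

Definition tassoc A B C : tensor (tensor A B) C -> tensor A (tensor B C) :=
  tlift (fun t c => tlift (fun a b => tens a (tens b c)) t).

Definition tswap A B : tensor A B -> tensor B A := tlift (fun a b => tens b a).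

(* The span of the [a (x) b] with [a] in [P] and [b] in [Q]; for subspaces [P]
   and [Q], this is the image of their tensor product. *)
Definition tspan A B (P : A -> Prop) (Q : B -> Prop) (t : tensor A B) : Prop :=
  exists s : seq (A * B), (forall x, x \in s -> P x.1 /\ Q x.2) /\
    t = \sum_(x <- s) tens x.1 x.2.

End Tensor.

Section TensorMaps.
Context (k : fieldType).
Implicit Types A B C D E F : algType k.

Lemma tlift_morph A B C (beta : A -> B -> C) : bilinear_map beta ->
  beta 1 1 = 1 ->
  (forall a a' b b', beta (a * a') (b * b') = beta a b * beta a' b') ->
  monoid_morphism (tlift beta).
Proof.
move=> bil b1 bM; have tl := tlift_linear bil.
split=> [|t u]; first by rewrite -tens1 tliftE.
move: t; apply: (tensor_linP (f := fun t => tlift beta (t * u))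
    (g := fun t => tlift beta t * tlift beta u)) => [||a b].
- by apply: (linP_comp tl); apply: linP_mulr.
- by apply: (linP_comp (linP_mulr _)).
move: u; apply: (tensor_linP (f := fun u => tlift beta (tens a b * u))
    (g := fun u => tlift beta (tens a b) * tlift beta u)) => [||a' b'].
- by apply: (linP_comp tl); apply: linP_mull.
- by apply: (linP_comp (linP_mull _)).
by rewrite tensM !tliftE.
Qed.

Lemma tensl_linear A B (b : B) : linear (fun a : A => tens a b).
Proof. by case: (tens_bilinear A B) => /(_ b). Qed.
Lemma tensr_linear A B (a : A) : linear (fun b : B => tens a b).
Proof. by case: (tens_bilinear A B) => _ /(_ a). Qed.

Lemma tmap_bilinear A B C D (f : A -> C) (g : B -> D) : linear f -> linear g ->
  bilinear_map (fun a b => tens (f a) (g b)).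
Proof.
move=> fl gl; split=> [b|a].
  exact: (linP_comp (tensl_linear (g b))).
exact: (linP_comp (tensr_linear (f a))).
Qed.

Lemma tmapE A B C D (f : A -> C) (g : B -> D) a b : linear f -> linear g ->
  tmap f g (tens a b) = tens (f a) (g b).
Proof. by move=> fl gl; apply/tliftE/tmap_bilinear. Qed.

Lemma tmap_linear A B C D (f : A -> C) (g : B -> D) : linear f -> linear g ->
  linear (tmap f g).
Proof. by move=> fl gl; apply/tlift_linear/tmap_bilinear. Qed.

Lemma tmap_morph A B C D (f : A -> C) (g : B -> D) : linear f -> linear g ->
  monoid_morphism f -> monoid_morphism g -> monoid_morphism (tmap f g).
Proof.
move=> fl gl [f1 fM] [g1 gM]; apply: tlift_morph; first exact: tmap_bilinear.
- by rewrite f1 g1 tens1.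
by move=> a a' b b'; rewrite tensM fM gM.
Qed.

Lemma tassoc_bilinear_in A B C (c : C) :
  bilinear_map (fun (a : A) (b : B) => tens a (tens b c)).
Proof.
split=> [b|a]; first exact: tensl_linear.
exact: (linP_comp (tensr_linear a) (tensl_linear c)).
Qed.

Lemma tassoc_bilinear A B C : bilinear_map (fun (t : tensor A B) (c : C) =>
  tlift (fun a b => tens a (tens b c)) t).
Proof.
split=> [c|t]; first exact/tlift_linear/tassoc_bilinear_in.
move=> d c c'; pose F (c : C) (t : tensor A B) := tlift (fun a b => tens a (tens b c)) t.
have Fl c0 : linear (F c0) by apply/tlift_linear/tassoc_bilinear_in.
have FE c0 a b : F c0 (tens a b) = tens a (tens b c0).
  by apply/tliftE/tassoc_bilinear_in.
suff: F (d *: c + c') t = d *: F c t + F c' t by [].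
move: t; apply: (tensor_linP
    (g := fun t => d *: F c t + F c' t)) => [||a b].
- exact: Fl.
- exact: linP_comb.
by rewrite !FE (tensr_linear b) (tensr_linear a).
Qed.

Lemma tassocE A B C (a : A) (b : B) (c : C) :
  tassoc (tens (tens a b) c) = tens a (tens b c).
Proof.
rewrite /tassoc tliftE; last exact: tassoc_bilinear.
by rewrite tliftE //; apply: tassoc_bilinear_in.
Qed.

Lemma tassoc_linear A B C : linear (@tassoc k A B C).
Proof. exact/tlift_linear/tassoc_bilinear. Qed.

Lemma tassoc_morph A B C : monoid_morphism (@tassoc k A B C).
Proof.
apply: tlift_morph; first exact: tassoc_bilinear.
- by rewrite -(tens1 A B) (tliftE _ _ (tassoc_bilinear_in _ _ _)) !tens1.
move=> t t' c c'; have bil (c0 : C) := tassoc_bilinear_in A B c0.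
pose F (c : C) (t : tensor A B) := tlift (fun a b => tens a (tens b c)) t.
have Fl (c0 : C) : linear (F c0) by apply: tlift_linear.
suff: F (c * c') (t * t') = F c t * F c' t' by [].
move: t; apply: (tensor_linP
    (f := fun t => F (c * c') (t * t')) (g := fun t => F c t * F c' t')) => [||a b].
- by apply: (linP_comp (Fl _)); apply: linP_mulr.
- by apply: (linP_comp (linP_mulr _)).
move: t'; apply: (tensor_linP (f := fun t' => F (c * c') (tens a b * t'))
    (g := fun t' => F c (tens a b) * F c' t')) => [||a' b'].
- by apply: (linP_comp (Fl _)); apply: linP_mull.
- by apply: (linP_comp (linP_mull _)).
by rewrite tensM /F !tliftE // !tensM.
Qed.

Lemma tswap_bilinear A B : bilinear_map (fun (a : A) (b : B) => tens b a).
Proof. by split=> [b|a]; [apply: tensr_linear|apply: tensl_linear]. Qed.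

Lemma tlift_tmap A B C D (V : lmodType k) (beta : C -> D -> V)
    (f : A -> C) (g : B -> D) t :
  bilinear_map beta -> linear f -> linear g ->
  tlift beta (tmap f g t) = tlift (fun a b => beta (f a) (g b)) t.
Proof.
move=> bil fl gl.
have bil' : bilinear_map (fun a b => beta (f a) (g b)).
  by case: bil => bl br; split=> [b|a]; [apply: (linP_comp (bl _))|apply: (linP_comp (br _))].
move: t; apply: (tensor_linP (f := fun t => tlift beta (tmap f g t))) => [||a b].
- by apply: linP_comp; [apply: tlift_linear|apply: tmap_linear].
- exact: tlift_linear.
by rewrite tmapE // !tliftE.
Qed.

Lemma tmap_tmap A B C D E F (f : A -> C) (g : B -> D)
    (f' : C -> E) (g' : D -> F) t :
  linear f -> linear g -> linear f' -> linear g' ->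
  tmap f' g' (tmap f g t) = tmap (fun a => f' (f a)) (fun b => g' (g b)) t.
Proof. by move=> *; apply: tlift_tmap => //; apply: tmap_bilinear. Qed.

Lemma tassoc_tmap A B C A' B' C' (f : A -> A') (g : B -> B') (h : C -> C') t :
  linear f -> linear g -> linear h ->
  tassoc (tmap (tmap f g) h t) = tmap f (tmap g h) (tassoc t).
Proof.
move=> fl gl hl; have fgl := tmap_linear fl gl; have ghl := tmap_linear gl hl.
move: t; apply: (tensor_linP (f := fun t => tassoc (tmap (tmap f g) h t))
  (g := fun t => tmap f (tmap g h) (tassoc t))) => [||t c].
- by apply: linP_comp; [apply: tassoc_linear|apply: tmap_linear].
- by apply: linP_comp; [apply: tmap_linear|apply: tassoc_linear].
rewrite tmapE //; move: t; apply: (tensor_linP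
  (f := fun t => tassoc (tens (tmap f g t) (h c)))
  (g := fun t => tmap f (tmap g h) (tassoc (tens t c)))) => [||a b].
- apply: (linP_comp (@tassoc_linear _ _ _)).
  by apply: (linP_comp (tensl_linear _)).
- apply: (linP_comp (tmap_linear fl ghl)).
  by apply: (linP_comp (@tassoc_linear _ _ _)); apply: tensl_linear.
by rewrite tmapE // !tassocE tmapE // tmapE.
Qed.

Lemma tspan_sum A B (P : A -> Prop) (Q : B -> Prop) (V : lmodType k)
    (f : tensor A B -> V) t : linear f ->
  (forall a b, P a -> Q b -> f (tens a b) = 0) -> tspan P Q t -> f t = 0.
Proof.
move=> fl f0 [s [Ps ->]]; rewrite (linP_sum _ _ fl) big_seq.
by rewrite big1 // => x /Ps[? ?]; apply: f0.
Qed.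

End TensorMaps.

HB.mixin Record isHopf (k : fieldType) H of GRing.Algebra k H := {
  comul : H -> tensor H H;
  counit : H -> k;
  antipode : H -> H;
  comul_linear : linear comul;
  comul_morph : monoid_morphism comul;
  counit_linear : linear (counit : H -> k^o);
  counit_morph : monoid_morphism counit;
  antipode_linear : linear antipode;
  comulA : forall h, tassoc (tmap comul id (comul h)) = tmap id comul (comul h);
  counitl : forall h, tlift (fun a b => counit a *: b) (comul h) = h;
  counitr : forall h, tlift (fun a b => counit b *: a) (comul h) = h;
  antipodel : forall h, tlift (fun a b => antipode a * b) (comul h) = (counit h)%:A;
  antipoder : forall h, tlift (fun a b => a * antipode b) (comul h) = (counit h)%:A
}.

#[short(type="hopfType")]
HB.structure Definition Hopf (k : fieldType) :=
  { H of GRing.Algebra k H & isHopf k H }.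

Section HopfDefs.
Context (k : fieldType).
Implicit Types H K : hopfType k.

Definition cocommutative H : Prop :=
  forall h : H, tswap (comul h) = comul h.

Definition hopf_hom H K (f : H -> K) : Prop :=
  [/\ linear f, monoid_morphism f,
      forall h, comul (f h) = tmap f f (comul h),
      forall h, counit (f h) = counit h &
      forall h, f (antipode h) = antipode (f h)].

Definition hopf_iso H K : Prop :=
  exists f : H -> K, hopf_hom f /\ bijective f.

(* Properness of the underlying ideal is automatic, since the counit of a
   Hopf ideal vanishes and [counit 1 = 1]. *)
Record hopf_ideal H := HopfIdeal {
  hopf_pideal :> pideal H;
  hopf_ideal_comul : forall x, hopf_pideal x -> exists u v,
    [/\ comul x = u + v, tspan hopf_pideal (fun=> True) u &
        tspan (fun=> True) hopf_pideal v];
  hopf_ideal_counit : forall x, hopf_pideal x -> counit x = 0;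
  hopf_ideal_antipode : forall x, hopf_pideal x -> hopf_pideal (antipode x)
}.

Definition hopf_subalgebra H (P : H -> Prop) : Prop :=
  [/\ P 1, forall (c : k) x y, P x -> P y -> P (c *: x + y),
      forall x y, P x -> P y -> P (x * y),
      forall x, P x -> tspan P P (comul x) &
      forall x, P x -> P (antipode x)].

End HopfDefs.

Section BilinearMaps.
Context (k : fieldType).

Lemma bilinear_scalel (A B : algType k) (e : A -> k) :
  linear (e : A -> k^o) -> bilinear_map (fun (a : A) (b : B) => e a *: b).
Proof.
move=> eel; split=> [b|a]; last exact: linP_scaler.
exact: (linP_comp (linP_scale b) eel).
Qed.
Lemma bilinear_scaler (A B : algType k) (e : A -> k) :
  linear (e : A -> k^o) -> bilinear_map (fun (b : B) (a : A) => e a *: b).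
Proof.
move=> eel; split=> [a|b]; first exact: linP_scaler.
exact: (linP_comp (linP_scale b) eel).
Qed.
Lemma bilinear_Sl (A : algType k) (S : A -> A) :
  linear S -> bilinear_map (fun a b => S a * b).
Proof.
move=> Sl; split=> [b|a]; last exact: linP_mull.
exact: (linP_comp (linP_mulr b) Sl).
Qed.
Lemma bilinear_Sr (A : algType k) (S : A -> A) :
  linear S -> bilinear_map (fun a b => a * S b).
Proof.
move=> Sl; split=> [b|a]; first exact: linP_mulr.
exact: (linP_comp (linP_mull a) Sl).
Qed.
End BilinearMaps.

Section HopfQuotient.
Context (k : fieldType) (H : hopfType k) (I : hopf_ideal H).

Definition hopf_quot := quot I.
HB.instance Definition _ := GRing.Algebra.on hopf_quot.
Local Notation Q := hopf_quot.
Local Notation p := (qpi I : H -> Q).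

Let pl : linear p. Proof. exact: qpi_linear. Qed.
Let pm : monoid_morphism p. Proof. exact: qpi_monoid_morphism. Qed.
Let p0 x : I x -> p x = 0.
Proof. by move=> Ix; apply/qpiP; rewrite subr0. Qed.

Definition hq_comul : Q -> tensor Q Q := qlift (fun h => tmap p p (comul h)).
Definition hq_counit : Q -> k := qlift counit.
Definition hq_antipode : Q -> Q := qlift (fun h => p (antipode h)).

Let cl : linear (fun h => tmap p p (comul h)).
Proof. by apply: linP_comp; [apply: tmap_linear|apply: comul_linear]. Qed.
Let c0 x : I x -> tmap p p (comul x) = 0.
Proof.
have tl := tmap_linear pl pl.
move=> /hopf_ideal_comul[u [v [-> Pu Pv]]]; rewrite (linPD tl).
rewrite (tspan_sum tl _ Pu) ?(tspan_sum tl _ Pv) ?addr0 // => a b.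
  by move=> _ /p0 b0; rewrite tmapE // b0 (linP0 (tensr_linear _)).
by move=> /p0 a0 _; rewrite tmapE // a0 (linP0 (tensl_linear _)).
Qed.
Let sl : linear (fun h => p (antipode h)).
Proof. exact: (linP_comp pl (@antipode_linear _ H)). Qed.
Let s0 x : I x -> p (antipode x) = 0.
Proof. by move=> /hopf_ideal_antipode/p0. Qed.
Let el : linear (counit : H -> k^o). Proof. exact: counit_linear. Qed.
Let e0 x : I x -> (counit : H -> k^o) x = 0.
Proof. exact: hopf_ideal_counit. Qed.

Let hq_comulE x : hq_comul (p x) = tmap p p (comul x).
Proof. exact: qliftE cl c0 x. Qed.
Let hq_counitE x : hq_counit (p x) = counit x.
Proof. exact: qliftE el e0 x. Qed.
Let hq_antipodeE x : hq_antipode (p x) = p (antipode x).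
Proof. exact: qliftE sl s0 x. Qed.

Lemma hq_comul_linear : linear hq_comul.
Proof. exact: qlift_linear cl c0. Qed.
Lemma hq_comul_morph : monoid_morphism hq_comul.
Proof.
apply: (qlift_monoid_morphism cl) => [|x]; last exact: c0.
have [cm1 cmM] := @comul_morph _ H; have [t1 tM] := tmap_morph pl pl pm pm.
by split=> [|x y]; rewrite ?cm1 ?t1 ?cmM ?tM.
Qed.
Lemma hq_counit_linear : linear (hq_counit : Q -> k^o).
Proof. exact: qlift_linear el e0. Qed.
Lemma hq_counit_morph : monoid_morphism hq_counit.
Proof. exact: (qlift_monoid_morphism (B := k^o) el (@counit_morph _ H) e0). Qed.
Lemma hq_antipode_linear : linear hq_antipode.
Proof. exact: qlift_linear sl s0. Qed.

Lemma hq_comulA h :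
  tassoc (tmap hq_comul id (hq_comul h)) = tmap id hq_comul (hq_comul h).
Proof.
have dl := hq_comul_linear; have Dl := @comul_linear _ H.
elim/qpi_ind: h => x; rewrite -/(p x) hq_comulE.
rewrite !tmap_tmap //.
transitivity (tassoc (tmap (tmap p p) p (tmap comul id (comul x)))).
  rewrite tmap_tmap //; last exact: tmap_linear.
  congr tassoc; congr (tmap _ _ _); apply/funext=> a; exact: hq_comulE.
rewrite tassoc_tmap // comulA tmap_tmap //; last exact: tmap_linear.
by congr (tmap _ _ _); apply/funext=> a; rewrite hq_comulE.
Qed.

Let push (beta : H -> H -> H) (gam : Q -> Q -> Q) t :
  bilinear_map beta -> bilinear_map gam ->
  (forall a b, gam (p a) (p b) = p (beta a b)) ->
  tlift gam (tmap p p t) = p (tlift beta t).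
Proof.
move=> bb bg bgE; rewrite tlift_tmap //.
have bil : bilinear_map (fun a b => gam (p a) (p b)).
  by case: bg => bl br; split=> [b|a]; [apply: (linP_comp (bl _))|apply: (linP_comp (br _))].
move: t; apply: tensor_linP => [||a b].
- exact: tlift_linear.
- by apply: (linP_comp pl); apply: tlift_linear.
by rewrite !tliftE.
Qed.

Lemma hq_counitl h : tlift (fun a b => hq_counit a *: b) (hq_comul h) = h.
Proof.
elim/qpi_ind: h => x; rewrite -/(p x) hq_comulE.
rewrite (push (beta := fun a b => counit a *: b)) ?counitl //.
- exact: bilinear_scalel.
- exact/bilinear_scalel/hq_counit_linear.
by move=> a b; rewrite hq_counitE -(linPZ _ pl).
Qed.
Lemma hq_counitr h : tlift (fun a b => hq_counit b *: a) (hq_comul h) = h.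
Proof.
elim/qpi_ind: h => x; rewrite -/(p x) hq_comulE.
rewrite (push (beta := fun a b => counit b *: a)) ?counitr //.
- exact: bilinear_scaler.
- exact/bilinear_scaler/hq_counit_linear.
by move=> a b; rewrite hq_counitE -(linPZ _ pl).
Qed.
Lemma hq_antipodel h :
  tlift (fun a b => hq_antipode a * b) (hq_comul h) = (hq_counit h)%:A.
Proof.
elim/qpi_ind: h => x; rewrite -/(p x) hq_comulE hq_counitE.
rewrite (push (beta := fun a b => antipode a * b)) ?antipodel.
- by rewrite (linPZ _ pl) pm.1.
- exact/bilinear_Sl/antipode_linear.
- exact/bilinear_Sl/hq_antipode_linear.
by move=> a b; rewrite hq_antipodeE pm.2.
Qed.
Lemma hq_antipoder h :
  tlift (fun a b => a * hq_antipode b) (hq_comul h) = (hq_counit h)%:A.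
Proof.
elim/qpi_ind: h => x; rewrite -/(p x) hq_comulE hq_counitE.
rewrite (push (beta := fun a b => a * antipode b)) ?antipoder.
- by rewrite (linPZ _ pl) pm.1.
- exact/bilinear_Sr/antipode_linear.
- exact/bilinear_Sr/hq_antipode_linear.
by move=> a b; rewrite hq_antipodeE pm.2.
Qed.

HB.instance Definition _ := isHopf.Build k Q hq_comul_linear hq_comul_morph
  hq_counit_linear hq_counit_morph hq_antipode_linear hq_comulA
  hq_counitl hq_counitr hq_antipodel hq_antipoder.

End HopfQuotient.

Definition group_alg (k : fieldType) (G : groupType) := monoid_alg k G.

Section GroupAlg.
Context (k : fieldType) (G : groupType).
Local Notation kG := (group_alg k G).
HB.instance Definition _ := GRing.Algebra.on kG.
Local Notation e := (@mmon k G : G -> kG).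

Definition ga_comul : kG -> tensor kG kG := mext (fun g : G => tens (e g) (e g)).
Definition ga_counit : kG -> k := mext (fun _ : G => 1 : k^o).
Definition ga_antipode : kG -> kG := mext (fun g : G => e g^-1%g).

Lemma ga_comulE g : ga_comul (e g) = tens (e g) (e g).
Proof. exact: mext_mmon. Qed.
Lemma ga_counitE g : ga_counit (e g) = 1.
Proof. exact: (@mext_mmon k G k^o). Qed.
Lemma ga_antipodeE g : ga_antipode (e g) = e g^-1%g.
Proof. exact: mext_mmon. Qed.

Lemma ga_comul_linear : linear ga_comul.
Proof. exact: mext_linear. Qed.
Lemma ga_comul_morph : monoid_morphism ga_comul.
Proof.
apply: mext_monoid_morphism => [|g h]; first by rewrite mmon1 tens1.
by rewrite tensM -mmonM.
Qed.
Lemma ga_counit_linear : linear (ga_counit : kG -> k^o).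
Proof. exact: mext_linear. Qed.
Lemma ga_counit_morph : monoid_morphism ga_counit.
Proof.
apply: (@mext_monoid_morphism k G k^o) => // g h.
by rewrite mulr1.
Qed.
Lemma ga_antipode_linear : linear ga_antipode.
Proof. exact: mext_linear. Qed.

Lemma ga_comulA h :
  tassoc (tmap ga_comul id (ga_comul h)) = tmap id ga_comul (ga_comul h).
Proof.
have dl := ga_comul_linear.
move: h; apply: (monoid_alg_linP
  (f := fun h => tassoc (tmap ga_comul id (ga_comul h)))
  (g := fun h => tmap id ga_comul (ga_comul h))) => [||g].
- apply: (linP_comp (@tassoc_linear _ _ _ _)).
  by apply: linP_comp => //; apply: tmap_linear.
- by apply: linP_comp => //; apply: tmap_linear.
by rewrite ga_comulE !tmapE // ga_comulE tassocE.
Qed.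

Let ext (beta : kG -> kG -> kG) (u : kG -> kG) : bilinear_map beta -> linear u ->
  (forall g, beta (e g) (e g) = u (e g)) -> forall h, tlift beta (ga_comul h) = u h.
Proof.
move=> bil ul bu; apply: (monoid_alg_linP (f := fun h => tlift beta (ga_comul h))) => // [|g].
  by apply: linP_comp; [apply: tlift_linear|apply: ga_comul_linear].
by rewrite ga_comulE tliftE.
Qed.

Lemma ga_counitl h : tlift (fun a b => ga_counit a *: b) (ga_comul h) = h.
Proof.
apply: (ext (u := id)) => //; first exact/bilinear_scalel/ga_counit_linear.
by move=> g; rewrite ga_counitE scale1r.
Qed.
Lemma ga_counitr h : tlift (fun a b => ga_counit b *: a) (ga_comul h) = h.
Proof.
apply: (ext (u := id)) => //; first exact/bilinear_scaler/ga_counit_linear.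
by move=> g; rewrite ga_counitE scale1r.
Qed.
Lemma ga_antipodel h :
  tlift (fun a b => ga_antipode a * b) (ga_comul h) = (ga_counit h)%:A.
Proof.
apply: (ext (u := fun h => (ga_counit h)%:A)).
- exact/bilinear_Sl/ga_antipode_linear.
- exact: (linP_comp (linP_scale (1 : kG)) ga_counit_linear).
by move=> g; rewrite ga_antipodeE ga_counitE -mmonM mulVg scale1r.
Qed.
Lemma ga_antipoder h :
  tlift (fun a b => a * ga_antipode b) (ga_comul h) = (ga_counit h)%:A.
Proof.
apply: (ext (u := fun h => (ga_counit h)%:A)).
- exact/bilinear_Sr/ga_antipode_linear.
- exact: (linP_comp (linP_scale (1 : kG)) ga_counit_linear).
by move=> g; rewrite ga_antipodeE ga_counitE -mmonM mulgV scale1r.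
Qed.

HB.instance Definition _ := isHopf.Build k kG ga_comul_linear ga_comul_morph
  ga_counit_linear ga_counit_morph ga_antipode_linear ga_comulA
  ga_counitl ga_counitr ga_antipodel ga_antipoder.
End GroupAlg.

(* The group Z^2, written multiplicatively. *)
Definition Zsq : Type := (int * int)%type.
HB.instance Definition _ := Choice.on Zsq.
Section Zsq.
Definition Zsq_mul (u v : Zsq) : Zsq := (u.1 + v.1, u.2 + v.2).
Definition Zsq_one : Zsq := (0, 0).
Definition Zsq_inv (u : Zsq) : Zsq := (- u.1, - u.2).
Lemma Zsq_mulA : associative Zsq_mul.
Proof. by move=> u v w; rewrite /Zsq_mul !addrA. Qed.
Lemma Zsq_mul1 : left_id Zsq_one Zsq_mul.
Proof. by case=> a b; rewrite /Zsq_mul !add0r. Qed.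
Lemma Zsq_mulr1 : right_id Zsq_one Zsq_mul.
Proof. by case=> a b; rewrite /Zsq_mul !addr0. Qed.
Lemma Zsq_mulV : left_inverse Zsq_one Zsq_inv Zsq_mul.
Proof. by case=> a b; rewrite /Zsq_mul !addNr. Qed.
Lemma Zsq_mulrV : right_inverse Zsq_one Zsq_inv Zsq_mul.
Proof. by case=> a b; rewrite /Zsq_mul !subrr. Qed.
HB.instance Definition _ :=
  isGroup.Build Zsq Zsq_mulA Zsq_mul1 Zsq_mulr1 Zsq_mulV Zsq_mulrV.
End Zsq.

(* The group presented by generators [X] and relations [u = v] for [(u, v)] in
   [R].  Words are lists of letters, [(x, true)] standing for [x] and
   [(x, false)] for its inverse. *)
Section PresentedGroup.
Context (X : choiceType).
Local Notation word := (seq (X * bool)).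
Context (R : seq (word * word)).

Inductive word_eqv : word -> word -> Prop :=
| word_eqv_refl u : word_eqv u u
| word_eqv_sym u v : word_eqv u v -> word_eqv v u
| word_eqv_trans u v w : word_eqv u v -> word_eqv v w -> word_eqv u w
| word_eqv_cat u u' v v' :
    word_eqv u u' -> word_eqv v v' -> word_eqv (u ++ v) (u' ++ v')
| word_eqv_cancel x b : word_eqv [:: (x, b); (x, ~~ b)] [::]
| word_eqv_rel u v : (u, v) \in R -> word_eqv u v.

Definition word_eqvb : rel word := fun u v => `[< word_eqv u v >].
Lemma word_eqvb_refl : reflexive word_eqvb.
Proof. by move=> u; apply/asboolP/word_eqv_refl. Qed.
Lemma word_eqvb_sym : symmetric word_eqvb.
Proof. by move=> u v; apply/asboolP/asboolP; apply: word_eqv_sym. Qed.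
Lemma word_eqvb_trans : transitive word_eqvb.
Proof.
by move=> v u w /asboolP uv /asboolP vw; apply/asboolP/(word_eqv_trans uv vw).
Qed.
Canonical word_equiv :=
  EquivRel word_eqvb word_eqvb_refl word_eqvb_sym word_eqvb_trans.

Definition presented_group := {eq_quot word_equiv}.
HB.instance Definition _ := Choice.on presented_group.

Definition pgpi (u : word) : presented_group := \pi_presented_group%qT u.
Definition pgrepr (g : presented_group) : word := generic_quotient.repr g.

Lemma pgP u v : pgpi u = pgpi v <-> word_eqv u v.
Proof.
split=> [/eqP|uv]; first by rewrite eqmodE => /asboolP.
by apply/eqP; rewrite eqmodE; apply/asboolP.
Qed.
Lemma pgreprK g : pgpi (pgrepr g) = g. Proof. exact: reprK. Qed.
Lemma pgrepr_pi u : word_eqv (pgrepr (pgpi u)) u.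
Proof. by apply/pgP; rewrite pgreprK. Qed.
Lemma pg_ind (P : presented_group -> Prop) : (forall u, P (pgpi u)) -> forall g, P g.
Proof. by move=> Pp g; rewrite -[g]pgreprK. Qed.

Definition word_inv (u : word) : word := rev [seq (x.1, ~~ x.2) | x <- u].

Lemma word_invK : involutive word_inv.
Proof.
move=> u; rewrite /word_inv map_rev revK -map_comp -[RHS]map_id.
by apply: eq_map => -[x b] /=; rewrite negbK.
Qed.
Lemma word_mulV u : word_eqv (u ++ word_inv u) [::].
Proof.
elim: u => [|[x b] u IH]; first exact: word_eqv_refl.
have -> : ((x, b) :: u) ++ word_inv ((x, b) :: u) =
    [:: (x, b)] ++ (u ++ word_inv u) ++ [:: (x, ~~ b)].
  by rewrite /word_inv /= rev_cons -cats1 catA.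
apply: word_eqv_trans (word_eqv_cancel x b).
apply: (word_eqv_cat (word_eqv_refl [:: (x, b)])).
exact: (word_eqv_cat IH (word_eqv_refl [:: (x, ~~ b)])).
Qed.
Lemma word_Vmul u : word_eqv (word_inv u ++ u) [::].
Proof. by have := word_mulV (word_inv u); rewrite word_invK. Qed.
Lemma word_eqv_inv u v : word_eqv u v -> word_eqv (word_inv u) (word_inv v).
Proof.
move=> uv; have r := word_eqv_refl.
have h1 : word_eqv (word_inv u) (word_inv u ++ v ++ word_inv v).
  rewrite -[X in word_eqv X _]cats0; apply: word_eqv_cat => //.
  exact/word_eqv_sym/word_mulV.
apply: word_eqv_trans h1 _; rewrite catA -[X in word_eqv _ X]cat0s.
apply: word_eqv_cat => //; apply: word_eqv_trans (word_Vmul u).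
by apply: word_eqv_cat => //; apply: word_eqv_sym.
Qed.

Definition pg_mul g h := pgpi (pgrepr g ++ pgrepr h).
Definition pg_one := pgpi [::].
Definition pg_inv g := pgpi (word_inv (pgrepr g)).

Lemma pg_mulE u v : pg_mul (pgpi u) (pgpi v) = pgpi (u ++ v).
Proof. by apply/pgP/word_eqv_cat; apply: pgrepr_pi. Qed.
Lemma pg_invE u : pg_inv (pgpi u) = pgpi (word_inv u).
Proof. by apply/pgP/word_eqv_inv/pgrepr_pi. Qed.

Lemma pg_mulA : associative pg_mul.
Proof.
by elim/pg_ind=> u; elim/pg_ind=> v; elim/pg_ind=> w; rewrite !pg_mulE catA.
Qed.
Lemma pg_mul1 : left_id pg_one pg_mul.
Proof. by elim/pg_ind=> u; rewrite pg_mulE. Qed.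
Lemma pg_mulr1 : right_id pg_one pg_mul.
Proof. by elim/pg_ind=> u; rewrite pg_mulE cats0. Qed.
Lemma pg_mulV : left_inverse pg_one pg_inv pg_mul.
Proof. by elim/pg_ind=> u; rewrite pg_invE pg_mulE; apply/pgP/word_Vmul. Qed.
Lemma pg_mulrV : right_inverse pg_one pg_inv pg_mul.
Proof. by elim/pg_ind=> u; rewrite pg_invE pg_mulE; apply/pgP/word_mulV. Qed.
HB.instance Definition _ :=
  isGroup.Build presented_group pg_mulA pg_mul1 pg_mulr1 pg_mulV pg_mulrV.
End PresentedGroup.

(* <f, g | f^2 = g^2>, with f = 0 and g = 1 in 'I_2. *)
Definition Gamma : groupType :=
  presented_group [:: ([:: (0 : 'I_2, true); (0, true)],
                       [:: (1 : 'I_2, true); (1, true)])].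

HB.instance Definition _ (X : choiceType) :=
  isMonoid.Build (fmonom X) (@mulmA (fmonom X)) (@mul1m (fmonom X)) (@mulm1 (fmonom X)).

Section FreeAlg.
Context (k : fieldType) (X : choiceType).

Definition free_alg : algType k := monoid_alg k (fmonom X).
Definition fgen (x : X) : free_alg := mmon k (fmu x : fmonom X).

Definition free_lift (A : algType k) (f : X -> A) : free_alg -> A :=
  mext (fun w : fmonom X => \prod_(x <- (w : seq X)) f x).

(* The anti-homomorphism extending [f]. *)
Definition free_antilift (A : algType k) (f : X -> A) : free_alg -> A :=
  mext (fun w : fmonom X => \prod_(x <- rev (w : seq X)) f x).

Lemma free_lift_linear (A : algType k) (f : X -> A) : linear (free_lift f).
Proof. exact: mext_linear. Qed.
Lemma free_lift_morph (A : algType k) (f : X -> A) : monoid_morphism (free_lift f).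
Proof.
apply: mext_monoid_morphism => [|v w]; first by rewrite fm1 big_nil.
by rewrite fmM big_cat.
Qed.
Lemma free_lift_gen (A : algType k) (f : X -> A) x : free_lift f (fgen x) = f x.
Proof. by rewrite [LHS]mext_mmon fmuE big_seq1. Qed.

Lemma free_antilift_linear (A : algType k) (f : X -> A) : linear (free_antilift f).
Proof. exact: mext_linear. Qed.
Lemma free_antilift1 (A : algType k) (f : X -> A) : free_antilift f 1 = 1.
Proof. by rewrite -[1]mmon1 [LHS]mext_mmon fm1 big_nil. Qed.
Lemma free_antilift_gen (A : algType k) (f : X -> A) x :
  free_antilift f (fgen x) = f x.
Proof. by rewrite [LHS]mext_mmon fmuE big_seq1. Qed.
Lemma free_antiliftM (A : algType k) (f : X -> A) p q :
  free_antilift f (p * q) = free_antilift f q * free_antilift f p.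
Proof.
have fl := free_antilift_linear f.
move: p; apply: (monoid_alg_linP (f := fun p => free_antilift f (p * q))
    (g := fun p => free_antilift f q * free_antilift f p)) => [||v].
- by apply: (linP_comp fl); apply: linP_mulr.
- by apply: (linP_comp (linP_mull _)).
move: q; apply: (monoid_alg_linP (f := fun q => free_antilift f (mmon k v * q))
    (g := fun q => free_antilift f q * free_antilift f (mmon k v))) => [||w].
- by apply: (linP_comp fl); apply: linP_mull.
- by apply: (linP_comp (linP_mulr _)).
rewrite -mmonM /free_antilift !mext_mmon.
by rewrite fmM rev_cat big_cat.
Qed.

Lemma free_ind (V : lmodType k) (f g : free_alg -> V) :
  linear f -> linear g -> f 1 = g 1 ->
  (forall x p, f p = g p -> f (fgen x * p) = g (fgen x * p)) -> f =1 g.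
Proof.
move=> fl gl fg1 fgM; apply: monoid_alg_linP => // -[w].
elim: w => [|x w IH].
  have -> : mmon k (FMonom [::] : fmonom X) = 1 by rewrite -[1]mmon1 -fmoneE.
  exact: fg1.
have -> : mmon k (FMonom (x :: w)) = fgen x * mmon k (FMonom w).
  by rewrite -mmonM; congr mmon; rewrite [RHS]fmmulE fmuE.
exact: fgM.
Qed.
End FreeAlg.

(* A character of the free algebra killing the relations shows that the ideal
   they generate is proper. *)
Lemma ideal_span_proper (k : fieldType) (A : algType k) (S : A -> Prop) (f : A -> k^o) :
  linear f -> monoid_morphism f -> (forall s, S s -> f s = 0) -> ~ ideal_span S 1.
Proof.
move=> fl fm fS /(ideal_span_kill fl fm fS); rewrite fm.1.
by apply/eqP/oner_neq0.
Qed.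

(* A_q(2): x_1, x_2 are the classes of [fgen 0] and [fgen 1]. *)
Section QuantumPlane.
Context (k : fieldType) (q : k).
Local Notation x1 := (fgen k (0 : 'I_2)).
Local Notation x2 := (fgen k (1 : 'I_2)).

Definition qplane_rel (r : free_alg k 'I_2) : Prop := r = x2 * x1 - q *: (x1 * x2).

Lemma qplane_proper : ~ ideal_span qplane_rel 1.
Proof.
pose f := free_lift (fun _ : 'I_2 => 0 : k^o).
have fl : linear f := free_lift_linear _.
have fm : monoid_morphism f := free_lift_morph _.
have fg i : f (fgen k i) = 0 by exact: free_lift_gen.
apply: (ideal_span_proper fl fm) => _ ->.
by rewrite (linPB fl) (linPZ _ fl) !fm.2 !fg mul0r scaler0 subrr.
Qed.

Definition qplane : algType k := quot (gen_ideal qplane_proper).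

(* Degree-n component: classes of combinations of words of length n. *)
Definition qplane_deg (n : nat) (a : qplane) : Prop :=
  exists p : {malg k[fmonom 'I_2]},
    (forall w, w \in msupp p -> fdeg w = n) /\ a = qpi (gen_ideal qplane_proper) p.
End QuantumPlane.

(* A(0,q): x, x^-1, y are the classes of [fgen 0], [fgen 1] and [fgen 2]. *)
Section A0.
Context (k : fieldType) (q : k).
Local Notation F := (free_alg k 'I_3).
Local Notation fx := (fgen k (0 : 'I_3)).
Local Notation fx' := (fgen k (1 : 'I_3)).
Local Notation fy := (fgen k (2 : 'I_3)).

Inductive A0_rel : F -> Prop :=
| A0_rel_xV : A0_rel (fx * fx' - 1)
| A0_rel_Vx : A0_rel (fx' * fx - 1)
| A0_rel_yx : A0_rel (fy * fx - q *: (fx * fy)).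

Definition A0_counit_gen (i : 'I_3) : k^o := [:: 1; 1; 0]`_i.

Let efl : linear (free_lift A0_counit_gen). Proof. exact: free_lift_linear. Qed.
Let efm : monoid_morphism (free_lift A0_counit_gen).
Proof. exact: free_lift_morph. Qed.
Let efr r : A0_rel r -> free_lift A0_counit_gen r = 0.
Proof.
case; rewrite (linPB efl) ?(linPZ _ efl) ?efm.1 !efm.2 !free_lift_gen
  /A0_counit_gen /=; by rewrite ?mulr1 ?mul1r ?mulr0 ?scaler0 ?subrr.
Qed.

Lemma A0_proper : ~ ideal_span A0_rel 1.
Proof. exact: (ideal_span_proper efl efm). Qed.
Local Notation I := (gen_ideal A0_proper).

Definition A0 := quot I.
HB.instance Definition _ := GRing.Algebra.on A0.

Local Notation p := (qpi I : F -> A0).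
Definition A0_x : A0 := p fx.
Definition A0_xV : A0 := p fx'.
Definition A0_y : A0 := p fy.

Let pl : linear p. Proof. exact: qpi_linear. Qed.
Let pm : monoid_morphism p. Proof. exact: qpi_monoid_morphism. Qed.
Let pr r : A0_rel r -> p r = 0.
Proof. by move=> rr; apply/qpiP; rewrite subr0; apply: ideal_span_in. Qed.

Lemma A0_xVE : A0_x * A0_xV = 1.
Proof.
apply/eqP; rewrite -subr_eq0 -pm.1 -pm.2 -(linPB pl).
by apply/eqP/pr; constructor.
Qed.
Lemma A0_VxE : A0_xV * A0_x = 1.
Proof.
apply/eqP; rewrite -subr_eq0 -pm.1 -pm.2 -(linPB pl).
by apply/eqP/pr; constructor.
Qed.
Lemma A0_yxE : A0_y * A0_x = q *: (A0_x * A0_y).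
Proof.
apply/eqP; rewrite -subr_eq0 -!pm.2 -(linPZ _ pl) -(linPB pl).
by apply/eqP/pr; constructor.
Qed.
Lemma A0_VyE : A0_xV * A0_y = q *: (A0_y * A0_xV).
Proof.
rewrite -[A0_xV * A0_y]mulr1 -A0_xVE mulrA -(mulrA A0_xV) A0_yxE.
by rewrite -scalerAr mulrA A0_VxE mul1r -scalerAl.
Qed.

Definition A0_comul_gen (i : 'I_3) : tensor A0 A0 :=
  [:: tens A0_x A0_x; tens A0_xV A0_xV; tens A0_y 1 + tens 1 A0_y]`_i.
Definition A0_antipode_gen (i : 'I_3) : A0 := [:: A0_xV; A0_x; - A0_y]`_i.

Definition A0_comul : A0 -> tensor A0 A0 := qlift (free_lift A0_comul_gen).
Definition A0_counit : A0 -> k := qlift (free_lift A0_counit_gen).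
Definition A0_antipode : A0 -> A0 := qlift (free_antilift A0_antipode_gen).

Let dfl : linear (free_lift A0_comul_gen). Proof. exact: free_lift_linear. Qed.
Let dfm : monoid_morphism (free_lift A0_comul_gen).
Proof. exact: free_lift_morph. Qed.
Let dfr r : A0_rel r -> free_lift A0_comul_gen r = 0.
Proof.
case; rewrite (linPB dfl) ?(linPZ _ dfl) ?dfm.1 !dfm.2 !free_lift_gen
  /A0_comul_gen /=.
- by rewrite tensM A0_xVE tens1 subrr.
- by rewrite tensM A0_VxE tens1 subrr.
rewrite mulrDl mulrDr !tensM !mul1r !mulr1 A0_yxE scalerDr.
rewrite (linPZ _ (tensl_linear A0_x)) (linPZ _ (tensr_linear A0_x)).
by rewrite subrr.
Qed.

Let sfl : linear (free_antilift A0_antipode_gen).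
Proof. exact: free_antilift_linear. Qed.
Let sfr r : A0_rel r -> free_antilift A0_antipode_gen r = 0.
Proof.
case; rewrite (linPB sfl) ?(linPZ _ sfl) ?free_antilift1 !free_antiliftM
  !free_antilift_gen /A0_antipode_gen /=.
- by rewrite A0_xVE subrr.
- by rewrite A0_VxE subrr.
by rewrite mulrN mulNr A0_VyE scalerN subrr.
Qed.

Let dk x : I x -> free_lift A0_comul_gen x = 0.
Proof. exact: (ideal_span_kill dfl dfm dfr). Qed.
Let ek x : I x -> free_lift A0_counit_gen x = 0.
Proof. exact: (ideal_span_kill efl efm efr). Qed.
Let sk x : I x -> free_antilift A0_antipode_gen x = 0.
Proof.
elim=> [|a s b {}x Ss _ IH]; first exact: linP0.
by rewrite (linPD sfl) IH !free_antiliftM (sfr Ss) mul0r mulr0 addr0.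
Qed.

Lemma A0_comul_linear : linear A0_comul. Proof. exact: qlift_linear dfl dk. Qed.
Lemma A0_comul_morph : monoid_morphism A0_comul.
Proof. exact: qlift_monoid_morphism dfl dfm dk. Qed.
Lemma A0_counit_linear : linear (A0_counit : A0 -> k^o).
Proof. exact: qlift_linear efl ek. Qed.
Lemma A0_counit_morph : monoid_morphism A0_counit.
Proof. exact: (qlift_monoid_morphism (B := k^o) efl efm ek). Qed.
Lemma A0_antipode_linear : linear A0_antipode. Proof. exact: qlift_linear sfl sk. Qed.
Lemma A0_antipode1 : A0_antipode 1 = 1.
Proof. by rewrite -pm.1 [LHS](qliftE sfl sk) free_antilift1. Qed.
Lemma A0_antipodeM u v : A0_antipode (u * v) = A0_antipode v * A0_antipode u.
Proof.
elim/qpi_ind: u => x; elim/qpi_ind: v => y; rewrite -/(p x) -/(p y) -pm.2.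
by rewrite /A0_antipode !(qliftE sfl sk) free_antiliftM.
Qed.

Definition A0_gen (i : 'I_3) : A0 := p (fgen k i).
Lemma A0_comul_genE i : A0_comul (A0_gen i) = A0_comul_gen i.
Proof. by rewrite [LHS](qliftE dfl dk) free_lift_gen. Qed.
Lemma A0_counit_genE i : A0_counit (A0_gen i) = A0_counit_gen i.
Proof. by rewrite [LHS](qliftE efl ek) free_lift_gen. Qed.
Lemma A0_antipode_genE i : A0_antipode (A0_gen i) = A0_antipode_gen i.
Proof. by rewrite [LHS](qliftE sfl sk) free_antilift_gen. Qed.

Lemma A0_gen_ind (P : 'I_3 -> Prop) : P 0 -> P 1 -> P 2 -> forall i, P i.
Proof.
move=> P0 P1 P2 [[|[|[|//]]] lti].
- by rewrite (_ : Ordinal lti = 0) //; apply: val_inj.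
- by rewrite (_ : Ordinal lti = 1) //; apply: val_inj.
- by rewrite (_ : Ordinal lti = 2) //; apply: val_inj.
Qed.

Lemma A0_ind (V : lmodType k) (f g : A0 -> V) :
  linear f -> linear g -> f 1 = g 1 ->
  (forall i h, f h = g h -> f (A0_gen i * h) = g (A0_gen i * h)) -> f =1 g.
Proof.
move=> fl gl fg1 fgM; elim/qpi_ind=> x; rewrite -/(p x); move: x.
apply: (free_ind (f := fun x => f (p x)) (g := fun x => g (p x))).
- exact: linP_comp.
- exact: linP_comp.
- by rewrite pm.1.
by move=> i x /(fgM i); rewrite pm.2.
Qed.

Lemma A0_hom_ext (A : algType k) (f g : A0 -> A) :
  linear f -> linear g -> monoid_morphism f -> monoid_morphism g ->
  (forall i, f (A0_gen i) = g (A0_gen i)) -> f =1 g.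
Proof.
move=> fl gl [f1 fM] [g1 gM] fg; apply: A0_ind => //; first by rewrite f1 g1.
by move=> i h fgh; rewrite fM gM fg fgh.
Qed.

Lemma morph_comp (A B C : algType k) (g : B -> C) (f : A -> B) :
  monoid_morphism g -> monoid_morphism f -> monoid_morphism (fun x => g (f x)).
Proof.
by move=> [g1 gM] [f1 fM]; split=> [|x y]; rewrite ?f1 ?g1 ?fM ?gM.
Qed.
Lemma morph_id (A : algType k) : monoid_morphism (@id A).
Proof. by []. Qed.

Lemma A0_comulA h :
  tassoc (tmap A0_comul id (A0_comul h)) = tmap id A0_comul (A0_comul h).
Proof.
have dl := A0_comul_linear; have dm := A0_comul_morph; have im := @morph_id A0.
have tl := tmap_linear dl (@linP_id _ A0); have tl' := tmap_linear (@linP_id _ A0) dl.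
have tm := tmap_morph dl (@linP_id _ A0) dm im.
have tm' := tmap_morph (@linP_id _ A0) dl im dm.
have al := @tassoc_linear k A0 A0 A0.
move: h; apply: (A0_hom_ext
  (f := fun h => tassoc (tmap A0_comul id (A0_comul h)))
  (g := fun h => tmap id A0_comul (A0_comul h))).
- by apply: (linP_comp al); apply: linP_comp.
- exact: linP_comp.
- by apply: (morph_comp (@tassoc_morph k _ _ _)); apply: morph_comp.
- exact: morph_comp.
have d1 := dm.1.
apply: A0_gen_ind; rewrite A0_comul_genE /A0_comul_gen /=.
- by rewrite !tmapE // [A0_comul A0_x](A0_comul_genE 0) tassocE.
- by rewrite !tmapE // [A0_comul A0_xV](A0_comul_genE 1) tassocE.
rewrite (linPD tl) (linPD tl') !tmapE // d1 [A0_comul A0_y](A0_comul_genE 2) /=.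
rewrite -tens1 (linPD (tensl_linear _)) (linPD (tensr_linear _)) !(linPD al).
by rewrite !tassocE addrA.
Qed.

Let counit_ext (beta : A0 -> A0 -> A0) : bilinear_map beta -> beta 1 1 = 1 ->
  (forall a a' b b', beta (a * a') (b * b') = beta a b * beta a' b') ->
  (forall i, tlift beta (A0_comul_gen i) = A0_gen i) ->
  forall h, tlift beta (A0_comul h) = h.
Proof.
move=> bil b1 bM bg; apply: (A0_hom_ext (g := id)) => //.
- by apply: linP_comp; [apply: tlift_linear|apply: A0_comul_linear].
- by apply: morph_comp; [apply: tlift_morph|apply: A0_comul_morph].
by move=> i; rewrite A0_comul_genE.
Qed.

Lemma A0_counitl h : tlift (fun a b => A0_counit a *: b) (A0_comul h) = h.
Proof.
have [e1 eM] := A0_counit_morph; have el := A0_counit_linear.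
have bil := @bilinear_scalel k A0 A0 _ el.
apply: counit_ext => //; first by rewrite e1 scale1r.
  by move=> a a' b b'; rewrite eM -scalerAl -scalerAr scalerA.
apply: A0_gen_ind; rewrite /A0_comul_gen /=; last first.
  rewrite (linPD (tlift_linear bil)) !tliftE // e1 [A0_counit A0_y](A0_counit_genE 2).
  by rewrite scale0r scale1r add0r.
- by rewrite tliftE // [A0_counit A0_xV](A0_counit_genE 1) scale1r.
- by rewrite tliftE // [A0_counit A0_x](A0_counit_genE 0) scale1r.
Qed.
Lemma A0_counitr h : tlift (fun a b => A0_counit b *: a) (A0_comul h) = h.
Proof.
have [e1 eM] := A0_counit_morph; have el := A0_counit_linear.
have bil := @bilinear_scaler k A0 A0 _ el.
apply: counit_ext => //; first by rewrite e1 scale1r.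
  by move=> a a' b b'; rewrite eM -scalerAl -scalerAr scalerA.
apply: A0_gen_ind; rewrite /A0_comul_gen /=; last first.
  rewrite (linPD (tlift_linear bil)) !tliftE // e1 [A0_counit A0_y](A0_counit_genE 2).
  by rewrite scale0r scale1r addr0.
- by rewrite tliftE // [A0_counit A0_xV](A0_counit_genE 1) scale1r.
- by rewrite tliftE // [A0_counit A0_x](A0_counit_genE 0) scale1r.
Qed.

Let unit_linear : linear (fun h => (A0_counit h)%:A : A0).
Proof. exact: (linP_comp (linP_scale (1 : A0)) A0_counit_linear). Qed.

Lemma A0_antipodel h :
  tlift (fun a b => A0_antipode a * b) (A0_comul h) = (A0_counit h)%:A.
Proof.
have bil := bilinear_Sl A0_antipode_linear; have tl := tlift_linear bil.
have [d1 dM] := A0_comul_morph; have [e1 eM] := A0_counit_morph.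
set L := tlift _ in tl *.
have LM c t u : L t = c%:A -> L (t * u) = c *: L u.
  move=> Lt; move: u; apply: (tensor_linP (f := fun u => L (t * u))
      (g := fun u => c *: L u)) => [||a b].
  - by apply: (linP_comp tl); apply: linP_mull.
  - by apply: (linP_comp (linP_scaler c)).
  rewrite [L (tens a b)]tliftE //.
  have -> : c *: (A0_antipode a * b) = A0_antipode a * L t * b.
    by rewrite Lt -scalerAr mulr1 -scalerAl.
  move: {Lt} t; apply: (tensor_linP (f := fun t => L (t * tens a b))
      (g := fun t => A0_antipode a * L t * b)) => [||a' b'].
  - by apply: (linP_comp tl); apply: linP_mulr.
  - by apply: (linP_comp (linP_mulr _)); apply: (linP_comp (linP_mull _)).
  by rewrite tensM /L !tliftE // A0_antipodeM !mulrA.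
have Lg i : L (A0_comul_gen i) = (A0_counit_gen i)%:A.
  move: i; apply: A0_gen_ind; rewrite /A0_comul_gen /A0_counit_gen /=.
  - by rewrite /L tliftE // (A0_antipode_genE 0) A0_VxE scale1r.
  - by rewrite /L tliftE // (A0_antipode_genE 1) A0_xVE scale1r.
  rewrite (linPD tl) /L !tliftE // (A0_antipode_genE 2) A0_antipode1.
  by rewrite mulr1 mul1r scale0r addNr.
move: h; apply: (A0_ind (f := fun h => L (A0_comul h)) _ unit_linear).
- by apply: (linP_comp tl); apply: A0_comul_linear.
- by rewrite d1 e1 -tens1 /L tliftE // A0_antipode1 mulr1 scale1r.
move=> i h IH; rewrite dM eM A0_comul_genE A0_counit_genE.
by rewrite (LM _ _ _ (Lg i)) IH scalerA.
Qed.

Lemma A0_antipoder h :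
  tlift (fun a b => a * A0_antipode b) (A0_comul h) = (A0_counit h)%:A.
Proof.
have bil := bilinear_Sr A0_antipode_linear; have tl := tlift_linear bil.
have [d1 dM] := A0_comul_morph; have [e1 eM] := A0_counit_morph.
set L := tlift _ in tl *.
have LM c t u : L u = c%:A -> L (t * u) = c *: L t.
  move=> Lu; move: t; apply: (tensor_linP (f := fun t => L (t * u))
      (g := fun t => c *: L t)) => [||a b].
  - by apply: (linP_comp tl); apply: linP_mulr.
  - by apply: (linP_comp (linP_scaler c)).
  rewrite [L (tens a b)]tliftE //.
  have -> : c *: (a * A0_antipode b) = a * L u * A0_antipode b.
    by rewrite Lu -scalerAr mulr1 -scalerAl.
  move: {Lu} u; apply: (tensor_linP (f := fun u => L (tens a b * u))
      (g := fun u => a * L u * A0_antipode b)) => [||a' b'].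
  - by apply: (linP_comp tl); apply: linP_mull.
  - by apply: (linP_comp (linP_mulr _)); apply: (linP_comp (linP_mull _)).
  by rewrite tensM /L !tliftE // A0_antipodeM !mulrA.
have Lg i : L (A0_comul_gen i) = (A0_counit_gen i)%:A.
  move: i; apply: A0_gen_ind; rewrite /A0_comul_gen /A0_counit_gen /=.
  - by rewrite /L tliftE // (A0_antipode_genE 0) A0_xVE scale1r.
  - by rewrite /L tliftE // (A0_antipode_genE 1) A0_VxE scale1r.
  rewrite (linPD tl) /L !tliftE // (A0_antipode_genE 2) A0_antipode1.
  by rewrite mulr1 mul1r scale0r subrr.
move: h; apply: (A0_ind (f := fun h => L (A0_comul h)) _ unit_linear).
- by apply: (linP_comp tl); apply: A0_comul_linear.
- by rewrite d1 e1 -tens1 /L tliftE // A0_antipode1 mulr1 scale1r.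
move=> i h IH; rewrite dM eM A0_comul_genE A0_counit_genE.
by rewrite (LM _ _ _ IH) Lg scalerA mulrC.
Qed.

HB.instance Definition _ := isHopf.Build k A0 A0_comul_linear A0_comul_morph
  A0_counit_linear A0_counit_morph A0_antipode_linear A0_comulA
  A0_counitl A0_counitr A0_antipodel A0_antipoder.
End A0.

Section Coactions.
Context (k : fieldType) (A : algType k) (gr : nat -> A -> Prop).

Definition coaction (H : hopfType k) (rho : A -> tensor A H) : Prop :=
  [/\ linear rho, monoid_morphism rho,
      forall a, tassoc (tmap rho id (rho a)) = tmap id comul (rho a) &
      forall a, tlift (fun b h => counit h *: b) (rho a) = a].

Definition graded_coaction (H : hopfType k) (rho : A -> tensor A H) : Prop :=
  coaction rho /\ forall n a, gr n a -> tspan (gr n) (fun=> True) (rho a).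

Definition inner_faithful (H : hopfType k) (rho : A -> tensor A H) : Prop :=
  forall P : H -> Prop, hopf_subalgebra P -> (exists h, ~ P h) ->
    ~ (forall a, tspan (fun=> True) P (rho a)).

(* aut^r(A) is determined by its universal property up to unique isomorphism. *)
Definition is_aut_r (U : hopfType k) (rho : A -> tensor A U) : Prop :=
  graded_coaction rho /\
  forall (H : hopfType k) (rho' : A -> tensor A H), graded_coaction rho' ->
    exists! phi : U -> H,
      hopf_hom phi /\ forall a, tmap id phi (rho a) = rho' a.
End Coactions.

Section MaxCocommutative.
Context (k : fieldType).
Implicit Types H Q : hopfType k.

Definition max_cocommutative H (I : hopf_ideal H) : Prop :=
  cocommutative (hopf_quot I) /\
  forall I' : hopf_ideal H, (forall x, I' x -> I x) -> ~ (forall x, I x -> I' x) ->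
    ~ cocommutative (hopf_quot I').

Definition is_quotient_of Q H : Prop :=
  exists I : hopf_ideal H, hopf_iso (hopf_quot I) Q.

Definition is_max_cocommutative_quotient_of Q H : Prop :=
  exists I : hopf_ideal H, max_cocommutative I /\ hopf_iso (hopf_quot I) Q.
End MaxCocommutative.

(* Main.v *)
Require Import Defs.
From mathcomp Require Import all_boot all_order all_algebra.
From mathcomp Require Import finmap boolp monalg zify ring.

(* A graded coaction on A_q(2) is a 2x2 comatrix c over H (rho x_j = sum_i x_i (x) c_ij)
   with c R c^T = d R for some d in H, where R is the matrix of the relation
   x_2 x_1 - q x_1 x_2.  If H is cocommutative, the scalar matrices f(c), f a linear
   form on H, commute; as soon as one of them is not scalar, a change of basis c = P D P^-1
   makes D either diag(g, h) or [[g, y], [0, g]], and the condition on D involves the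
   congruent form A = P^-1 R P^-T.  Comparing entries, either gh = hg, or A is diagonal
   (hence symmetric, so q = -1) and g^2 = h^2, or A_22 = 0 and y g = l g y, where the
   invariants det A and A_12 - A_21 force l = q or l = q^-1.  So c is an image of the
   generic matrix over k[Z^2], k[Gamma] or A(0, l).  Maximality of these three follows from
   the same dichotomy: a cocommutative coaction mapping onto the generic one has a matrix
   of the same shape in the same basis, and is therefore also an image of it. *)

Set Implicit Arguments.
Unset Strict Implicit.
Unset Printing Implicit Defensive.

Import GRing.Theory.
Local Open Scope ring_scope.

(** * Tensor products and Hopf homomorphisms *)

(** The algebra [U] of the universal coaction is known only through its universal property, so no
    ideal of it is ever computed. It is handled through one matrix [u]: Hopf maps out of [U] are
    determined by the image of [u]. Equality of two matrices therefore gives equality of two maps,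
    typically [s \o f] and the projection of [U] onto a quotient, and from it the inclusion of the
    kernel of [f] in an ideal. Both directions of the classification of maximal quotients end with
    such an inclusion.

    The entries of a comatrix do not commute, so neither eigenvectors nor transposes of products
    make sense over [H]. Linear forms give scalar matrices in their place: the products of two of
    them are values of convolution products, which is why cocommutativity makes them commute, and
    linear forms separate the points of [H], so a shape shared by all these scalar matrices is a
    shape of [c]. Only scalar changes of basis are used. *)

Lemma monalgU_mmon (k : fieldType) (M : monoidType) (c : k) (m : M) :
  << c *g m >> = c *: mmon k m.
Proof.
by rewrite mmon.unlock; apply/malgP=> v; rewrite mcoeffZ !mcoeffU mulrnAr mulr1.
Qed.

Lemma mmon_nil (k : fieldType) (X : choiceType) :
  mmon k (FMonom [::] : fmonom X) = 1.
Proof. by rewrite -[1]mmon1 -fmoneE. Qed.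

Lemma mmon_cons (k : fieldType) (X : choiceType) (x : X) (w : seq X) :
  mmon k (FMonom (x :: w)) = fgen k x * mmon k (FMonom w) :> free_alg k X.
Proof. by rewrite -mmonM; congr mmon; rewrite [RHS]fmmulE fmuE. Qed.

Section TensorSpan.
Context (k : fieldType).
Implicit Types A B C D : algType k.

Lemma tens0l A B (b : B) : tens (0 : A) b = 0.
Proof. exact: linP0 (tensl_linear b). Qed.

Lemma tens0r A B (a : A) : tens a (0 : B) = 0.
Proof. exact: linP0 (tensr_linear a). Qed.

Lemma tensZl A B c (a : A) (b : B) : tens (c *: a) b = c *: tens a b.
Proof. exact: (linPZ _ (tensl_linear b)). Qed.

Lemma tensZr A B c (a : A) (b : B) : tens a (c *: b) = c *: tens a b.
Proof. exact: (linPZ _ (tensr_linear a)). Qed.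

Lemma tensDl A B (a a' : A) (b : B) : tens (a + a') b = tens a b + tens a' b.
Proof. exact: (linPD (tensl_linear b)). Qed.

Lemma tensDr A B (a : A) (b b' : B) : tens a (b + b') = tens a b + tens a b'.
Proof. exact: (linPD (tensr_linear a)). Qed.

Lemma tspan_tens A B (P : A -> Prop) (Q : B -> Prop) a b :
  P a -> Q b -> tspan P Q (tens a b).
Proof.
by move=> Pa Qb; exists [:: (a, b)]; split=> [x|]; rewrite ?inE ?big_seq1 // => /eqP->.
Qed.

Lemma tspan0 A B (P : A -> Prop) (Q : B -> Prop) : tspan P Q 0.
Proof. by exists [::]; rewrite big_nil. Qed.

Lemma tspanD A B (P : A -> Prop) (Q : B -> Prop) t u :
  tspan P Q t -> tspan P Q u -> tspan P Q (t + u).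
Proof.
move=> [s [Ps ->]] [s' [Ps' ->]]; exists (s ++ s'); rewrite big_cat; split=> // x.
by rewrite mem_cat => /orP[/Ps|/Ps'].
Qed.

Lemma tspan_bigsum A B (P : A -> Prop) (Q : B -> Prop) (T : eqType) (s : seq T) F :
  (forall x, x \in s -> tspan P Q (F x)) -> tspan P Q (\sum_(x <- s) F x).
Proof.
move=> PF; rewrite big_seq; elim/big_rec: _ => [|x t /PF]; [exact: tspan0|exact: tspanD].
Qed.

Lemma tspan_sub A B (P P' : A -> Prop) (Q Q' : B -> Prop) t :
  (forall a, P a -> P' a) -> (forall b, Q b -> Q' b) ->
  tspan P Q t -> tspan P' Q' t.
Proof. by move=> PP QQ [s [Ps ->]]; exists s; split=> // x /Ps[/PP ? /QQ ?]. Qed.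

Lemma tspanZ A B (P : A -> Prop) (Q : B -> Prop) c t :
  (forall a, P a -> P (c *: a)) -> tspan P Q t -> tspan P Q (c *: t).
Proof.
move=> PZ [s [Ps ->]]; rewrite scaler_sumr; apply: tspan_bigsum => x /Ps[Px Qx].
by rewrite -tensZl; apply: tspan_tens => //; apply: PZ.
Qed.

Lemma tspanM A B (P P1 P2 : A -> Prop) (Q Q1 Q2 : B -> Prop) t u :
  (forall a b, P1 a -> P2 b -> P (a * b)) ->
  (forall a b, Q1 a -> Q2 b -> Q (a * b)) ->
  tspan P1 Q1 t -> tspan P2 Q2 u -> tspan P Q (t * u).
Proof.
move=> PM QM [s [Ps ->]] [s' [Ps' ->]]; rewrite mulr_suml.
apply: tspan_bigsum => x /Ps[Px Qx]; rewrite mulr_sumr.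
apply: tspan_bigsum => y /Ps'[Py Qy]; rewrite tensM.
by apply: tspan_tens; [apply: PM|apply: QM].
Qed.

Lemma tspan_map A B A' B' (P : A -> Prop) (Q : B -> Prop) (P' : A' -> Prop)
    (Q' : B' -> Prop) (f : A -> A') (g : B -> B') t :
  linear f -> linear g ->
  (forall a, P a -> P' (f a)) -> (forall b, Q b -> Q' (g b)) ->
  tspan P Q t -> tspan P' Q' (tmap f g t).
Proof.
move=> fl gl Pf Qg [s [Ps ->]]; rewrite (linP_sum _ _ (tmap_linear fl gl)).
apply: tspan_bigsum => x /Ps[Px Qx]; rewrite tmapE //.
by apply: tspan_tens; [apply: Pf|apply: Qg].
Qed.

(** The universal property only compares linear maps, so the expansion into pure tensors is read off
    a representative in the monoid algebra. Since [tspan] has no coefficients, scalars are absorbed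
    into the left factor. *)
Lemma tspanT A B (t : tensor A B) : tspan (fun=> True) (fun=> True) t.
Proof.
suff: exists s : seq (k * (A * B)), t = \sum_(x <- s) x.1 *: tens x.2.1 x.2.2.
  move=> [s ->]; apply: tspan_bigsum => x _; apply: tspanZ => //.
  exact: tspan_tens.
move: t; rewrite /tens /tensor tensor_pack.unlock /=; elim/qpi_ind=> x.
exists [seq (x@_m, m) | m <- msupp x].
rewrite big_map {1}[x]monalgE (linP_sum _ _ (@qpi_linear _ _ _)).
apply: eq_bigr => -[a b] _ /=; by rewrite qpiZ monalgU_mmon.
Qed.

Lemma tlift_ext A B (V : lmodType k) (beta gam : A -> B -> V) t :
  (forall a b, beta a b = gam a b) -> tlift beta t = tlift gam t.
Proof. by move=> bg; congr tlift; apply/funext=> a; apply/funext=> b. Qed.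

Lemma tswap_linear A B : linear (@tswap k A B).
Proof. exact/tlift_linear/tswap_bilinear. Qed.

Lemma tswapE A B (a : A) (b : B) : tswap (tens a b) = tens b a.
Proof. exact/tliftE/tswap_bilinear. Qed.

Lemma tswap_morph A B : monoid_morphism (@tswap k A B).
Proof.
apply: tlift_morph; [exact: tswap_bilinear|exact: tens1|].
by move=> *; rewrite tensM.
Qed.

Lemma tswap_tmap A B C D (f : A -> C) (g : B -> D) t : linear f -> linear g ->
  tswap (tmap f g t) = tmap g f (tswap t).
Proof.
move=> fl gl; move: t; apply: tensor_linP => [||a b].
- by apply: (linP_comp (@tswap_linear _ _)); apply: tmap_linear.
- by apply: linP_comp; [apply: tmap_linear|apply: tswap_linear].
by rewrite tmapE // !tswapE tmapE.
Qed.

Lemma tens_inl_morph A B : monoid_morphism (fun a : A => tens a (1 : B)).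
Proof. by split=> [|a a']; rewrite ?tens1 // tensM mulr1. Qed.

Lemma tens_inr_morph A B : monoid_morphism (fun b : B => tens (1 : A) b).
Proof. by split=> [|b b']; rewrite ?tens1 // tensM mulr1. Qed.

End TensorSpan.

(** * Hopf homomorphisms, their kernels and images *)

Section HopfHom.
Context (k : fieldType).
Implicit Types H K L : hopfType k.

(* Both [f \o antipode] and [antipode \o f] are convolution inverses of [f]. *)
Lemma hopf_homI H K (f : H -> K) : linear f -> monoid_morphism f ->
  (forall h, comul (f h) = tmap f f (comul h)) ->
  (forall h, counit (f h) = counit h) -> hopf_hom f.
Proof.
move=> fl fm fc fe; split=> // h; have [f1 fM] := fm.
have sl := @antipode_linear _ H; have Sl := @antipode_linear _ K.
have dl := @comul_linear _ H.
pose bS (a b : H) := f (antipode a) * f b; pose bT (b c : H) := f b * antipode (f c).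
have bSb : bilinear_map bS.
  split=> [b|a]; first by apply: (linP_comp (linP_mulr _)); apply: (linP_comp fl).
  by apply: (linP_comp (linP_mull _)).
have bTb : bilinear_map bT.
  split=> [b|a]; first by apply: (linP_comp (linP_mulr _)).
  by apply: (linP_comp (linP_mull _)); apply: (linP_comp Sl).
have LT x : tlift bT (comul x) = (counit x)%:A.
  rewrite -fe -antipoder fc tlift_tmap //; exact/bilinear_Sr.
have LS x : tlift bS (comul x) = (counit x)%:A.
  rewrite /bS -[RHS](_ : f ((counit x)%:A) = _); last by rewrite (linPZ _ fl) f1.
  rewrite -antipodel; move: (comul x); apply: tensor_linP => [||a b].
  - exact: tlift_linear.
  - by apply: (linP_comp fl); apply/tlift_linear/bilinear_Sl.
  by rewrite !tliftE ?fM //; apply/bilinear_Sl.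
have lbr : bilinear_map (fun (a : H) (t : tensor H H) => f (antipode a) * tlift bT t).
  split=> [t|a]; first by apply: (linP_comp (linP_mulr _)); apply: (linP_comp fl).
  by apply: (linP_comp (linP_mull _)); apply: tlift_linear.
have lbl : bilinear_map (fun (t : tensor H H) (c : H) => tlift bS t * antipode (f c)).
  split=> [c|t]; first by apply: (linP_comp (linP_mulr _)); apply: tlift_linear.
  by apply: (linP_comp (linP_mull _)); apply: (linP_comp Sl).
have assoc t : tlift (fun (a : H) (t : tensor H H) => f (antipode a) * tlift bT t) (tassoc t)
    = tlift (fun (t : tensor H H) (c : H) => tlift bS t * antipode (f c)) t.
  move: t; apply: tensor_linP => [||t c].
  - by apply: linP_comp; [apply: tlift_linear|apply: tassoc_linear].
  - exact: tlift_linear.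
  rewrite tliftE //; move: t.
  apply: (tensor_linP (f := fun t => tlift _ (tassoc (tens t c)))
    (g := fun t => tlift bS t * antipode (f c))) => [||a b].
  - apply: linP_comp; first exact: tlift_linear.
    by apply: linP_comp; [apply: tassoc_linear|apply: tensl_linear].
  - by apply: (linP_comp (linP_mulr _)); apply: tlift_linear.
  by rewrite tassocE !tliftE // /bS /bT mulrA.
(* Coassociativity is applied to [f (antipode a) * f b * antipode (f c)]: bracketed to the left,
   [LS] collapses it to [antipode (f h)]; bracketed to the right, [LT] collapses it to
   [f (antipode h)]. *)
have := congr1 (tlift (fun (a : H) (t : tensor H H) => f (antipode a) * tlift bT t)) (comulA h).
rewrite assoc !tlift_tmap //.
rewrite (tlift_ext (gam := fun a b => counit a *: antipode (f b))); last first.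
  by move=> a b; rewrite LS -scalerAl mul1r.
rewrite (tlift_ext (beta := fun a b => f (antipode a) * tlift bT (comul b))
  (gam := fun a b => counit b *: f (antipode a))); last first.
  by move=> a b; rewrite LT -scalerAr mulr1.
have el := @counit_linear _ H.
have -> : tlift (fun a b => counit a *: antipode (f b)) (comul h) = antipode (f h).
  rewrite -{2}[h]counitl; move: (comul h); apply: tensor_linP => [||a b].
  - apply: tlift_linear; split=> [b|a]; first exact: (linP_comp (linP_scale (antipode (f b))) el).
    by apply: (linP_comp (linP_scaler _)); apply: (linP_comp Sl).
  - apply: (linP_comp Sl); apply: (linP_comp fl).
    exact/tlift_linear/bilinear_scalel.
  rewrite !tliftE; first by rewrite (linPZ _ fl) (linPZ _ Sl).
    exact: bilinear_scalel.
  split=> [b'|a']; first exact: (linP_comp (linP_scale (antipode (f b'))) el).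
  by apply: (linP_comp (linP_scaler _)); apply: (linP_comp Sl).
move=> ->; rewrite -{1}[h]counitr; move: (comul h); apply: tensor_linP => [||a b].
- apply: (linP_comp fl); apply: (linP_comp sl).
  exact/tlift_linear/bilinear_scaler.
- apply: tlift_linear; split=> [b|a]; last exact: (linP_comp (linP_scale (f (antipode a))) el).
  by apply: (linP_comp (linP_scaler _)); apply: (linP_comp fl).
rewrite !tliftE; first by rewrite (linPZ _ sl) (linPZ _ fl).
  split=> [b'|a']; last exact: (linP_comp (linP_scale (f (antipode a'))) el).
  by apply: (linP_comp (linP_scaler _)); apply: (linP_comp fl).
exact: bilinear_scaler.
Qed.

Lemma hopf_hom_id H : hopf_hom (@id H).
Proof.
split=> // h; rewrite /tmap -[LHS]/(id (comul h)); move: (comul h).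
apply: tensor_linP => // [|a b]; first exact: tmap_linear.
by rewrite [RHS]tmapE.
Qed.

Lemma hopf_hom_comp H K L (g : K -> L) (f : H -> K) :
  hopf_hom g -> hopf_hom f -> hopf_hom (fun x => g (f x)).
Proof.
move=> [gl gm gc ge gS] [fl fm fc fe fS]; split=> [|||h|h].
- exact: linP_comp.
- exact: morph_comp.
- by move=> h; rewrite gc fc tmap_tmap.
- by rewrite ge fe.
- by rewrite fS gS.
Qed.

Lemma hopf_hom_inv H K (f : H -> K) (g : K -> H) :
  hopf_hom f -> cancel f g -> cancel g f -> hopf_hom g.
Proof.
move=> [fl [f1 fM] fc fe fS] fK gK; have fI := can_inj fK.
have gl : linear g by move=> c x y; apply: fI; rewrite gK fl !gK.
split=> // [|h|h|h].
- by split=> [|x y]; apply: fI; rewrite gK ?f1 // fM !gK.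
- rewrite -{2}[h]gK fc tmap_tmap // -[LHS]/(id (comul (g h))); move: (comul _).
  apply: tensor_linP => // [|a b]; last by rewrite [RHS]tmapE ?fK //; apply: linP_comp.
  by apply: tmap_linear; apply: linP_comp.
- by rewrite -fe gK.
- by apply: fI; rewrite fS !gK.
Qed.

Lemma hopf_iso_refl H : hopf_iso H H.
Proof. by exists id; split; [apply: hopf_hom_id|exists id]. Qed.

Lemma hopf_iso_sym H K : hopf_iso H K -> hopf_iso K H.
Proof.
move=> [f [fh [g fK gK]]]; exists g; split; last by exists f.
exact: hopf_hom_inv gK.
Qed.

Lemma hopf_iso_trans H K L : hopf_iso H K -> hopf_iso K L -> hopf_iso H L.
Proof.
move=> [f [fh fb]] [g [gh gb]]; exists (fun x => g (f x)); split.
  exact: hopf_hom_comp.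
exact: bij_comp.
Qed.

Lemma cocommutative_iso H K : hopf_iso H K -> cocommutative K -> cocommutative H.
Proof.
move=> /hopf_iso_sym[g [[gl _ gc _ _] [f gK fK]]] Kc h.
by rewrite -[h]fK gc tswap_tmap // Kc.
Qed.

Lemma qpi_hopf_hom H (I : hopf_ideal H) : hopf_hom (qpi I : H -> hopf_quot I).
Proof.
have pl : linear (qpi I : H -> hopf_quot I) by exact: qpi_linear.
have pm : monoid_morphism (qpi I : H -> hopf_quot I) by exact: qpi_monoid_morphism.
apply: hopf_homI => // h.
- apply: (qliftE (f := fun h => tmap (qpi I : H -> hopf_quot I) (qpi I) (comul h))).
    by apply: linP_comp; [apply: tmap_linear|apply: comul_linear].
  move=> x /hopf_ideal_comul[u [v [-> Pu Pv]]].
  have tl := tmap_linear pl pl.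
  have p0 y : I y -> qpi I y = 0 by move=> Iy; apply/qpiP; rewrite subr0.
  rewrite (linPD tl) (tspan_sum tl _ Pu) ?(tspan_sum tl _ Pv) ?addr0 // => a b.
    by move=> _ /p0 b0; rewrite tmapE // [X in tens _ X]b0 tens0r.
  by move=> /p0 a0 _; rewrite tmapE // [X in tens X _]a0 tens0l.
by apply: (qliftE (f := counit : H -> k^o)); [apply: counit_linear|apply: hopf_ideal_counit].
Qed.

(** No bases are chosen. The sums [u + v] form a proper ideal [J] of the tensor square, and a
    set-theoretic section [s] of [f], though not linear, becomes so modulo [J]. Hence
    [tens (s a) (s b)] induces a linear map from the tensor square of [K] to [quot J]; composed with
    [tmap f f] it is the projection, so [tmap f f t = 0] puts [t] in [J]. *)
Lemma hopf_ker_tensor H K (f : H -> K) (t : tensor H H) :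
  linear f -> monoid_morphism f -> (forall y, exists x, f x = y) ->
  tmap f f t = 0 -> exists u v,
    [/\ t = u + v, tspan (fun x => f x = 0) (fun=> True) u &
        tspan (fun=> True) (fun x => f x = 0) v].
Proof.
move=> fl fm fs; have [f1 fM] := fm; have tl := tmap_linear fl fl.
pose W (t : tensor H H) := exists u v,
    [/\ t = u + v, tspan (fun x => f x = 0) (fun=> True) u &
        tspan (fun=> True) (fun x => f x = 0) v].
have WD x y : W x -> W y -> W (x + y).
  move=> [u [v [-> Pu Pv]]] [u' [v' [-> Pu' Pv']]].
  by exists (u + u'), (v + v'); rewrite addrACA; split=> //; apply: tspanD.
have Wl a x : W x -> W (a * x).
  move=> [u [v [-> Pu Pv]]]; exists (a * u), (a * v); rewrite mulrDr; split=> //.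
    by apply: (tspanM _ _ (tspanT a) Pu) => // b c _ c0; rewrite fM c0 mulr0.
  by apply: (tspanM _ _ (tspanT a) Pv) => // b c _ c0; rewrite fM c0 mulr0.
have Wr a x : W x -> W (x * a).
  move=> [u [v [-> Pu Pv]]]; exists (u * a), (v * a); rewrite mulrDl; split=> //.
    by apply: (tspanM _ _ Pu (tspanT a)) => // b c b0 _; rewrite fM b0 mul0r.
  by apply: (tspanM _ _ Pv (tspanT a)) => // b c b0 _; rewrite fM b0 mul0r.
have W0 : W 0 by exists 0, 0; rewrite addr0; split=> //; apply: tspan0.
have Wf x : W x -> tmap f f x = 0.
  move=> [u [v [-> Pu Pv]]].
  rewrite (linPD tl) (tspan_sum tl _ Pu) ?(tspan_sum tl _ Pv) ?addr0 // => a b.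
    by move=> _ b0; rewrite tmapE // b0 tens0r.
  by move=> a0 _; rewrite tmapE // a0 tens0l.
have W1 : ~ W 1.
  by move=> /Wf /eqP; rewrite (tmap_morph _ _ _ _).1 // oner_eq0.
pose J := PIdeal W0 WD Wl Wr W1.
pose s y := sval (cid (fs y)); have sK y : f (s y) = y by rewrite /s; case: cid.
have Wkl a b : f a = 0 -> W (tens a b).
  by move=> a0; exists (tens a b), 0; rewrite addr0; split=> //; [apply: tspan_tens|apply: tspan0].
have Wkr a b : f b = 0 -> W (tens a b).
  by move=> b0; exists 0, (tens a b); rewrite add0r; split=> //; [apply: tspan0|apply: tspan_tens].
pose beta a b : quot J := qpi J (tens (s a) (s b)).
have f0 c x y z : z = c *: x + y -> f (s z - (c *: s x + s y)) = 0.
  by move=> ->; rewrite (linPB fl) fl !sK subrr.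
have bil : bilinear_map beta.
  split=> [b c a a'|a c b b']; rewrite /beta qpiZ qpiD; apply/qpiP.
    by rewrite -tensZl -tensDl -(linPB (tensl_linear _)); apply/Wkl/f0.
  by rewrite -tensZr -tensDr -(linPB (tensr_linear _)); apply/Wkr/f0.
have key u : tlift beta (tmap f f u) = qpi J u.
  rewrite tlift_tmap //; move: u; apply: tensor_linP => [||a b].
  - apply: tlift_linear; case: bil => bl br; split=> ?.
      exact: (linP_comp (bl _)).
    exact: (linP_comp (br _)).
  - exact: qpi_linear.
  rewrite tliftE; last first.
    by case: bil => bl br; split=> ?; [apply: (linP_comp (bl _))|apply: (linP_comp (br _))].
  apply/qpiP; have -> : tens (s (f a)) (s (f b)) - tens a b =
     tens (s (f a) - a) (s (f b)) + tens a (s (f b) - b).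
    by rewrite (linPB (tensl_linear _)) (linPB (tensr_linear _)) addrA subrK.
  by apply: (WD _ _); [apply: Wkl|apply: Wkr]; rewrite (linPB fl) sK subrr.
move=> t0; have := key t; rewrite t0 (linP0 (tlift_linear bil)) => /esym.
by rewrite -(linP0 (@qpi_linear _ _ J)) => /qpiP; rewrite subr0.
Qed.

Lemma hopf_kerP H K (f : H -> K) : hopf_hom f -> (forall y, exists x, f x = y) ->
  exists I : hopf_ideal H, forall x, I x <-> f x = 0.
Proof.
move=> [fl fm fc fe fS] fs; have [f1 fM] := fm.
have p0 : f 0 = 0 by apply: linP0.
have pD x y : f x = 0 -> f y = 0 -> f (x + y) = 0.
  by move=> x0 y0; rewrite (linPD fl) x0 y0 addr0.
have pl a x : f x = 0 -> f (a * x) = 0 by move=> x0; rewrite fM x0 mulr0.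
have pr a x : f x = 0 -> f (x * a) = 0 by move=> x0; rewrite fM x0 mul0r.
have p1 : ~ (f 1 = 0) by rewrite f1; apply/eqP/oner_neq0.
pose I := @PIdeal k H (fun x => f x = 0) p0 pD pl pr p1.
have Ic (x : H) : I x -> exists u v,
    [/\ comul x = u + v, tspan I (fun=> True) u & tspan (fun=> True) I v].
  move=> x0; apply: (hopf_ker_tensor fl fm fs); rewrite -fc x0.
  exact: (linP0 (@comul_linear _ _)).
have Ie (x : H) : I x -> counit x = 0.
  by move=> x0; rewrite -fe x0; exact: (@linP0 _ _ k^o _ (@counit_linear _ K)).
have IS (x : H) : I x -> I (antipode x).
  by rewrite /= => x0; rewrite fS x0; apply: (linP0 (@antipode_linear _ _)).
by exists (HopfIdeal Ic Ie IS).
Qed.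

Lemma hopf_quot_iso H K (f : H -> K) (I : hopf_ideal H) :
  hopf_hom f -> (forall y, exists x, f x = y) -> (forall x, I x <-> f x = 0) ->
  hopf_iso (hopf_quot I) K.
Proof.
move=> [fl fm fc fe fS] fs IE.
have [pl pm pc pe pS] := qpi_hopf_hom I.
have f0 x : I x -> f x = 0 by move/IE.
have gE x : qlift f (qpi I x) = f x by apply: qliftE.
exists (qlift f : hopf_quot I -> K); split.
  apply: hopf_homI; first exact: qlift_linear.
  - exact: qlift_monoid_morphism.
  - elim/qpi_ind=> x; rewrite gE fc (pc x) tmap_tmap //; last exact: qlift_linear.
      by congr (tmap _ _ _); apply/funext=> y; rewrite gE.
    exact: qlift_linear.
  - by elim/qpi_ind=> x; rewrite gE fe; apply/esym/pe.
pose s y := sval (cid (fs y)); have sK y : f (s y) = y by rewrite /s; case: cid.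
exists (fun y => qpi I (s y)) => [|y]; last by rewrite gE sK.
by elim/qpi_ind=> x; rewrite gE; apply/qpiP/IE; rewrite (linPB fl) sK subrr.
Qed.

Lemma is_quotient_of_surj H K (f : H -> K) :
  hopf_hom f -> (forall y, exists x, f x = y) -> is_quotient_of K H.
Proof.
by move=> fh fs; have [I IE] := hopf_kerP fh fs; exists I; apply: (hopf_quot_iso fh).
Qed.

Lemma hopf_subalgebra_image H K (f : H -> K) : hopf_hom f ->
  hopf_subalgebra (fun y => exists x, f x = y).
Proof.
move=> [fl [f1 fM] fc fe fS]; split=> [|c _ _ [x <-] [y <-]|_ _ [x <-] [y <-]|_ [x <-]|_ [x <-]].
- by exists 1.
- by exists (c *: x + y); rewrite fl.
- by exists (x * y); rewrite fM.
- by rewrite fc; apply: tspan_map (tspanT _) => // a _; exists a.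
- by exists (antipode x); rewrite fS.
Qed.

End HopfHom.

(** * Comatrices and invariant forms *)

Section MatrixMap.
Context (k : fieldType).
Implicit Types A B : algType k.

Definition smx A m n (P : 'M[k]_(m, n)) : 'M[A]_(m, n) := map_mx (in_alg A) P.

Lemma smxM A m n p (P : 'M[k]_(m, n)) (Q : 'M_(n, p)) :
  smx A (P *m Q) = smx A P *m smx A Q.
Proof. exact: map_mxM. Qed.

Lemma smx1 A n : smx A (1%:M : 'M_n) = 1%:M.
Proof. exact: map_mx1. Qed.

(** Transposition does not reverse products over a noncommutative algebra; it does when one factor
    has central entries, as scalar matrices have. *)
Lemma trmx_smxl A m n p (P : 'M[k]_(m, n)) (c : 'M[A]_(n, p)) :
  (smx A P *m c)^T = c^T *m smx A P^T.
Proof.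
by apply/matrixP=> i j; rewrite !mxE; apply: eq_bigr => l _; rewrite !mxE mulr_algl mulr_algr.
Qed.

Lemma trmx_smxr A m n p (P : 'M[k]_(n, p)) (c : 'M[A]_(m, n)) :
  (c *m smx A P)^T = smx A P^T *m c^T.
Proof.
by apply/matrixP=> i j; rewrite !mxE; apply: eq_bigr => l _; rewrite !mxE mulr_algl mulr_algr.
Qed.

Lemma map_algM A B (f : A -> B) m n p (c : 'M[A]_(m, n)) (d : 'M_(n, p)) :
  linear f -> monoid_morphism f -> map_mx f (c *m d) = map_mx f c *m map_mx f d.
Proof.
move=> fl [_ fM]; apply/matrixP=> i j; rewrite !mxE (linP_sum _ _ fl).
by apply: eq_bigr => l _; rewrite fM !mxE.
Qed.

Lemma map_smx A B (f : A -> B) m n (P : 'M[k]_(m, n)) :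
  linear f -> f 1 = 1 -> map_mx f (smx A P) = smx B P.
Proof. by move=> fl f1; apply/matrixP=> i j; rewrite !mxE (linPZ _ fl) f1. Qed.

(** A linear form is not multiplicative, but scalar factors pass through it, so a change of basis of
    [c] is seen on the scalar matrix [map_mx f c]. *)
Lemma map_form A (f : A -> k^o) m n p r (P : 'M[k]_(m, n)) (c : 'M[A]_(n, p))
    (Q : 'M_(p, r)) : linear f ->
  map_mx f (smx A P *m c *m smx A Q) = P *m (map_mx f c : 'M[k]_(n, p)) *m Q.
Proof.
move=> fl; apply/matrixP=> i j; rewrite !mxE (linP_sum _ _ fl).
apply: eq_bigr => l _; rewrite !mxE mulr_algr (linPZ _ fl) (linP_sum _ _ fl).
rewrite [RHS]mulrC; congr (_ * _); apply: eq_bigr => t _.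
by rewrite !mxE mulr_algl (linPZ _ fl).
Qed.

(* [R] spans a one-dimensional subcomodule of [V (x) V] when [c] is the matrix
   of a coaction on [V]. *)
Definition preserves_form A n (R : 'M[k]_n) (c : 'M[A]_n) :=
  exists d, c *m smx A R *m c^T = d *: smx A R.

(** The factor [d] does not change: the inner products [P' *m P] and their transposes cancel, and
    scalar matrices commute with [d]. *)
Lemma preserves_form_conj A n (R P P' : 'M[k]_n) (c : 'M[A]_n) :
  P' *m P = 1%:M -> preserves_form R c ->
  preserves_form (P *m R *m P^T) (smx A P *m c *m smx A P').
Proof.
move=> PP [d cd]; exists d.
rewrite trmx_smxr trmx_smxl !smxM -!mulmxA.
rewrite [smx A P' *m _]mulmxA -smxM PP smx1 mul1mx.
rewrite [smx A P^T *m (smx A P'^T *m _)]mulmxA -smxM -trmx_mul PP trmx1 smx1 mul1mx.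
have -> : smx A P *m (c *m (smx A R *m (c^T *m smx A P^T))) =
    smx A P *m (c *m smx A R *m c^T) *m smx A P^T by rewrite !mulmxA.
rewrite cd [in RHS]mulmxA scalemxAl; congr (_ *m _).
apply/matrixP=> i j; rewrite !mxE mulr_sumr; apply: eq_bigr => l _.
by rewrite !mxE /= [RHS]mulrA mulr_algl scalerAl; congr (_ * _); rewrite mulr_algr.
Qed.

Lemma preserves_form_map A B (f : A -> B) n (R : 'M[k]_n) (c : 'M[A]_n) :
  linear f -> monoid_morphism f -> preserves_form R c ->
  preserves_form R (map_mx f c).
Proof.
move=> fl fm [d cd]; exists (f d).
rewrite -(map_smx _ fl fm.1) map_trmx -!map_algM // cd.
by apply/matrixP=> i j; rewrite !mxE fm.2.
Qed.

End MatrixMap.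

Section Comatrix.
Context (k : fieldType).
Implicit Types H K : hopfType k.

(** A matrix identity, with [c] placed in the left and then in the right tensor factor, so that
    conjugation is pure matrix algebra; [comatrixP] gives the usual entrywise form. *)
Definition comatrix H n (c : 'M[H]_n) : Prop :=
  map_mx comul c = map_mx (fun h => tens h (1 : H)) c *m map_mx (fun h => tens (1 : H) h) c
  /\ map_mx counit c = 1%:M.

Lemma comatrixP H n (c : 'M[H]_n) : comatrix c <->
  (forall i j, comul (c i j) = \sum_l tens (c i l) (c l j)) /\
  (forall i j, counit (c i j) = (i == j)%:R).
Proof.
split=> [[cc ce]|[cc ce]]; split.
- move=> i j; have /matrixP/(_ i j) := cc; rewrite !mxE => ->.
  by apply: eq_bigr => l _; rewrite !mxE tensM mulr1 mul1r.
- by move=> i j; have /matrixP/(_ i j) := ce; rewrite !mxE.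
- apply/matrixP=> i j; rewrite !mxE cc.
  by apply: eq_bigr => l _; rewrite !mxE tensM mulr1 mul1r.
by apply/matrixP=> i j; rewrite !mxE ce.
Qed.

Lemma comatrix_map H K (f : H -> K) n (c : 'M[H]_n) :
  hopf_hom f -> comatrix c -> comatrix (map_mx f c).
Proof.
move=> [fl fm fc fe _] /comatrixP[cc ce]; apply/comatrixP; split=> i j.
  rewrite mxE fc cc (linP_sum _ _ (tmap_linear fl fl)).
  by apply: eq_bigr => l _; rewrite tmapE // !mxE.
by rewrite mxE fe.
Qed.

Lemma comatrix_conj H n (P P' : 'M[k]_n) (c : 'M[H]_n) :
  P *m P' = 1%:M -> P' *m P = 1%:M -> comatrix c ->
  comatrix (smx H P *m c *m smx H P').
Proof.
move=> PP PP' [cc ce].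
have dl := @comul_linear _ H; have dm := @comul_morph _ H.
have ll := @tensl_linear k H H 1; have lm := @tens_inl_morph k H H.
have rl := @tensr_linear k H H 1; have rm := @tens_inr_morph k H H.
split; last first.
  by rewrite (@map_form k H counit) ?ce ?mulmx1 //; apply: counit_linear.
rewrite !map_algM // cc !map_smx ?tens1 ?dm.1 //.
set T := tensor H H; rewrite -!mulmxA; do 2!congr (_ *m _).
by rewrite [smx T P' *m _]mulmxA -smxM PP' smx1 mul1mx.
Qed.

(** The entries of the two sides are the values at [c i j] of the convolution products of [f] with
    [g] and of [g] with [f]; these agree because the coproduct is symmetric. *)
Lemma comatrix_commute H n (c : 'M[H]_n) (f g : H -> k^o) :
  cocommutative H -> comatrix c -> linear f -> linear g ->
  (map_mx f c : 'M[k]_n) *m map_mx g c = (map_mx g c : 'M[k]_n) *m map_mx f c.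
Proof.
move=> Hc /comatrixP[cc _] fl gl; apply/matrixP=> i j; rewrite !mxE.
pose beta a b : k^o := f a * g b.
have bil : bilinear_map beta.
  split=> [b|a].
    by apply: (linP_comp (g := fun x : k^o => x * g b)) => //; apply: (@linP_mulr k k^o).
  by apply: (linP_comp (g := fun x : k^o => f a * x)) => //; apply: (@linP_mull k k^o).
have tl := tlift_linear bil; have sl := @tswap_linear k H H.
transitivity (tlift beta (comul (c i j))).
  by rewrite cc (linP_sum _ _ tl); apply: eq_bigr => l _; rewrite tliftE // !mxE.
rewrite -Hc cc (linP_sum _ _ sl) (linP_sum _ _ tl); apply: eq_bigr => l _.
by rewrite tswapE tliftE // !mxE mulrC.
Qed.

End Comatrix.

(** * Two-by-two matrices given by their entries *)

Lemma sum_I2 (V : nmodType) (F : 'I_2 -> V) : \sum_i F i = F 0 + F 1.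
Proof. by rewrite big_ord_recl big_ord1; congr (_ + F _); apply: val_inj. Qed.

Lemma I2_ind (P : 'I_2 -> Prop) : P 0 -> P 1 -> forall i, P i.
Proof.
move=> P0 P1 [[|[|//]] lti].
- by rewrite (_ : Ordinal lti = 0) //; apply: val_inj.
- by rewrite (_ : Ordinal lti = 1) //; apply: val_inj.
Qed.

Definition mx2 (T : nmodType) (a b c d : T) : 'M[T]_2 :=
  \matrix_(i, j) if i == 0 then if j == 0 then a else b else if j == 0 then c else d.

Lemma mx2E (T : nmodType) (M : 'M[T]_2) : M = mx2 (M 0 0) (M 0 1) (M 1 0) (M 1 1).
Proof. by apply/matrixP; elim/I2_ind; elim/I2_ind; rewrite !mxE. Qed.

Lemma mx2_eq (T : nmodType) (a b c d a' b' c' d' : T) :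
  mx2 a b c d = mx2 a' b' c' d' <-> [/\ a = a', b = b', c = c' & d = d'].
Proof.
split=> [/matrixP e|[-> -> -> -> //]].
by split; [have := e 0 0|have := e 0 1|have := e 1 0|have := e 1 1]; rewrite !mxE.
Qed.

Lemma mul_mx2 (A : pzSemiRingType) (a b c d a' b' c' d' : A) :
  mx2 a b c d *m mx2 a' b' c' d' =
  mx2 (a * a' + b * c') (a * b' + b * d') (c * a' + d * c') (c * b' + d * d').
Proof. by apply/matrixP; elim/I2_ind; elim/I2_ind; rewrite !(mxE, sum_I2). Qed.

Lemma tr_mx2 (T : nmodType) (a b c d : T) : (mx2 a b c d)^T = mx2 a c b d.
Proof. by apply/matrixP; elim/I2_ind; elim/I2_ind; rewrite !mxE. Qed.

Lemma map_mx2 (T U : nmodType) (f : T -> U) (a b c d : T) :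
  map_mx f (mx2 a b c d) = mx2 (f a) (f b) (f c) (f d).
Proof. by apply/matrixP; elim/I2_ind; elim/I2_ind; rewrite !mxE. Qed.

Lemma mx2_1 (A : pzSemiRingType) : 1%:M = mx2 1 0 0 1 :> 'M[A]_2.
Proof. by apply/matrixP; elim/I2_ind; elim/I2_ind; rewrite !mxE. Qed.

Lemma scale_mx2 (A : pzSemiRingType) (x a b c d : A) :
  x *: mx2 a b c d = mx2 (x * a) (x * b) (x * c) (x * d).
Proof. by apply/matrixP; elim/I2_ind; elim/I2_ind; rewrite !mxE. Qed.

(** * Coactions on the quantum plane *)

Section QPlane.
Context (k : fieldType) (q : k).
Local Notation A := (qplane q).
Local Notation F := (free_alg k 'I_2).
Local Notation I := (gen_ideal (@qplane_proper k q)).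

Definition qx (i : 'I_2) : A := qpi I (fgen k i).

Lemma qx_rel : qx 1 * qx 0 = q *: (qx 0 * qx 1).
Proof.
rewrite /qx qpiM qpiM qpiZ; apply/qpiP; exact: ideal_span_in.
Qed.

(** Index [0] is [x_1] and index [1] is [x_2]. Sorting a word into [x_1^a x_2^b] costs one factor
    [q] for each [x_2] standing to the left of an [x_1]. *)
Fixpoint inversions (w : seq 'I_2) : nat :=
  if w is i :: w' then ((i == 1%R) * count_mem 0%R w' + inversions w')%N else 0%N.

Lemma inversions_cat u v : inversions (u ++ v) =
  (inversions u + inversions v + count_mem 1%R u * count_mem 0%R v)%N.
Proof.
elim: u => [|i u /= ->]; first by rewrite addn0.
by rewrite count_cat; case: eqP => _; lia.
Qed.

(* The coefficient of [x_1^a x_2^b] in the normal form of a word. *)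
Definition word_coef (a b : nat) (w : fmonom 'I_2) : k^o :=
  if (count_mem 0 (w : seq _) == a) && (count_mem 1 (w : seq _) == b)
  then q ^+ inversions w else 0.

(** [u x_2 x_1 v] has the same letters as [u x_1 x_2 v] and exactly one more inversion. The forms
    thus descend to the quotient, where they yield the independence of monomials without any
    rewriting argument. *)
Lemma word_coef_kill a b x : I x -> mext (word_coef a b) x = 0.
Proof.
have el := mext_linear (V := k^o) (word_coef a b).
elim=> [|u s v {}x -> _ IH]; first exact: linP0.
rewrite (linPD el) {}IH addr0 {x}; move: u.
apply: (monoid_alg_linP (g := fun=> 0)) => [||u].
- by apply: (linP_comp el); apply: (linP_comp (linP_mulr v)); apply: linP_mulr.
- by move=> c x y; rewrite scaler0 addr0.
move: v; apply: (monoid_alg_linP (g := fun=> 0)) => [||v].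
- by apply: (linP_comp el); apply: linP_mull.
- by move=> c x y; rewrite scaler0 addr0.
rewrite mulrBr mulrBl -scalerAr -scalerAl (linPB el) (linPZ _ el).
rewrite /fgen -!mmonM !(mext_mmon (V := k^o)) /word_coef !fmM !fmuE.
rewrite !count_cat /= !inversions_cat /= !count_cat /=.
rewrite ?(addn0, add0n).
case: ifP => _; last by rewrite scaler0 subrr.
rewrite -[X in _ - X]exprS; apply/eqP; rewrite subr_eq0; apply/eqP; congr (q ^+ _); lia.
Qed.

Definition qcoef a b : A -> k^o := qlift (mext (word_coef a b) : F -> k^o).

Lemma qcoef_linear a b : linear (qcoef a b).
Proof. by apply: qlift_linear; [apply: mext_linear|apply: word_coef_kill]. Qed.

Lemma qcoef1 a b i : qcoef a b (qx i) = ((i == 0) == a :> nat)%:R * ((i == 1) == b :> nat)%:R.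
Proof.
rewrite [LHS]qliftE; [|exact: mext_linear|exact: word_coef_kill].
rewrite [LHS](mext_mmon (V := k^o)) /word_coef fmuE /= addn0 addn0.
by case: (_ == a); case: (_ == b); rewrite ?(mul0r, mulr0, mul1r) // muln0 addn0.
Qed.

Lemma qcoef2 a b i j : qcoef a b (qx i * qx j) =
  if ((i == 0%R) + (j == 0%R) == a)%N && ((i == 1%R) + (j == 1%R) == b)%N
  then q ^+ ((i == 1) && (j == 0)) else 0.
Proof.
rewrite qpiM [LHS]qliftE; [|exact: mext_linear|exact: word_coef_kill].
rewrite -mmonM [LHS](mext_mmon (V := k^o)) /word_coef fmM !fmuE /= !addn0.
by rewrite muln0 addn0 mulnb.
Qed.

Lemma qplane_ind (V : lmodType k) (f g : A -> V) :
  linear f -> linear g -> f 1 = g 1 ->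
  (forall i h, f h = g h -> f (qx i * h) = g (qx i * h)) -> f =1 g.
Proof.
move=> fl gl fg1 fgM; elim/qpi_ind=> x; move: x.
apply: (free_ind (f := fun x => f (qpi I x)) (g := fun x => g (qpi I x))).
- by apply: (linP_comp fl); apply: qpi_linear.
- by apply: (linP_comp gl); apply: qpi_linear.
- by rewrite (@qpi_monoid_morphism _ _ I).1.
by move=> i x /(fgM i); rewrite qpiM.
Qed.

Lemma qplane_hom_ext (B : algType k) (f g : A -> B) :
  linear f -> linear g -> monoid_morphism f -> monoid_morphism g ->
  (forall i, f (qx i) = g (qx i)) -> f =1 g.
Proof.
move=> fl gl [f1 fM] [g1 gM] fg; apply: qplane_ind => //; first by rewrite f1 g1.
by move=> i h fgh; rewrite fM gM fg fgh.
Qed.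

Lemma qplane_degZ n c a : qplane_deg n a -> qplane_deg n (c *: a : A).
Proof.
move=> [x [xn ->]]; exists (c *: x); split; last by rewrite qpiZ.
by move=> w /(fsubsetP (msuppZ_le _ _)) /xn.
Qed.

Lemma qplane_deg_word (w : fmonom 'I_2) : qplane_deg (fdeg w) (qpi I (mmon k w)).
Proof.
exists << w >>; split; last by rewrite mmon.unlock.
by move=> v /(fsubsetP (msuppU_le)); rewrite in_fset1 => /eqP ->.
Qed.

Lemma qplane_deg1P (a : A) : qplane_deg 1 a ->
  exists c0 c1, a = c0 *: qx 0 + c1 *: qx 1.
Proof.
move=> [x [xn ->]]; pose W (a : A) := exists c0 c1, a = c0 *: qx 0 + c1 *: qx 1.
rewrite [x]monalgE (linP_sum _ _ (@qpi_linear _ _ I)) big_seq -/(W _).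
elim/big_rec: _ => [|w y /xn wn [c0 [c1 ->]]].
  by exists 0, 0; rewrite !scale0r addr0.
rewrite monalgU_mmon -qpiZ; case: w wn => -[|i [|//]] // _.
rewrite mmon_cons mmon_nil mulr1 -/(qx i).
move: i; elim/I2_ind; [exists (x@_(FMonom [:: 0]) + c0), c1|exists c0, (x@_(FMonom [:: 1]) + c1)].
  by rewrite scalerDl addrA.
by rewrite addrCA scalerDl.
Qed.

Definition rel_form : 'M[k]_2 := mx2 0 (- q) 1 0.

Definition coacts (C : algType k) (rho : A -> tensor A C) (c : 'M[C]_2) : Prop :=
  forall j, rho (qx j) = \sum_i tens (qx i) (c i j).

Definition qtens (C : algType k) (c : 'M[C]_2) (j : 'I_2) : tensor A C :=
  \sum_i tens (qx i) (c i j).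

Lemma qtens_rel (C : algType k) (c : 'M[C]_2) :
  qtens c 1 * qtens c 0 - q *: (qtens c 0 * qtens c 1) =
  \sum_i \sum_j tens (qx i * qx j) ((c *m smx C rel_form *m c^T) i j).
Proof.
have E u v : qtens c u * qtens c v = \sum_i \sum_j tens (qx i * qx j) (c i u * c j v).
  rewrite mulr_suml; apply: eq_bigr => i _; rewrite mulr_sumr; apply: eq_bigr => j _.
  exact: tensM.
rewrite !E scaler_sumr -sumrB; apply: eq_bigr => i _; rewrite scaler_sumr -sumrB.
apply: eq_bigr => j _; rewrite -tensZr -(linPB (tensr_linear _)); congr tens.
rewrite !(mxE, sum_I2) /= !scale0r !mulr0 add0r addr0 scale1r mulr1.
by rewrite -scalerAr mulr1 -scalerAl scaleNr.
Qed.

Lemma qtens_rel0 (C : algType k) (c : 'M[C]_2) :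
  preserves_form rel_form c <->
  qtens c 1 * qtens c 0 = q *: (qtens c 0 * qtens c 1).
Proof.
split=> [[d cd]|/eqP].
  apply/eqP; rewrite -subr_eq0 qtens_rel cd !sum_I2 /= !mxE /= !scale0r !mulr0 scale1r.
  rewrite mulr1 !tens0r add0r addr0 qx_rel tensZl -tensZr -tensDr -scalerAr mulr1.
  by rewrite scaleNr addNr tens0r.
rewrite -subr_eq0 qtens_rel => /eqP; set M := _ *m c^T => e.
have ev a b : \sum_i \sum_j qcoef a b (qx i * qx j) *: M i j = 0.
  have bil := @bilinear_scalel k A C _ (qcoef_linear a b); have tl := tlift_linear bil.
  rewrite -[RHS](linP0 tl) -e (linP_sum _ _ tl); apply: eq_bigr => i _.
  by rewrite (linP_sum _ _ tl); apply: eq_bigr => j _; rewrite tliftE.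
(* [rel_form] has entry 1 at position [(1, 0)], which dictates the factor. The coefficients of
   [x_1^2], [x_1 x_2] and [x_2^2] give [M 0 0 = 0], [M 0 1 + q M 1 0 = 0] and [M 1 1 = 0]. *)
exists (M 1 0); move: (ev 2 0)%N (ev 1 1)%N (ev 0 2)%N.
rewrite !sum_I2 !qcoef2 /= !scale0r !scale1r !addr0 !add0r expr1 => M0 M1 M2.
rewrite -/M [LHS]mx2E /smx /rel_form map_mx2 scale_mx2 /= !scale0r scale1r mulr0 mulr1 M0 M2.
congr mx2; rewrite -scalerAr mulr1 scaleNr; apply/eqP; rewrite -addr_eq0; exact/eqP.
Qed.

End QPlane.

(** * Correspondence between graded coactions and matrices *)

Section QPlaneCoactions.
Context (k : fieldType) (q : k).
Local Notation A := (qplane q).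
Local Notation F := (free_alg k 'I_2).
Local Notation I := (gen_ideal (@qplane_proper k q)).
Local Notation x := (qx q).

Lemma qx_tens_inj (C : algType k) (a b : 'I_2 -> C) :
  \sum_i tens (x i) (a i) = \sum_i tens (x i) (b i) -> a =1 b.
Proof.
move=> e i; pose ev (u v : nat) := tlift (fun (y : A) (h : C) => qcoef u v y *: h).
have bil u v := @bilinear_scalel k A C _ (@qcoef_linear k q u v).
have tl u v := tlift_linear (bil u v).
have evE u v (d : 'I_2 -> C) :
    ev u v (\sum_i tens (x i) (d i)) = qcoef u v (x 0) *: d 0 + qcoef u v (x 1) *: d 1.
  by rewrite /ev sum_I2 (linPD (tl u v)) !tliftE.
move: i; elim/I2_ind.
  have := congr1 (ev 1 0)%N e; rewrite !evE !qcoef1 /=.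
  by rewrite !mulr0 !mulr1 !scale0r !scale1r !addr0.
have := congr1 (ev 0 1)%N e; rewrite !evE !qcoef1 /=.
by rewrite !mulr0 !mulr1 !scale0r !scale1r !add0r.
Qed.

Lemma coacts_unique (C : algType k) (rho rho' : A -> tensor A C) (c : 'M[C]_2) :
  linear rho -> linear rho' -> monoid_morphism rho -> monoid_morphism rho' ->
  coacts rho c -> coacts rho' c -> rho = rho'.
Proof.
move=> rl rl' rm rm' rc rc'; apply/funext; apply: (qplane_hom_ext rl rl' rm rm') => i.
by rewrite rc rc'.
Qed.

Lemma coacts_map (C D : algType k) (f : C -> D) (rho : A -> tensor A C) (c : 'M[C]_2) :
  linear f -> coacts rho c -> coacts (fun a => tmap id f (rho a)) (map_mx f c).
Proof.
move=> fl rc j; have tl := tmap_linear (@linP_id _ A) fl.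
rewrite rc (linP_sum _ _ tl); apply: eq_bigr => i _.
by rewrite tmapE // mxE.
Qed.

(** Both sides of each comodule axiom are algebra maps, so they need only be compared on [x_1] and
    [x_2], where they become the two comatrix identities. *)
Lemma coaction_exists (C : hopfType k) (c : 'M[C]_2) :
  comatrix c -> preserves_form (rel_form q) c ->
  exists rho : A -> tensor A C,
    graded_coaction (@qplane_deg k q) rho /\ coacts rho c.
Proof.
move=> /comatrixP[cc ce] /qtens_rel0 crel.
have fl := @free_lift_linear k 'I_2 (tensor A C) (qtens q c).
have fm := @free_lift_morph k 'I_2 (tensor A C) (qtens q c).
have f0 y : I y -> free_lift (qtens q c) y = 0.
  apply: (ideal_span_kill fl fm) => _ ->.
  by rewrite (linPB fl) (linPZ _ fl) !fm.2 !free_lift_gen crel subrr.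
pose rho : A -> tensor A C := qlift (free_lift (qtens q c)).
have rl : linear rho by apply: qlift_linear.
have rm : monoid_morphism rho by apply: qlift_monoid_morphism.
have rc : coacts rho c.
  by move=> j; rewrite /rho /qx [LHS]qliftE // free_lift_gen.
have il := @linP_id k C; have iA := @linP_id k A.
have dl := @comul_linear _ C; have dm := @comul_morph _ C.
exists rho; split=> //; split; [split=> //|].
- apply: qplane_hom_ext.
  + by apply: (linP_comp (@tassoc_linear _ _ _ _)); apply: linP_comp => //; apply: tmap_linear.
  + by apply: linP_comp => //; apply: tmap_linear.
  + apply: (morph_comp (@tassoc_morph _ _ _ _)); apply: morph_comp => //.
    exact: tmap_morph.
  + by apply: morph_comp => //; apply: tmap_morph.
  move=> j; rewrite rc.
  rewrite (linP_sum _ _ (tmap_linear rl il)) (linP_sum _ _ (@tassoc_linear _ _ _ _)).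
  rewrite (linP_sum _ _ (tmap_linear iA dl)).
  transitivity (\sum_i \sum_l tens (x l) (tens (c l i) (c i j))).
    apply: eq_bigr => i _; rewrite tmapE // rc (linP_sum _ _ (tensl_linear _)).
    rewrite (linP_sum _ _ (@tassoc_linear _ _ _ _)).
    by apply: eq_bigr => l _; rewrite tassocE.
  rewrite exchange_big; apply: eq_bigr => l _.
  by rewrite tmapE // cc (linP_sum _ _ (tensr_linear _)).
- have el := @counit_linear _ C; have [e1 eM] := @counit_morph _ C.
  have bil := @bilinear_scaler k C A _ el.
  apply: (qplane_hom_ext (g := id)) => //.
  + by apply: linP_comp => //; apply: tlift_linear.
  + apply: morph_comp => //; apply: tlift_morph => //; first by rewrite e1 scale1r.
    by move=> a a' b b'; rewrite eM -scalerAl -scalerAr scalerA.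
  move=> j; rewrite rc (linP_sum _ _ (tlift_linear bil)) (bigD1 j) //= tliftE //.
  rewrite ce eqxx scale1r big1 ?addr0 // => i /negPf ij.
  by rewrite tliftE // ce ij scale0r.
move=> n _ [p [pn ->]]; rewrite [rho _]qliftE // [p]monalgE (linP_sum _ _ fl).
apply: tspan_bigsum => w /pn wn.
rewrite monalgU_mmon (linPZ _ fl); apply: tspanZ; first by move=> a; apply: qplane_degZ.
rewrite -wn [free_lift _ _]mext_mmon; move: w {wn} => [w].
(* The left factors are required to be classes of words of the right length, which is stable under
   left multiplication by a generator and so suits the induction on [w]. *)
apply: (@tspan_sub _ _ _ (fun a => exists2 v : fmonom 'I_2, fdeg v = size w &
    a = qpi I (mmon k v)) _ (fun=> True)) => //.
  by move=> _ [v vw ->]; have := @qplane_deg_word k q v; rewrite vw.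
elim: w => [|i w IH].
  rewrite big_nil -tens1; apply: tspan_tens => //.
  by exists (FMonom [::]); rewrite // mmon_nil.
rewrite big_cons mulr_suml; apply: tspan_bigsum => j _.
apply: (@tspanM _ _ _ _ (fun a => a = x j) _ _ (fun=> True)) IH => //; last exact: tspan_tens.
move=> _ _ -> [[v] vw ->]; exists (FMonom (j :: v)); first by rewrite /= -vw.
by rewrite /qx qpiM -mmon_cons.
Qed.

(** Compatibility with the grading keeps [rho (x j)] in degree one, spanned by the two generators.
    Their linear independence makes the coefficients unique, and the comodule axioms then become
    identities between coefficients. *)
Lemma coaction_matrix (C : hopfType k) (rho : A -> tensor A C) :
  graded_coaction (@qplane_deg k q) rho ->
  exists c : 'M[C]_2, [/\ comatrix c, preserves_form (rel_form q) c & coacts rho c].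
Proof.
move=> [[rl rm rA re] rg].
have x1 j : qplane_deg 1 (x j).
  have := @qplane_deg_word k q (FMonom [:: j]).
  by rewrite mmon_cons mmon_nil mulr1.
have ex j : exists a : 'I_2 -> C, rho (x j) = \sum_i tens (x i) (a i).
  have [s [s1 ->]] := rg _ _ (x1 j).
  rewrite big_seq; elim/big_rec: _ => [|y t /s1[/qplane_deg1P[c0 [c1 yE]] _] [a ->]].
    by exists (fun=> 0); rewrite big1 // => i _; rewrite tens0r.
  exists (fun i => (if i == 0 then c0 else c1) *: y.2 + a i).
  rewrite !sum_I2 /= !tensDr yE tensDl !tensZl !tensZr.
  by rewrite addrACA.
have [a aE] := choice ex.
pose c : 'M[C]_2 := \matrix_(i, j) a j i.
have rc : coacts rho c by move=> j; rewrite aE; apply: eq_bigr => i _; rewrite mxE.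
exists c; split=> //.
- apply/comatrixP; split=> i j.
    have := rA (x j); rewrite rc.
    rewrite (linP_sum _ _ (tmap_linear rl (@linP_id _ _))).
    rewrite (linP_sum _ _ (@tassoc_linear _ _ _ _)).
    rewrite (linP_sum _ _ (tmap_linear (@linP_id _ _) (@comul_linear _ C))).
    rewrite [RHS](eq_bigr (fun i => tens (x i) (comul (c i j)))); last first.
      by move=> l _; rewrite tmapE //; apply: comul_linear.
    rewrite (eq_bigr (fun i => \sum_l tens (x l) (tens (c l i) (c i j)))); last first.
      move=> l _; rewrite tmapE // rc (linP_sum _ _ (tensl_linear _)).
      rewrite (linP_sum _ _ (@tassoc_linear _ _ _ _)).
      by apply: eq_bigr => m _; rewrite tassocE.
    rewrite exchange_big (eq_bigr (fun i => tens (x i) (\sum_l tens (c i l) (c l j)))).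
      by move/qx_tens_inj.
    by move=> l _; rewrite (linP_sum _ _ (tensr_linear _)).
  have el := @counit_linear _ C; have bil := @bilinear_scaler k C A _ el.
  have := re (x j); rewrite rc (linP_sum _ _ (tlift_linear bil)).
  rewrite (eq_bigr (fun i => counit (c i j) *: x i)); last by move=> l _; rewrite tliftE.
  rewrite sum_I2 => e; have ev u v := congr1 (@qcoef k q u v) e.
  have Z (z : k) : z *: (1 : k^o) = z by exact: mulr1.
  move: i (ev 1 0)%N (ev 0 1)%N; rewrite !(linPD (qcoef_linear _ _)).
  rewrite !(linPZ _ (qcoef_linear _ _)) !qcoef1 /=.
  by move: j {rc e ev}; elim/I2_ind; elim/I2_ind;
    rewrite /= ?mulr0 ?mulr1 ?scaler0 ?add0r ?addr0 ?Z.
apply/qtens_rel0; rewrite /qtens -!rc -!rm.2 -(linPZ _ rl).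
by congr rho; apply: qx_rel.
Qed.

End QPlaneCoactions.

(** * Maps out of the three Hopf algebras *)

Section Grouplike.
Context (k : fieldType) (C : hopfType k).
Implicit Types g h y : C.

Definition grouplike g : Prop := comul g = tens g g /\ counit g = 1.

Lemma grouplike1 : grouplike 1.
Proof. by split; rewrite ?(@comul_morph _ C).1 ?tens1 ?(@counit_morph _ C).1. Qed.

Lemma grouplikeM g h : grouplike g -> grouplike h -> grouplike (g * h).
Proof.
move=> [gc ge] [hc he]; split.
  by rewrite (@comul_morph _ C).2 gc hc tensM.
by rewrite (@counit_morph _ C).2 ge he mulr1.
Qed.

Lemma grouplikeX g n : grouplike g -> grouplike (g ^+ n).
Proof.
move=> gg; elim: n => [|n IH]; first exact: grouplike1.
by rewrite exprS; apply: grouplikeM.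
Qed.

Lemma grouplikeVl g : grouplike g -> antipode g * g = 1.
Proof.
move=> [gc ge]; have := antipodel g; rewrite gc tliftE ?ge ?scale1r //.
exact/bilinear_Sl/antipode_linear.
Qed.

Lemma grouplikeVr g : grouplike g -> g * antipode g = 1.
Proof.
move=> [gc ge]; have := antipoder g; rewrite gc tliftE ?ge ?scale1r //.
exact/bilinear_Sr/antipode_linear.
Qed.

(** [comul (antipode g)] is multiplied on the right by [g * antipode g = 1] in both tensor factors;
    the resulting [tens g g] is [comul g] and cancels. *)
Lemma grouplikeV g : grouplike g -> grouplike (antipode g).
Proof.
move=> gg; have Vl := grouplikeVl gg; have Vr := grouplikeVr gg; have [gc ge] := gg.
have [c1 cM] := @comul_morph _ C; have [e1 eM] := @counit_morph _ C.
split; last by rewrite -e1 -Vr eM ge mul1r.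
rewrite -[LHS]mulr1 -tens1 -{1 2}Vr -tensM mulrA -gc -cM Vl c1.
exact: mul1r.
Qed.

Lemma grouplike_lregI g (x y : C) : grouplike g -> g * x = g * y -> x = y.
Proof.
by move=> /grouplikeVl gV e; rewrite -[x]mul1r -[y]mul1r -gV -!mulrA e.
Qed.

Lemma grouplike_rregI g (x y : C) : grouplike g -> x * g = y * g -> x = y.
Proof.
by move=> /grouplikeVr gV e; rewrite -[x]mulr1 -[y]mulr1 -gV !mulrA e.
Qed.

Lemma grouplike_commV g (x : C) : grouplike g -> g * x = x * g ->
  antipode g * x = x * antipode g.
Proof.
move=> gg e; apply: (grouplike_lregI gg).
by rewrite !mulrA e grouplikeVr // mul1r -mulrA grouplikeVr // mulr1.
Qed.

Lemma comatrix_diag g h :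
  comatrix (mx2 g 0 0 h) <-> grouplike g /\ grouplike h.
Proof.
have c0 : comul (0 : C) = 0 by apply: linP0 (@comul_linear _ C).
have e0 : counit (0 : C) = 0 by apply: (@linP0 _ _ k^o _ (@counit_linear _ C)).
rewrite /comatrix !map_mx2 mul_mx2 mx2_1 !mx2_eq c0 e0 !tensM !mul1r !mulr1 !tens0l !tens0r.
rewrite !addr0 !add0r; split=> [[[gc _ _ hc] [ge _ _ he]] //|[[gc ge] [hc he]]].
by split; split.
Qed.

Lemma comatrix_jordan g y : comatrix (mx2 g y 0 g) <->
  [/\ grouplike g, comul y = tens g y + tens y g & counit y = 0].
Proof.
have c0 : comul (0 : C) = 0 by apply: linP0 (@comul_linear _ C).
have e0 : counit (0 : C) = 0 by apply: (@linP0 _ _ k^o _ (@counit_linear _ C)).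
rewrite /comatrix !map_mx2 mul_mx2 mx2_1 !mx2_eq c0 e0 !tensM !mul1r !mulr1 !tens0l !tens0r.
rewrite !addr0 !add0r; split=> [[[gc yc _ _] [ge ye _ _]] //|[[gc ge] yc ye]].
by split; split.
Qed.

End Grouplike.

Section GroupAlgebraHom.
Context (k : fieldType) (G : groupType).

Lemma group_alg_hom (C : hopfType k) (phi : G -> C) : phi 1%g = 1 ->
  (forall a b, phi (a * b)%g = phi a * phi b) -> (forall a, grouplike (phi a)) ->
  hopf_hom (mext phi : group_alg k G -> C).
Proof.
move=> p1 pM pg; have fl := mext_linear phi; have fm := mext_monoid_morphism p1 pM.
have dl := @comul_linear _ (group_alg k G); have Dl := @comul_linear _ C.
apply: hopf_homI => //.
  apply: monoid_alg_linP => [||a].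
  - exact: linP_comp.
  - by apply: linP_comp => //; apply: tmap_linear.
  have -> : comul (mmon k a : group_alg k G) = tens (mmon k a : group_alg k G) (mmon k a : group_alg k G).
    exact: ga_comulE.
  by rewrite tmapE // [mext phi _]mext_mmon; have [] := pg a.
apply: (@monoid_alg_linP k G k^o) => [||a].
- by apply: linP_comp => //; apply: counit_linear.
- exact: (@counit_linear k (group_alg k G)).
rewrite mext_mmon; have [_ ->] := pg a.
by have -> : counit (mmon k a : group_alg k G) = 1 by exact: ga_counitE.
Qed.

Lemma group_alg_cocommutative : cocommutative (group_alg k G).
Proof.
apply: (@monoid_alg_linP k G (tensor (group_alg k G) (group_alg k G))) => [||a].
- exact: (linP_comp (@tswap_linear _ _ _) (@comul_linear k (group_alg k G))).
- exact: (@comul_linear k (group_alg k G)).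
have -> : comul (mmon k a : group_alg k G) = tens (mmon k a : group_alg k G) (mmon k a : group_alg k G).
  exact: ga_comulE.
exact: tswapE.
Qed.

Lemma mmon_grouplike (a : G) : grouplike (mmon k a : group_alg k G).
Proof. by split; [apply: ga_comulE|apply: ga_counitE]. Qed.

Lemma mmon_antipode (a : G) :
  antipode (mmon k a : group_alg k G) = mmon k (a^-1)%g.
Proof. exact: ga_antipodeE. Qed.

Lemma mmon_form_exists (a b : G) : a <> b ->
  exists f : group_alg k G -> k^o, [/\ linear f, f (mmon k a) = 1 & f (mmon k b) = 0].
Proof.
move=> /eqP/negPf ab; exists (mext (fun c => (c == a)%:R)); split.
- exact: mext_linear.
- by rewrite (@mext_mmon k G k^o) eqxx.
by rewrite (@mext_mmon k G k^o) eq_sym ab.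
Qed.

End GroupAlgebraHom.

Section ZsqHom.
Context (k : fieldType) (C : hopfType k).
Implicit Types g h : C.

(** Integer powers of a group-like element, with [antipode g] as its inverse; [Negz n] is [-(n+1)],
    hence the exponent [n.+1]. *)
Definition gpow g (n : int) : C :=
  match n with Posz n => g ^+ n | Negz n => antipode g ^+ n.+1 end.

Lemma gpow_grouplike g n : grouplike g -> grouplike (gpow g n).
Proof. by move=> gg; case: n => n; apply: grouplikeX => //; apply: grouplikeV. Qed.

Lemma gpowS g n : grouplike g -> gpow g (1 + n) = g * gpow g n.
Proof.
move=> gg; case: n => [n|[|n]]; first by rewrite -exprS.
  by rewrite /= expr1 grouplikeVr.
have -> : 1 + Negz n.+1 = Negz n by rewrite !NegzE; lia.
by rewrite /= [in RHS]exprS mulrA grouplikeVr // mul1r.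
Qed.

Lemma gpowD g m n : grouplike g -> gpow g (m + n) = gpow g m * gpow g n.
Proof.
move=> gg; elim/int_ind: m => [|m IH|m IH]; first by rewrite add0r mul1r.
  by rewrite -[m.+1]add1n PoszD -addrA !gpowS // IH mulrA.
have Sm : 1 + - m.+1%:Z = - m%:Z by lia.
apply: (grouplike_lregI gg); rewrite mulrA -!gpowS // addrA Sm; exact: IH.
Qed.

Lemma gpow_comm g (x : C) n : grouplike g -> g * x = x * g ->
  gpow g n * x = x * gpow g n.
Proof.
move=> gg e; case: n => n; apply/esym/commrX/esym => //.
exact: grouplike_commV.
Qed.

Definition Zsq_x : group_alg k Zsq := mmon k ((1, 0) : Zsq).
Definition Zsq_y : group_alg k Zsq := mmon k ((0, 1) : Zsq).

Lemma Zsq_hom g h : grouplike g -> grouplike h -> g * h = h * g ->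
  exists f : group_alg k Zsq -> C, [/\ hopf_hom f, f Zsq_x = g & f Zsq_y = h].
Proof.
move=> gg hg gh; pose phi (u : Zsq) := gpow g u.1 * gpow h u.2.
exists (mext phi); split.
- apply: group_alg_hom; first by rewrite /phi mulr1.
    move=> [a b] [c d]; rewrite /phi /= !gpowD // !mulrA; congr (_ * _).
    rewrite -!mulrA; congr (_ * _); apply: gpow_comm => //.
    exact/esym/gpow_comm.
  by move=> u; apply: grouplikeM; apply: gpow_grouplike.
- by rewrite [mext _ _]mext_mmon /phi /= expr1 mulr1.
by rewrite [mext _ _]mext_mmon /phi /= expr1 mul1r.
Qed.

End ZsqHom.

Section GammaHom.
Context (k : fieldType) (C : hopfType k).
Implicit Types g h : C.

Local Notation R := [:: ([:: (0 : 'I_2, true); (0, true)], [:: (1 : 'I_2, true); (1, true)])].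

Definition Gamma_f : group_alg k Gamma := mmon k (pgpi R [:: (0 : 'I_2, true)]).
Definition Gamma_g : group_alg k Gamma := mmon k (pgpi R [:: (1 : 'I_2, true)]).

Lemma Gamma_hom g h : grouplike g -> grouplike h -> g * g = h * h ->
  exists f : group_alg k Gamma -> C, [/\ hopf_hom f, f Gamma_f = g & f Gamma_g = h].
Proof.
move=> gg hg gh.
pose letter (x : 'I_2 * bool) := let u := if x.1 == 0 then g else h in
  if x.2 then u else antipode u.
pose val (w : seq ('I_2 * bool)) := \prod_(x <- w) letter x.
have lg x : grouplike (letter x).
  by rewrite /letter; case: (x.1 == 0); case: x.2 => //; apply: grouplikeV.
have valP u v : word_eqv R u v -> val u = val v.
  elim=> {u v} [//|u v _ -> //|u v w _ -> _ -> //|u u' v v' _ IH _ IH'|x b|u v].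
  - by rewrite /val !big_cat /=; congr (_ * _).
  - rewrite /val !big_cons big_nil mulr1 /letter /=.
    by case: (x == 0); case: b => /=; rewrite ?grouplikeVr ?grouplikeVl.
  by rewrite inE => /eqP[-> ->]; rewrite /val !big_cons !big_nil /letter /= !mulr1.
pose phi (u : Gamma) := val (pgrepr u).
have phiE w : phi (pgpi R w) = val w by apply: valP; apply: pgrepr_pi.
exists (mext phi); split.
- apply: group_alg_hom.
  + by rewrite [1%g]/(pg_one R) /pg_one phiE /val big_nil.
  + move=> u v; rewrite [(u * v)%g]/(pg_mul u v) /pg_mul phiE /val big_cat //.
  move=> u; rewrite /phi /val; elim/big_rec: _ => [|x w _]; first exact: grouplike1.
  exact: grouplikeM.
- by rewrite [mext _ _]mext_mmon phiE /val big_seq1.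
by rewrite [mext _ _]mext_mmon phiE /val big_seq1.
Qed.

(** The parity of the number of letters [g] or [g^-1] in a word is invariant: cancellation removes
    zero or two of them, and the relation exchanges none for two. *)
Lemma Gamma_f_neq_g : pgpi R [:: (0 : 'I_2, true)] <> pgpi R [:: (1 : 'I_2, true)].
Proof.
move=> /pgP; pose par (w : seq ('I_2 * bool)) := odd (count (fun x => x.1 == 1) w).
suff parP u v : word_eqv R u v -> par u = par v by move/parP.
elim=> {u v} [//|u v _ -> //|u v w _ -> _ -> //|u u' v v' _ IH _ IH'|x b|u v].
- by rewrite /par !count_cat !oddD; congr addb.
- by rewrite /par /= addn0 oddD addbb.
by rewrite inE => /eqP[-> ->].
Qed.

End GammaHom.

(** * Maps out of [A0 l], and its generators *)

Section A0Hom.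
Context (k : fieldType) (l : k).
Local Notation F := (free_alg k 'I_3).
Local Notation J := (gen_ideal (@A0_proper k l)).

Lemma A0_hom (C : hopfType k) (g y : C) : grouplike g ->
  comul y = tens y 1 + tens 1 y -> counit y = 0 -> y * g = l *: (g * y) ->
  exists f : A0 l -> C, [/\ hopf_hom f, f (A0_x l) = g & f (A0_y l) = y].
Proof.
move=> gg yc ye yg; pose gen (i : 'I_3) := [:: g; antipode g; y]`_i.
have fl := free_lift_linear gen; have fm := free_lift_morph gen.
have f0 x : J x -> free_lift gen x = 0.
  apply: (ideal_span_kill fl fm) => _ [];
    rewrite (linPB fl) ?(linPZ _ fl) ?fm.1 !fm.2 !free_lift_gen /gen /=.
  - by rewrite grouplikeVr ?subrr.
  - by rewrite grouplikeVl ?subrr.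
  by rewrite yg subrr.
pose f : A0 l -> C := qlift (free_lift gen).
have Fl : linear f by apply: qlift_linear.
have Fm : monoid_morphism f by apply: qlift_monoid_morphism.
have fE i : f (A0_gen l i) = gen i by rewrite /f [LHS]qliftE // free_lift_gen.
have dl := @comul_linear _ (A0 l); have dm := @comul_morph _ (A0 l).
have Dl := @comul_linear _ C; have Dm := @comul_morph _ C.
have [gc ge] := gg; have [Vc Ve] := grouplikeV gg.
exists f; split; [|exact: (fE 0)|exact: (fE 2)].
apply: hopf_homI => //.
  apply: A0_hom_ext.
  - exact: linP_comp.
  - by apply: linP_comp => //; apply: tmap_linear.
  - exact: morph_comp.
  - by apply: morph_comp => //; apply: tmap_morph.
  move=> i; rewrite fE [comul (A0_gen l i)]A0_comul_genE.
  have tl := tmap_linear Fl Fl.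
  move: i; apply: A0_gen_ind; rewrite /A0_comul_gen /gen /=.
  - by rewrite tmapE // gc (fE 0).
  - by rewrite tmapE // Vc (fE 1).
  by rewrite (linPD tl) !tmapE // yc (fE 2) Fm.1.
apply: (@A0_hom_ext k l k^o).
- by apply: linP_comp => //; apply: counit_linear.
- exact: (@counit_linear k (A0 l)).
- by apply: (@morph_comp k _ _ k^o) => //; apply: counit_morph.
- exact: (@counit_morph k (A0 l)).
move=> i; rewrite fE [counit (A0_gen l i)]A0_counit_genE.
by move: i; apply: A0_gen_ind.
Qed.

Lemma A0_cocommutative : cocommutative (A0 l).
Proof.
have dl := @comul_linear _ (A0 l); have dm := @comul_morph _ (A0 l).
apply: A0_hom_ext => //.
- exact: (linP_comp (@tswap_linear _ _ _)).
- exact: (morph_comp (@tswap_morph _ _ _)).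
move=> i; rewrite [comul (A0_gen l i)]A0_comul_genE.
move: i; apply: A0_gen_ind; rewrite /A0_comul_gen /= ?tswapE //.
by rewrite (linPD (@tswap_linear _ _ _)) !tswapE addrC.
Qed.

Lemma A0_x_grouplike : grouplike (A0_x l).
Proof. by split; [apply: (A0_comul_genE l 0)|apply: (A0_counit_genE l 0)]. Qed.

Lemma A0_y_primitive : comul (A0_y l) = tens (A0_y l) 1 + tens 1 (A0_y l).
Proof. exact: (A0_comul_genE l 2). Qed.

Lemma A0_counit_y : counit (A0_y l) = 0.
Proof. exact: (A0_counit_genE l 2). Qed.

Lemma A0_antipode_x : antipode (A0_x l) = A0_xV l.
Proof. exact: (A0_antipode_genE l 0). Qed.

(* [x = diag(1, l)], [y = E_12] is a representation in which [y] acts nontrivially. *)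
Lemma A0_y_neq0 : l != 0 -> A0_y l != 0.
Proof.
move=> l0.
pose gen (i : 'I_3) : 'M[k]_2 :=
  [:: mx2 1 0 0 l; mx2 1 0 0 l^-1; mx2 0 1 0 0]`_i.
have fl := free_lift_linear gen; have fm := free_lift_morph gen.
have f0 x : J x -> free_lift gen x = 0.
  apply: (ideal_span_kill fl fm) => _ [];
    rewrite (linPB fl) ?(linPZ _ fl) ?fm.1 !fm.2 !free_lift_gen /gen /=;
    rewrite -!mulmxE !mul_mx2 ?mulr0 ?mul0r ?mulr1 ?mul1r ?add0r ?addr0.
  - by rewrite mulfV // -mx2_1 subrr.
  - by rewrite mulVf // -mx2_1 subrr.
  have -> : l *: mx2 0 1 0 0 = mx2 0 l 0 0 :> 'M[k]_2.
    by rewrite scale_mx2 !mulr0 mulr1.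
  by rewrite subrr.
apply/eqP => y0; have : qlift (free_lift gen) (A0_y l) = 0.
  by rewrite y0; apply: linP0; apply: qlift_linear.
rewrite [LHS]qliftE // free_lift_gen /gen /= => /matrixP/(_ 0 1).
by rewrite !mxE /= => /eqP; rewrite oner_eq0.
Qed.

Lemma hopf_subalgebra_A0 (P : A0 l -> Prop) : hopf_subalgebra P ->
  P (A0_x l) -> P (A0_y l) -> forall h, P h.
Proof.
move=> [P1 PL PM _ PS] Px Py.
have PxV : P (A0_xV l) by rewrite -A0_antipode_x; apply: PS.
have P0 : P 0 by have := PL (-1) _ _ P1 P1; rewrite scaleN1r addNr.
elim/qpi_ind=> x; move: (x : {malg k[fmonom 'I_3]}) => {}x.
rewrite [x]monalgE (linP_sum _ _ (@qpi_linear _ _ J)).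
elim/big_rec: _ => // w y _ Py'.
rewrite monalgU_mmon -qpiZ; apply: PL => //; case: w => w; elim: w => [|i w IH].
  by rewrite mmon_nil.
rewrite mmon_cons -qpiM; apply: PM => //.
by move: i; apply: A0_gen_ind.
Qed.

End A0Hom.

Section GroupAlgRelations.
Context (k : fieldType).

Lemma Zsq_xyC : Zsq_x k * Zsq_y k = Zsq_y k * Zsq_x k.
Proof. by rewrite /Zsq_x /Zsq_y -!mmonM; congr mmon. Qed.

Lemma Gamma_ffE : Gamma_f k * Gamma_f k = Gamma_g k * Gamma_g k.
Proof.
rewrite /Gamma_f /Gamma_g -!mmonM; congr mmon.
rewrite [LHS]pg_mulE [RHS]pg_mulE; apply/pgP/word_eqv_rel.
exact: mem_head.
Qed.

End GroupAlgRelations.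

Section GroupAlgSub.
Context (k : fieldType).
Local Notation R := [:: ([:: (0 : 'I_2, true); (0, true)], [:: (1 : 'I_2, true); (1, true)])].

Lemma hopf_subalgebra_group_alg (G : groupType) (P : group_alg k G -> Prop) :
  hopf_subalgebra P -> (forall a : G, P (mmon k a)) -> forall h, P h.
Proof.
move=> [P1 PL _ _ _] Pa x; have P0 : P 0 by have := PL (-1) _ _ P1 P1; rewrite scaleN1r addNr.
rewrite [x]monalgE; elim/big_rec: _ => // w y _ Py.
by rewrite monalgU_mmon; apply: PL.
Qed.

Lemma hopf_subalgebra_Zsq (P : group_alg k Zsq -> Prop) : hopf_subalgebra P ->
  P (Zsq_x k) -> P (Zsq_y k) -> forall h, P h.
Proof.
move=> Ps Px Py; apply: hopf_subalgebra_group_alg => //; have [P1 _ PM _ PS] := Ps.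
have pow (u : Zsq) (n : nat) : P (mmon k u) -> P (mmon k (u ^+ n)%g).
  move=> Pu; elim: n => [|n IH]; first by rewrite expg0 mmon1.
  by rewrite expgS mmonM; apply: PM.
have inv (u : Zsq) : P (mmon k u) -> P (mmon k u^-1%g).
  by rewrite -mmon_antipode; apply: PS.
have powx n : (((1%R, 0%R) : Zsq) ^+ n)%g = (n%:Z, 0).
  elim: n => // n IH; rewrite expgS IH [(_ * _)%g]/(Zsq_mul _ _) /Zsq_mul /=.
  by congr (_, _); lia.
have powy n : (((0%R, 1%R) : Zsq) ^+ n)%g = (0, n%:Z).
  elim: n => // n IH; rewrite expgS IH [(_ * _)%g]/(Zsq_mul _ _) /Zsq_mul /=.
  by congr (_, _); lia.
have PX (m : int) : P (mmon k ((m, 0) : Zsq)).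
  case: m => m; first by rewrite -powx; apply: pow.
  have -> : (Negz m, 0) = ((((1%R, 0%R) : Zsq) ^+ m.+1)^-1)%g.
    by rewrite powx [(_^-1)%g]/(Zsq_inv _) /Zsq_inv /= oppr0 NegzE.
  by apply/inv/pow.
have PY (m : int) : P (mmon k ((0, m) : Zsq)).
  case: m => m; first by rewrite -powy; apply: pow.
  have -> : (0, Negz m) = ((((0%R, 1%R) : Zsq) ^+ m.+1)^-1)%g.
    by rewrite powy [(_^-1)%g]/(Zsq_inv _) /Zsq_inv /= oppr0 NegzE.
  by apply/inv/pow.
move=> [a b]; have -> : (a, b) = (((a, 0%R) : Zsq) * ((0%R, b) : Zsq))%g.
  by rewrite [(_ * _)%g]/(Zsq_mul _ _) /Zsq_mul /= addr0 add0r.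
by rewrite mmonM; apply: PM.
Qed.

Lemma hopf_subalgebra_Gamma (P : group_alg k Gamma -> Prop) : hopf_subalgebra P ->
  P (Gamma_f k) -> P (Gamma_g k) -> forall h, P h.
Proof.
move=> Ps Pf Pg; apply: hopf_subalgebra_group_alg => //; have [P1 _ PM _ PS] := Ps.
elim/pg_ind; elim=> [|[i b] w IH]; first exact: P1.
have -> : pgpi R ((i, b) :: w) = (pgpi R [:: (i, b)] * pgpi R w)%g :> Gamma.
  exact/esym/pg_mulE.
rewrite mmonM; apply: PM => //.
have Pt : P (mmon k (pgpi R [:: (i, true)] : Gamma)) by move: i; elim/I2_ind.
case: b => //.
have -> : pgpi R [:: (i, false)] = ((pgpi R [:: (i, true)] : Gamma)^-1)%g.
  exact/esym/pg_invE.
by rewrite -mmon_antipode; apply: PS.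
Qed.

End GroupAlgSub.

(** * Classification of cocommutative coactions *)

Section Forms.
Context (k : fieldType).

(** The entries of the form stay as coefficients on both sides because any of them may vanish; each
    nonzero one equates a product of [g] and [h] with the same [d]. *)
Lemma preserves_diag (C : algType k) a b c e (g h : C) :
  preserves_form (mx2 a b c e) (mx2 g 0 0 h) <->
  exists d, [/\ a *: (g * g) = a *: d, b *: (g * h) = b *: d,
                c *: (h * g) = c *: d & e *: (h * h) = e *: d].
Proof.
have E d : mx2 g 0 0 h *m smx C (mx2 a b c e) *m (mx2 g 0 0 h)^T = d *: smx C (mx2 a b c e) <->
  [/\ a *: (g * g) = a *: d, b *: (g * h) = b *: d,
      c *: (h * g) = c *: d & e *: (h * h) = e *: d].
  rewrite /smx !map_mx2 /= tr_mx2 !mul_mx2 scale_mx2 !mul0r !mulr0 !addr0 !add0r.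
  by rewrite mx2_eq !mulr_algr !scalerAl.
by split=> -[d /E e0]; exists d.
Qed.

Lemma preserves_jordan (C : algType k) a b c e (g y : C) :
  preserves_form (mx2 a b c e) (mx2 g y 0 g) <->
  exists d, [/\ a *: (g * g) + c *: (y * g) + (b *: (g * y) + e *: (y * y)) = a *: d,
                b *: (g * g) + e *: (y * g) = b *: d,
                c *: (g * g) + e *: (g * y) = c *: d & e *: (g * g) = e *: d].
Proof.
have E d : mx2 g y 0 g *m smx C (mx2 a b c e) *m (mx2 g y 0 g)^T = d *: smx C (mx2 a b c e) <->
  [/\ a *: (g * g) + c *: (y * g) + (b *: (g * y) + e *: (y * y)) = a *: d,
      b *: (g * g) + e *: (y * g) = b *: d,
      c *: (g * g) + e *: (g * y) = c *: d & e *: (g * g) = e *: d].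
  rewrite /smx !map_mx2 /= tr_mx2 !mul_mx2 scale_mx2 !mul0r !mulr0 !add0r.
  by rewrite mx2_eq !mulr_algr !mulrDl !scalerAl.
by split=> -[d /E e0]; exists d.
Qed.

End Forms.

(** * Shape of a comatrix over a cocommutative Hopf algebra *)

Section Shape.
Context (k : fieldType) (C : hopfType k) (c : 'M[C]_2).
Hypotheses (Cc : cocommutative C) (cc : comatrix c).

Lemma form_eq0 (u : C) : (forall f : C -> k^o, linear f -> f u = 0) -> u = 0.
Proof.
move=> fu; apply/eqP/negPn/negP => /linear_form_exists[f [fl f1]].
by have /eqP := fu f fl; rewrite f1 oner_eq0.
Qed.

(** Every [map_mx g c] commutes with a diagonal matrix with distinct eigenvalues, hence is diagonal;
    linear forms detect that the off-diagonal entries of [c] vanish. *)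
Lemma comatrix_diag_shape (f : C -> k^o) (a b : k) : linear f ->
  map_mx f c = mx2 a 0 0 b :> 'M[k]_2 -> a != b -> c = mx2 (c 0 0) 0 0 (c 1 1).
Proof.
move=> fl fc ab; rewrite [LHS]mx2E.
have F (g : C -> k^o) : linear g -> g (c 0 1) = 0 /\ g (c 1 0) = 0.
  move=> gl; have := comatrix_commute Cc cc fl gl.
  rewrite fc [map_mx g c : 'M[k]_2]mx2E !mul_mx2 !mxE.
  rewrite !mul0r !mulr0 !addr0 !add0r => /mx2_eq[_ e1 e2 _].
  have ab' : a - b != 0 by rewrite subr_eq0.
  by split; apply: (mulfI ab'); rewrite mulr0 mulrBl ?e1 ?e2 [X in X - _]mulrC subrr.
by congr mx2; apply: form_eq0 => g /F[].
Qed.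

(** The matrices commuting with a nontrivial Jordan block are upper triangular with equal diagonal
    entries. *)
Lemma comatrix_jordan_shape (f : C -> k^o) (a b : k) : linear f ->
  map_mx f c = mx2 a b 0 a :> 'M[k]_2 -> b != 0 -> c = mx2 (c 0 0) (c 0 1) 0 (c 0 0).
Proof.
move=> fl fc b0; rewrite [LHS]mx2E.
have F (g : C -> k^o) : linear g -> g (c 1 0) = 0 /\ g (c 1 1) = g (c 0 0).
  move=> gl; have := comatrix_commute Cc cc fl gl.
  rewrite fc [map_mx g c : 'M[k]_2]mx2E !mul_mx2 !mxE.
  rewrite !mul0r !mulr0 !addr0 !add0r => /mx2_eq[e0 e1 _ _].
  split; apply: (mulfI b0).
    by rewrite mulr0; apply: (addrI (a * g (c 0 0))); rewrite addr0 e0 mulrC.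
  by apply: (addrI (a * g (c 0 1))); rewrite e1 addrC [g _ * a]mulrC [g _ * b]mulrC.
congr mx2; first by apply: form_eq0 => g /F[].
apply/eqP; rewrite -subr_eq0; apply/eqP/form_eq0 => g gl.
by rewrite (linPB gl) (F g gl).2 subrr.
Qed.

End Shape.

(** * Generic matrices over the three Hopf algebras *)

Section Models.
Context (k : fieldType).

Definition hopf_generates (H : hopfType k) (c : 'M[H]_2) : Prop :=
  forall P, hopf_subalgebra P -> (forall i j, P (c i j)) -> forall h, P h.

(* The key field is [model_lift]: a cocommutative coaction mapping onto [c] is also an
   image of [c]; this gives maximality. *)
Record model (A : 'M[k]_2) (H : hopfType k) (c : 'M[H]_2) : Prop := Model {
  model_cocommutative : cocommutative H;
  model_comatrix : comatrix c;
  model_form : preserves_form A c;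
  model_generates : hopf_generates c;
  model_lift : forall (C : hopfType k) (d : 'M[C]_2) (p : C -> H),
    cocommutative C -> comatrix d -> preserves_form A d ->
    linear p -> monoid_morphism p -> map_mx p d = c ->
    exists s : H -> C, hopf_hom s /\ map_mx s c = d }.

(** Allows each model to be verified only for a convenient form congruent to [rel_form]. For the
    lifting property, [d] is conjugated back, lifted, and the scalar matrices are carried through
    [s]. *)
Lemma model_conj (A P P' : 'M[k]_2) (H : hopfType k) (c : 'M[H]_2) :
  P *m P' = 1%:M -> P' *m P = 1%:M -> model A c ->
  model (P *m A *m P^T) (smx H P *m c *m smx H P').
Proof.
have back (Q Q' : 'M[k]_2) (K : algType k) (e : 'M[K]_2) : Q' *m Q = 1%:M ->
    smx K Q' *m (smx K Q *m e *m smx K Q') *m smx K Q = e.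
  move=> Q1; rewrite -!mulmxA -[smx K Q' *m smx K Q]smxM Q1 smx1 mulmx1.
  by rewrite mulmxA -smxM Q1 smx1 mul1mx.
move=> PP PP' [Hc cm cf cg cl]; split=> //.
- exact: comatrix_conj.
- exact: preserves_form_conj.
- move=> S [S1 SL SM Sc SS] Sij; apply: cg; first by split.
  have S0 : S 0 by have := SL (-1) _ _ S1 S1; rewrite scaleN1r addNr.
  have SD u v : S u -> S v -> S (u + v) by move=> Su; rewrite -[u]scale1r; apply: SL.
  have SZ a u : S u -> S (a *: u) by move=> Su; rewrite -[_ *: _]addr0; apply: SL.
  move=> i j; rewrite -(back _ _ _ c PP') mxE sum_I2 ![(smx H P' *m _) _ _]mxE !sum_I2.
  move: Sij; set d := _ *m _ *m _ => Sij.
  by rewrite ![smx _ _ _ _]mxE !mulr_algl !mulr_algr; apply: (SD _ _); apply/(SZ _ _)/(SD _ _); apply/(SZ _ _).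
move=> C d p Cc dm df pl pm pd.
have [||||||s [sh sc]] := cl C (smx C P' *m d *m smx C P) p => //.
- exact: comatrix_conj.
- have := preserves_form_conj PP df; rewrite -!mulmxA -trmx_mul PP' trmx1 mulmx1.
  by rewrite mulmxA PP' mul1mx.
- by rewrite !map_algM // !map_smx ?pm.1 // pd back.
exists s; split=> //; have [sl sm _ _ _] := sh.
by rewrite !map_algM // !map_smx ?sm.1 // sc back.
Qed.

Lemma Zsq_lift (C : hopfType k) (b c : k) (g h : C) : b != 0 -> c != 0 ->
  comatrix (mx2 g 0 0 h) -> preserves_form (mx2 0 b c 0) (mx2 g 0 0 h) ->
  exists s : group_alg k Zsq -> C,
    hopf_hom s /\ map_mx s (mx2 (Zsq_x k) 0 0 (Zsq_y k)) = mx2 g 0 0 h.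
Proof.
move=> b0 c0 /comatrix_diag[gg hg] /preserves_diag[d [_ e1 e2 _]].
have gh : g * h = h * g by rewrite (scalerI b0 e1) (scalerI c0 e2).
have [s [sh sx sy]] := Zsq_hom gg hg gh; exists s; split=> //.
by have [sl _ _ _ _] := sh; rewrite map_mx2 sx sy (linP0 sl).
Qed.

Lemma model_Zsq (b c : k) : b != 0 -> c != 0 ->
  model (mx2 0 b c 0) (mx2 (Zsq_x k) 0 0 (Zsq_y k)).
Proof.
move=> b0 c0; split.
- exact: group_alg_cocommutative.
- by apply/comatrix_diag; split; apply: mmon_grouplike.
- apply/preserves_diag; exists (Zsq_x k * Zsq_y k); by rewrite !scale0r Zsq_xyC.
- move=> P Ps Pc; apply: hopf_subalgebra_Zsq => //.
    by have := Pc 0 0; rewrite mxE.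
  by have := Pc 1 1; rewrite mxE.
move=> C d p Cc dm df pl pm pd.
(* A form separating the two group-likes turns the generic matrix into [diag(1, 0)]; precomposed
   with [p], it forces [d] to be diagonal as well. *)
have [//|f [fl f1 f0]] := @mmon_form_exists k Zsq (1, 0) (0, 1).
have dE : d = mx2 (d 0 0) 0 0 (d 1 1).
  apply: (@comatrix_diag_shape _ _ _ Cc dm (fun u => f (p u)) 1 0); last exact: oner_neq0.
    exact: linP_comp.
  by rewrite map_mx_comp pd map_mx2 f1 f0 (linP0 fl).
by rewrite dE in dm df *; apply: Zsq_lift df.
Qed.

Lemma Gamma_lift (C : hopfType k) (a e : k) (g h : C) : a != 0 -> e != 0 ->
  comatrix (mx2 g 0 0 h) -> preserves_form (mx2 a 0 0 e) (mx2 g 0 0 h) ->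
  exists s : group_alg k Gamma -> C,
    hopf_hom s /\ map_mx s (mx2 (Gamma_f k) 0 0 (Gamma_g k)) = mx2 g 0 0 h.
Proof.
move=> a0 e0 /comatrix_diag[gg hg] /preserves_diag[d [e1 _ _ e2]].
have gh : g * g = h * h by rewrite (scalerI a0 e1) (scalerI e0 e2).
have [s [sh sx sy]] := Gamma_hom gg hg gh; exists s; split=> //.
by have [sl _ _ _ _] := sh; rewrite map_mx2 sx sy (linP0 sl).
Qed.

Lemma model_Gamma (a e : k) : a != 0 -> e != 0 ->
  model (mx2 a 0 0 e) (mx2 (Gamma_f k) 0 0 (Gamma_g k)).
Proof.
move=> a0 e0; split.
- exact: group_alg_cocommutative.
- by apply/comatrix_diag; split; apply: mmon_grouplike.
- apply/preserves_diag; exists (Gamma_f k * Gamma_f k); by rewrite !scale0r Gamma_ffE.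
- move=> P Ps Pc; apply: hopf_subalgebra_Gamma => //.
    by have := Pc 0 0; rewrite mxE.
  by have := Pc 1 1; rewrite mxE.
move=> C d p Cc dm df pl pm pd.
have [f [fl f1 f0]] := @mmon_form_exists k Gamma _ _ Gamma_f_neq_g.
have dE : d = mx2 (d 0 0) 0 0 (d 1 1).
  apply: (@comatrix_diag_shape _ _ _ Cc dm (fun u => f (p u)) 1 0); last exact: oner_neq0.
    exact: linP_comp.
  by rewrite map_mx_comp pd map_mx2 f1 f0 (linP0 fl).
by rewrite dE in dm df *; apply: Gamma_lift df.
Qed.

(** The [(1, 0)] entry gives [d = g * g], so the corner [a] cancels from the [(0, 0)] entry, which
    reduces to [y * g = l *: (g * y)]. Since [y] is skew-primitive, the generator [A0_y l] has to go
    to the primitive element [antipode g * y]. *)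
Lemma A0_lift (C : hopfType k) (l a c : k) (g y : C) : c != 0 ->
  comatrix (mx2 g y 0 g) -> preserves_form (mx2 a (- l * c) c 0) (mx2 g y 0 g) ->
  exists s : A0 l -> C,
    hopf_hom s /\ map_mx s (mx2 (A0_x l) (A0_x l * A0_y l) 0 (A0_x l)) = mx2 g y 0 g.
Proof.
move=> c0 /comatrix_jordan[gg yc ye] /preserves_jordan[d [e0 _ e2 _]].
have dE : g * g = d by apply: (scalerI c0); rewrite -e2 scale0r addr0.
have yg : y * g = l *: (g * y).
  apply: (scalerI c0); move: e0; rewrite scale0r addr0 -dE -addrA.
  move=> /(canRL (addKr _)); rewrite addNr mulNr scaleNr => /eqP.
  by rewrite subr_eq0 => /eqP ->; rewrite scalerA mulrC.
have Vl := grouplikeVl gg; have Vr := grouplikeVr gg; have Vg := grouplikeV gg.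
have [Vc Ve] := Vg; have [_ dM] := @comul_morph _ C.
have [|||s [sh sx sy]] := @A0_hom k l C g (antipode g * y) gg.
- by rewrite dM Vc yc mulrDr !tensM Vl addrC.
- by rewrite (@counit_morph _ C).2 ye mulr0.
- by rewrite -mulrA yg -scalerAr !mulrA Vl Vr.
exists s; split=> //; have [sl sm _ _ _] := sh.
by rewrite map_mx2 sm.2 sx sy (linP0 sl) mulrA Vr mul1r.
Qed.

Lemma model_A0 (l a c : k) : l != 0 -> c != 0 ->
  model (mx2 a (- l * c) c 0) (mx2 (A0_x l) (A0_x l * A0_y l) 0 (A0_x l)).
Proof.
move=> l0 c0; have xg := A0_x_grouplike l; have [xc xe] := xg.
have Vl := grouplikeVl xg; have [_ dM] := @comul_morph _ (A0 l).
split.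
- exact: A0_cocommutative.
- apply/comatrix_jordan; split=> //.
    by rewrite dM xc A0_y_primitive mulrDr !tensM !mulr1 addrC.
  by rewrite (@counit_morph _ (A0 l)).2 A0_counit_y mulr0.
- apply/preserves_jordan; exists (A0_x l * A0_x l); rewrite !scale0r !addr0; split=> //.
  rewrite -[A0_x l * A0_y l * _]mulrA A0_yxE -scalerAr scalerA mulNr scaleNr.
  by rewrite [c * l]mulrC -addrA subrr addr0.
- move=> P Ps Pc; have Px : P (A0_x l) by have := Pc 0 0; rewrite mxE.
  apply: (hopf_subalgebra_A0 Ps) => //; have [_ _ PM _ PS] := Ps.
  have := Pc 0 1; rewrite mxE /= => /(PM _ _ (PS _ Px)).
  by rewrite mulrA Vl mul1r.
move=> C d p Cc dm df pl pm pd.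
have xy0 : A0_x l * A0_y l != 0.
  apply/eqP => xy0; have := A0_y_neq0 l0; rewrite -[A0_y l]mul1r -Vl -mulrA xy0 mulr0.
  by rewrite eqxx.
(* With [f (x y) = 1] the generic matrix becomes a nontrivial Jordan block, so [d] inherits the
   Jordan shape. *)
have [f [fl f1]] := linear_form_exists xy0.
have dE : d = mx2 (d 0 0) (d 0 1) 0 (d 0 0).
  apply: (@comatrix_jordan_shape _ _ _ Cc dm (fun u => f (p u)) (f (A0_x l)) 1); last exact: oner_neq0.
    exact: linP_comp.
  by rewrite map_mx_comp pd map_mx2 f1 (linP0 fl).
by rewrite dE in dm df *; apply: A0_lift df.
Qed.

End Models.

(** * Normal form of a non-scalar two-by-two matrix *)

Lemma quadratic_root (k : closedFieldType) (u v : k) : exists t, t ^+ 2 = u + v * t.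
Proof.
have [t tE] := @solve_monicpoly k 2 (nth 0 [:: u; v]) isT.
by exists t; rewrite tE big_ord_recl big_ord1 /= expr0 mulr1 expr1.
Qed.

Lemma mx2_normal_form (k : closedFieldType) (a b c d : k) :
  ~ [/\ b = 0, c = 0 & a = d] -> exists P P' : 'M[k]_2,
    [/\ P *m P' = 1%:M, P' *m P = 1%:M &
      (exists u v, u != v /\ P' *m mx2 a b c d *m P = mx2 u 0 0 v) \/
      (exists u v, v != 0 /\ P' *m mx2 a b c d *m P = mx2 u v 0 u)].
Proof.
have upper (u v w : k) : ~ (v = 0 /\ u = w) -> exists P P' : 'M[k]_2,
    [/\ P *m P' = 1%:M, P' *m P = 1%:M &
      (exists u' v', u' != v' /\ P' *m mx2 u v 0 w *m P = mx2 u' 0 0 v') \/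
      (exists u' v', v' != 0 /\ P' *m mx2 u v 0 w *m P = mx2 u' v' 0 u')].
  move=> nz; have [uw|uw] := eqVneq u w.
    exists 1%:M, 1%:M; rewrite !mulmx1 !mul1mx; split=> //; right.
    by exists u, v; rewrite uw; split=> //; apply/eqP => v0; apply: nz.
  have wu : w - u != 0 by rewrite subr_eq0 eq_sym.
  (* The shear by [m] replaces the corner [v] by [u m + v - m w], which vanishes for this [m]. *)
  pose m := v / (w - u).
  exists (mx2 1 m 0 1), (mx2 1 (- m) 0 1); rewrite mx2_1 !mul_mx2; split.
  - by apply/mx2_eq; split; ring.
  - by apply/mx2_eq; split; ring.
  by left; exists u, w; split=> //; apply/mx2_eq; split; rewrite /m; field.
have [->|c0] := eqVneq c 0.
  by move=> nz; apply: upper => -[b0 ad]; apply: nz.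
move=> _.
have [t tE] := quadratic_root (b * c - a * d) (a + d).
(* [t] is a root of the characteristic polynomial. The first column [(t - d, c)] of [Q] is an
   eigenvector for it; the second, [(1, 0)], is independent of the first as [c] is nonzero, and
   makes the new corner equal to 1. *)
pose Q := mx2 (t - d) 1 c 0; pose Q' := mx2 0 c^-1 1 ((d - t) / c).
have QQ : Q *m Q' = 1%:M.
  by rewrite mul_mx2 mx2_1; apply/mx2_eq; split; field.
have QQ' : Q' *m Q = 1%:M.
  by rewrite mul_mx2 mx2_1; apply/mx2_eq; split; field.
have FQ : Q' *m mx2 a b c d *m Q = mx2 t 1 0 (a + d - t).
  rewrite !mul_mx2; apply/mx2_eq; split; try by field.
  have -> : (1 * a + (d - t) / c * c) * (t - d) + (1 * b + (d - t) / c * d) * c =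
    b * c - a * d + (a + d) * t - t ^+ 2 by field.
  by rewrite tE subrr.
have [|P [P' [PP PP' nf]]] := upper t 1 (a + d - t).
  by move=> [/eqP]; rewrite oner_eq0.
exists (Q *m P), (P' *m Q').
have assoc : P' *m Q' *m mx2 a b c d *m (Q *m P) = P' *m mx2 t 1 0 (a + d - t) *m P.
  by rewrite -FQ !mulmxA.
split; last by rewrite assoc.
  by rewrite -mulmxA [P *m _]mulmxA PP mul1mx.
by rewrite -mulmxA [Q' *m _]mulmxA QQ' mul1mx.
Qed.

Section Classification.
Context (k : closedFieldType) (q : k).
Hypothesis q0 : q != 0.

Definition listed (H : hopfType k) : Prop :=
  [\/ hopf_iso H (group_alg k Zsq), hopf_iso H (A0 q), hopf_iso H (A0 q^-1)
    | q = -1 /\ hopf_iso H (group_alg k Gamma)].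

Lemma classification (C : hopfType k) (c : 'M[C]_2) : cocommutative C ->
  comatrix c -> preserves_form (rel_form q) c ->
  exists (H : hopfType k) (d : 'M[H]_2) (s : H -> C),
    [/\ listed H, model (rel_form q) d, hopf_hom s & map_mx s d = c].
Proof.
move=> Cc cm cf.
have qN0 : - q != 0 by rewrite oppr_eq0.
have [[f [fl fn]]|ns] := pselect (exists f : C -> k^o, linear f /\
    ~ [/\ f (c 0 1) = 0, f (c 1 0) = 0 & f (c 0 0) = f (c 1 1)]); last first.
  have ns' (f : C -> k^o) : linear f -> [/\ f (c 0 1) = 0, f (c 1 0) = 0 & f (c 0 0) = f (c 1 1)].
    by move=> fl; apply: contrapT => fn; apply: ns; exists f.
  (* Every linear form sees a scalar matrix, so [c] is already diagonal; the two off-diagonal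
     entries of [rel_form] are nonzero, and the [Zsq] model applies without a change of basis. *)
  have cE : c = mx2 (c 0 0) 0 0 (c 1 1).
    by rewrite [LHS]mx2E; congr mx2; apply: form_eq0 => f /ns'[].
  rewrite cE in cm cf *; have [s [sh sc]] := Zsq_lift qN0 (oner_neq0 k) cm cf.
  exists (group_alg k Zsq), (mx2 (Zsq_x k) 0 0 (Zsq_y k)), s; split=> //.
    by constructor 1; apply: hopf_iso_refl.
  by apply: model_Zsq => //; apply: oner_neq0.
have [P [P' [PP PP' nf]]] := @mx2_normal_form k _ _ _ _ fn.
pose d := smx C P' *m c *m smx C P; pose A := P' *m rel_form q *m P'^T.
have dm : comatrix d by apply: comatrix_conj.
have df : preserves_form A d by apply: preserves_form_conj.
have cE : c = smx C P *m d *m smx C P'.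
  rewrite /d -!mulmxA -smxM PP smx1 mulmx1 mulmxA -smxM PP smx1 mul1mx //.
have AE : rel_form q = P *m A *m P^T.
  rewrite /A -!mulmxA -trmx_mul PP trmx1 mulmx1 mulmxA PP mul1mx //.
have fd : map_mx f d = P' *m mx2 (f (c 0 0)) (f (c 0 1)) (f (c 1 0)) (f (c 1 1)) *m P :> 'M[k]_2.
  by rewrite /d map_form // [map_mx f c]mx2E !mxE.
suff [H [e [s [Hl em sh se]]]] : exists (H : hopfType k) (e : 'M[H]_2) (s : H -> C),
    [/\ listed H, model A e, hopf_hom s & map_mx s e = d].
  exists H, (smx H P *m e *m smx H P'), s; split=> //.
    by rewrite AE; apply: model_conj.
  by have [sl sm _ _ _] := sh; rewrite !map_algM // !map_smx ?sm.1 // se cE.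
have [w [x [y [z P'E]]]] : exists w x y z : k, P' = mx2 w x y z.
  by do 4!eexists; apply: mx2E.
have D0 : w * z - x * y != 0.
  apply/eqP => D0; have := PP'; rewrite P'E [P]mx2E mul_mx2 mx2_1 => /mx2_eq[].
  set p := P 0 0; set r := P 0 1; set u := P 1 0; set v := P 1 1 => e1 e2 e3 e4.
  have : (w * p + x * u) * (y * r + z * v) - (w * r + x * v) * (y * p + z * u) =
    (w * z - x * y) * (p * v - r * u) by ring.
  by rewrite e1 e4 e2 D0 !mul0r mulr1 subr0 => /eqP; rewrite oner_eq0.
have AE' : A = mx2 ((1 - q) * (w * x)) (x * y - q * (w * z)) (w * z - q * (x * y))
    ((1 - q) * (y * z)).
  by rewrite /A P'E tr_mx2 !mul_mx2; apply/mx2_eq; split; ring.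
clearbody d; pose dl := w * z - x * y; rewrite -/dl in D0.
(* Congruence by [P'] multiplies the determinant of the form by [dl ^+ 2] and its skew part by [dl].
   The rest of the argument uses only these two identities about the entries of [A]. *)
have [a [b [m [e [AE2 detE skewE]]]]] : exists a b m e, [/\ A = mx2 a b m e,
    a * e - b * m = q * dl ^+ 2 & b - m = - ((1 + q) * dl)].
  by do 4!eexists; split; [exact: AE'|rewrite /dl; ring|rewrite /dl; ring].
have bmae0 : a * e - b * m != 0 by rewrite detE mulf_neq0 // expf_neq0.
rewrite AE2 in df *; case: nf => -[u [v [uv nfE]]].
  have dE : d = mx2 (d 0 0) 0 0 (d 1 1).
    by apply: (comatrix_diag_shape Cc dm fl _ uv); rewrite fd.
  move: (congr1 (fun M : 'M[k]_2 => M 0 0) fd) (congr1 (fun M : 'M[k]_2 => M 1 1) fd).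
  rewrite nfE !mxE /= => fg fh.
  have gh : d 0 0 <> d 1 1 by move=> gh; move: uv; rewrite -fg -fh gh eqxx.
  rewrite dE in dm df *; move: (d 0 0) (d 1 1) gh dm df => g h gh dm df.
  have [gg hg] := (comatrix_diag g h).1 dm.
  have [t [ea eb em ee]] := (preserves_diag _ _ _ _ _ _).1 df.
  (* A diagonal and an off-diagonal entry of the form cannot both be nonzero: for instance
     [g * g = t = g * h] would give [g = h], although [f] separates them. *)
  have bm0 : (a != 0) || (e != 0) -> b = 0 /\ m = 0.
    move=> /orP[a0|e0]; split; apply: contrapT => /eqP n0; apply: gh.
    - by apply: (grouplike_lregI gg); rewrite (scalerI a0 ea) (scalerI n0 eb).
    - by apply: (grouplike_rregI gg); rewrite (scalerI a0 ea) (scalerI n0 em).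
    - by apply: (grouplike_rregI hg); rewrite (scalerI e0 ee) (scalerI n0 eb).
    - by apply: (grouplike_lregI hg); rewrite (scalerI e0 ee) (scalerI n0 em).
  have [ae|ae] := boolP ((a != 0) || (e != 0)).
    have [b0 m0] := bm0 ae; rewrite b0 m0 in df detE skewE bmae0 *.
    move: bmae0; rewrite mulr0 subr0 mulf_eq0 negb_or => /andP[a0 e0].
    have [s [sh sc]] := Gamma_lift a0 e0 dm df.
    exists (group_alg k Gamma), (mx2 (Gamma_f k) 0 0 (Gamma_g k)), s; split=> //; last exact: model_Gamma.
    constructor 4; split; last exact: hopf_iso_refl.
    (* With a diagonal form the skew part vanishes, so [(1 + q) * dl = 0]. *)
    move/esym/eqP: skewE; rewrite subrr oppr_eq0 mulf_eq0 (negPf D0) orbF addrC addr_eq0.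
    by move/eqP.
  move: ae; rewrite negb_or !negbK => /andP[/eqP a0 /eqP e0].
  rewrite a0 e0 in df bmae0 *; move: bmae0.
  rewrite mul0r sub0r oppr_eq0 mulf_eq0 negb_or => /andP[b0 m0].
  have [s [sh sc]] := Zsq_lift b0 m0 dm df.
  exists (group_alg k Zsq), (mx2 (Zsq_x k) 0 0 (Zsq_y k)), s; split=> //; last exact: model_Zsq.
  by constructor 1; apply: hopf_iso_refl.
have dE : d = mx2 (d 0 0) (d 0 1) 0 (d 0 0).
  by apply: (comatrix_jordan_shape (a := u) Cc dm fl _ uv); rewrite fd.
move: (congr1 (fun M : 'M[k]_2 => M 0 1) fd); rewrite nfE !mxE /= => fy.
have y0 : d 0 1 != 0 by apply/eqP => y0; move: uv; rewrite -fy y0 (linP0 fl) eqxx.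
rewrite dE in dm df *; move: (d 0 0) (d 0 1) y0 dm df => g h h0 dm df.
have [gg _ _] := (comatrix_jordan g h).1 dm.
(* Here [h] is the corner of the Jordan shape. A nonzero [e] would give [g * g = t], then
   [g * h = 0] from the [(1, 0)] entry, hence [h = 0]. *)
have e0 : e = 0.
  have [t [_ _ em ee]] := (preserves_jordan _ _ _ _ _ _).1 df.
  apply/eqP; apply: contrapT => /negP e0; move/eqP: h0; apply; apply: (grouplike_lregI gg).
  rewrite mulr0; apply: (scalerI e0); rewrite scaler0.
  by apply: (addrI (m *: (g * g))); rewrite addr0 em (scalerI e0 ee).
rewrite e0 mulr0 sub0r oppr_eq0 mulf_eq0 negb_or in bmae0.
have /andP[b0 m0] := bmae0.
(* Read off so that the form is [mx2 a (- l * m) m 0], the one carried by the model over [A0 l]. *)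
pose l := - b / m; have bE : b = - l * m by rewrite /l; field.
have l0 : l != 0 by rewrite mulf_neq0 ?oppr_eq0 ?invr_eq0.
(* The determinant divided by the square of the skew part is a congruence invariant: [q / (1 + q)^2]
   for [rel_form], and [l / (1 + l)^2] here. Cross-multiplying, which also covers [q = -1], the
   difference factors as [(l - q)(1 - q l)]. *)
have : (l - q) * (1 - q * l) = 0.
  have E1 : l * m ^+ 2 = q * dl ^+ 2 by rewrite -detE e0 bE; ring.
  have E2 : (l + 1) * m = (1 + q) * dl by apply: oppr_inj; rewrite -skewE bE; ring.
  have q1 : q * dl ^+ 2 != 0 by rewrite -E1 mulf_neq0 // expf_neq0.
  apply: (mulfI q1); rewrite mulr0.
  have -> : q * dl ^+ 2 * ((l - q) * (1 - q * l)) =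
    q * (l * ((1 + q) * dl) ^+ 2 - (l + 1) ^+ 2 * (q * dl ^+ 2)) by ring.
  by rewrite -E1 -E2; ring.
rewrite e0 bE in df *.
have [s [sh sc]] := A0_lift m0 dm df; move/eqP; rewrite mulf_eq0 => lq.
exists (A0 l), (mx2 (A0_x l) (A0_x l * A0_y l) 0 (A0_x l)), s; split=> //; last exact: model_A0.
case/orP: lq => /eqP lq.
  by constructor 2; rewrite (_ : q = l); [apply: hopf_iso_refl|rewrite -[q](subrK l) -opprB lq oppr0 add0r].
constructor 3; rewrite (_ : q^-1 = l); first exact: hopf_iso_refl.
by rewrite -[l](mulKf q0) -[q * l](subKr 1) lq subr0 mulr1.
Qed.

End Classification.

(** * Maximal cocommutative quotients *)

Section UniversalMatrix.
Context (k : fieldType) (q : k).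
Local Notation A := (qplane q).

Lemma coaction_map (C D : hopfType k) (f : C -> D) (rho : A -> tensor A C)
    (rho' : A -> tensor A D) (c : 'M[C]_2) :
  hopf_hom f -> coaction rho -> coacts rho c -> coaction rho' ->
  coacts rho' (map_mx f c) -> forall a, tmap id f (rho a) = rho' a.
Proof.
move=> [fl fm _ _ _] [rl rm _ _] rc [rl' rm' _ _] rc' a.
have tl := tmap_linear (@linP_id _ A) fl.
have E : (fun a => tmap id f (rho a)) = rho'.
  apply: (coacts_unique _ rl' _ rm' (coacts_map fl rc) rc'); first exact: linP_comp.
  by apply: morph_comp => //; apply: tmap_morph.
by rewrite -E.
Qed.

(** The universal property of [is_aut_r] in terms of matrices: [U] represents the functor sending
    [H] to the comatrices over [H] that preserve [rel_form]. Existence and uniqueness are separated,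
    since uniqueness is applied to compositions of maps. *)
Definition universal_matrix (U : hopfType k) (u : 'M[U]_2) : Prop :=
  [/\ comatrix u, preserves_form (rel_form q) u,
   forall (H : hopfType k) (c : 'M[H]_2), comatrix c -> preserves_form (rel_form q) c ->
     exists f : U -> H, hopf_hom f /\ map_mx f u = c &
   forall (H : hopfType k) (f g : U -> H), hopf_hom f -> hopf_hom g ->
     map_mx f u = map_mx g u -> f = g].

Lemma aut_r_universal_matrix (U : hopfType k) (rho : A -> tensor A U) :
  is_aut_r (@qplane_deg k q) rho -> exists u : 'M[U]_2, universal_matrix u.
Proof.
move=> [rg runiv]; have [u [um uf uc]] := coaction_matrix rg; exists u; split=> //.
  move=> H c cm cf; have [rho' [rg' rc']] := coaction_exists cm cf.
  have [f [[fh fE] _]] := runiv _ _ rg'; exists f; split=> //.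
  have [fl _ _ _ _] := fh; have mc := coacts_map fl uc.
  apply/matrixP=> i j; apply: (@qx_tens_inj k q H (fun i => map_mx f u i j) (fun i => c i j)).
  by rewrite -mc -rc' fE.
move=> H f g fh gh fg; have [fl fm _ _ _] := fh.
have [rho' [rg' rc']] := coaction_exists (comatrix_map fh um) (preserves_form_map fl fm uf).
have [h [_ hu]] := runiv _ _ rg'.
rewrite -(hu f); last by split=> //; apply: (coaction_map fh rg.1 uc rg'.1 rc').
by apply: hu; split=> //; apply: (coaction_map gh rg.1 uc rg'.1); rewrite -fg.
Qed.

(** The image of [f] is a Hopf subalgebra containing the entries of [c], which generate [H]. *)
Lemma model_surj (H U : hopfType k) (B : 'M[k]_2) (c : 'M[H]_2) (u : 'M[U]_2) (f : U -> H) :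
  model B c -> hopf_hom f -> map_mx f u = c -> forall y, exists x, f x = y.
Proof.
move=> cM fh fu; apply: (model_generates cM (hopf_subalgebra_image fh)) => i j.
by exists (u i j); rewrite -fu mxE.
Qed.

(** [I] is the kernel of the map [f] to the model. For a smaller [I'] with cocommutative quotient,
    [model_lift] gives [s] from [H] back to that quotient, and uniqueness makes [s \o f] the
    projection; so [f x = 0] already implies [I' x]. *)
Lemma model_max_quotient (U H Q : hopfType k) (u : 'M[U]_2) (c : 'M[H]_2) :
  universal_matrix u -> model (rel_form q) c -> hopf_iso Q H ->
  is_max_cocommutative_quotient_of Q U.
Proof.
move=> [um uf uex uun] cM QH.
have [f [fh fu]] := uex _ _ (model_comatrix cM) (model_form cM).
have fs := model_surj cM fh fu; have [I IE] := hopf_kerP fh fs.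
have UH := hopf_quot_iso fh fs IE; exists I; split; last first.
  exact/(hopf_iso_trans UH)/hopf_iso_sym.
split; first exact: cocommutative_iso UH (model_cocommutative cM).
move=> I' I'I nII' Cc; apply: nII' => x /IE fx0.
have ph := qpi_hopf_hom I'; have [pl pm _ _ _] := ph.
have [fl fm _ _ _] := fh; have f0 y : I' y -> f y = 0 by move=> /I'I/IE.
pose p : hopf_quot I' -> H := qlift f.
have pE y : p (qpi I' y) = f y by apply: qliftE.
have [||||||s [sh sc]] := @model_lift _ _ _ _ cM _ (map_mx (qpi I' : U -> hopf_quot I') u) p => //.
- exact: comatrix_map.
- exact: preserves_form_map.
- exact: qlift_linear.
- exact: qlift_monoid_morphism.
- by rewrite -map_mx_comp -fu; apply/matrixP=> i j; rewrite !mxE /= pE.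
have E : (fun y => s (f y)) = (qpi I' : U -> hopf_quot I').
  apply: uun => //; first exact: hopf_hom_comp.
  by rewrite map_mx_comp fu.
have := congr1 (fun g => g x) E; rewrite /= fx0; have [sl _ _ _ _] := sh.
by rewrite (linP0 sl) -(linP0 (@qpi_linear _ _ I')) => /esym/qpiP; rewrite subr0.
Qed.

End UniversalMatrix.

(** * The models for the form of the quantum plane *)

Section ListedModels.
Context (k : fieldType) (q : k).
Hypothesis q0 : q != 0.

Lemma listed_Zsq : model (rel_form q) (mx2 (Zsq_x k) 0 0 (Zsq_y k)).
Proof. by apply: model_Zsq; rewrite ?oppr_eq0 ?oner_neq0. Qed.

Lemma listed_A0 : model (rel_form q) (mx2 (A0_x q) (A0_x q * A0_y q) 0 (A0_x q)).
Proof. by have := model_A0 0 q0 (oner_neq0 k); rewrite mulr1. Qed.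

(** Exchanging [x_1] and [x_2] turns [rel_form] into [mx2 0 1 (- q) 0], which is the form of the
    [A0] model with [l = q^-1] and [c = - q]. *)
Lemma listed_A0V : exists c : 'M[A0 q^-1]_2, model (rel_form q) c.
Proof.
have V0 : q^-1 != 0 by rewrite invr_eq0.
have N0 : - q != 0 by rewrite oppr_eq0.
pose P : 'M[k]_2 := mx2 0 1 1 0.
have PP : P *m P = 1%:M by rewrite mul_mx2 mx2_1; apply/mx2_eq; split; ring.
have := model_conj PP PP (model_A0 0 V0 N0); set c := _ *m _ *m smx _ P => cM; exists c.
rewrite (_ : rel_form q = P *m mx2 0 (- q^-1 * - q) (- q) 0 *m P^T) //.
by rewrite /P tr_mx2 !mul_mx2; apply/mx2_eq; split; field.
Qed.

(** At [q = -1] the form is the symmetric hyperbolic plane, diagonalised by the sum and difference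
    of the basis vectors; the inverse change of basis divides by 2. *)
Lemma listed_Gamma : 2%:R != 0 :> k -> q = -1 ->
  exists c : 'M[group_alg k Gamma]_2, model (rel_form q) c.
Proof.
move=> two0 qE; have a0 : 2%:R^-1 != 0 :> k by rewrite invr_eq0.
have e0 : - 2%:R^-1 != 0 :> k by rewrite oppr_eq0.
pose P : 'M[k]_2 := mx2 1 1 1 (-1).
pose P' : 'M[k]_2 := mx2 2%:R^-1 2%:R^-1 2%:R^-1 (- 2%:R^-1).
have PP : P *m P' = 1%:M by rewrite mul_mx2 mx2_1; apply/mx2_eq; split; field.
have PP' : P' *m P = 1%:M by rewrite mul_mx2 mx2_1; apply/mx2_eq; split; field.
have := model_conj PP PP' (model_Gamma a0 e0); set c := _ *m _ *m smx _ P' => cM; exists c.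
rewrite (_ : rel_form q = P *m mx2 2%:R^-1 0 0 (- 2%:R^-1) *m P^T) //.
by rewrite /rel_form qE /P tr_mx2 !mul_mx2; apply/mx2_eq; split; field.
Qed.

End ListedModels.

Section Main.
Context (k : closedFieldType) (q : k).
Hypothesis q0 : q != 0.

(** The projection onto the quotient by [I] factors through the model [H] supplied by
    [classification], so the kernel of [U -> H] lies in [I]. As [H] is cocommutative, maximality
    makes the two ideals equal. *)
Lemma max_quotient_listed (U Q : hopfType k) (u : 'M[U]_2) :
  universal_matrix q u -> is_max_cocommutative_quotient_of Q U -> listed q Q.
Proof.
move=> [um uf uex uun] [I [[Ic Imax] IQ]].
have ph := qpi_hopf_hom I; have [pl pm _ _ _] := ph.
have [H [d [s [Hl dM sh sd]]]] := classification q0 Ic (comatrix_map ph um) (preserves_form_map pl pm uf).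
have [f [fh fu]] := uex _ _ (model_comatrix dM) (model_form dM).
have E : (fun y => s (f y)) = (qpi I : U -> hopf_quot I).
  apply: uun => //; first exact: hopf_hom_comp.
  by rewrite map_mx_comp fu.
have fs := model_surj dM fh fu; have [I' I'E] := hopf_kerP fh fs.
have [sl _ _ _ _] := sh.
have I'I x : I' x -> I x.
  move=> /I'E fx0; have := congr1 (fun g => g x) E; rewrite /= fx0 (linP0 sl).
  by rewrite -(linP0 (@qpi_linear _ _ I)) => /esym/qpiP; rewrite subr0.
have II' x : I x -> I' x.
  move=> Ix; apply: contrapT => nI'x; apply: (Imax I' I'I); first by move/(_ x Ix).
  exact: cocommutative_iso (hopf_quot_iso fh fs I'E) (model_cocommutative dM).
have QH : hopf_iso Q H.
  apply: hopf_iso_trans (hopf_iso_sym IQ) (hopf_quot_iso fh fs _) => x.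
  by split=> [/II'/I'E|/I'E/I'I].
rewrite /listed; case: Hl => [Hl|Hl|Hl|[qE Hl]].
- by constructor 1; apply: hopf_iso_trans Hl.
- by constructor 2; apply: hopf_iso_trans Hl.
- by constructor 3; apply: hopf_iso_trans Hl.
by constructor 4; split=> //; apply: hopf_iso_trans Hl.
Qed.

(** The coaction takes its coefficients in the image of [s], a Hopf subalgebra; were [s] not
    surjective, this would contradict inner-faithfulness. *)
Lemma inner_faithful_quotient (C : hopfType k) (rho : qplane q -> tensor (qplane q) C) :
  cocommutative C -> graded_coaction (@qplane_deg k q) rho -> inner_faithful rho ->
  exists2 H, listed q H & is_quotient_of C H.
Proof.
move=> Cc rg rif; have [c [cm cf rc]] := coaction_matrix rg.
have [H [d [s [Hl dM sh sd]]]] := classification q0 Cc cm cf.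
exists H => //; apply: (is_quotient_of_surj sh); apply: contrapT => ns.
have [rho' [rg' rc']] := coaction_exists (model_comatrix dM) (model_form dM).
apply: (rif _ (hopf_subalgebra_image sh)).
  by move/existsNP: ns => [y ny]; exists y.
move=> a; rewrite -(coaction_map sh rg'.1 rc' rg.1) ?sd //.
have [sl _ _ _ _] := sh.
by apply: tspan_map (tspanT _) => // b _; exists b.
Qed.

Lemma is_quotient_of_iso (C H K : hopfType k) :
  hopf_iso H K -> is_quotient_of C H -> is_quotient_of C K.
Proof.
move=> /hopf_iso_sym[f [fh [f' fK f'K]]] [I [g [gh [g' gK g'K]]]].
apply: (@is_quotient_of_surj _ _ _ (fun x => g (qpi I (f x)))).
  exact/(hopf_hom_comp gh)/(hopf_hom_comp (qpi_hopf_hom I)).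
by move=> y; exists (f' (qrepr (g' y))); rewrite f'K qreprK g'K.
Qed.

End Main.

Theorem theorem6p6 (k : closedFieldType) (char0 : [pchar k] =i pred0)
    (q : k) (q_neq0 : q != 0) :
  (forall (U : hopfType k) (rho : qplane q -> tensor (qplane q) U),
     is_aut_r (@qplane_deg k q) rho ->
     forall Q : hopfType k,
       is_max_cocommutative_quotient_of Q U <->
       [\/ hopf_iso Q (group_alg k Zsq),
           hopf_iso Q (A0 q),
           hopf_iso Q (A0 q^-1)
         | q = -1 /\ hopf_iso Q (group_alg k Gamma)])
  /\
  (forall (C : hopfType k) (rho : qplane q -> tensor (qplane q) C),
     cocommutative C ->
     graded_coaction (@qplane_deg k q) rho ->
     inner_faithful rho ->
     [\/ is_quotient_of C (group_alg k Zsq),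
         is_quotient_of C (A0 q),
         is_quotient_of C (A0 q^-1)
       | q = -1 /\ is_quotient_of C (group_alg k Gamma)]).
Proof.
(* Characteristic zero enters through the invertibility of 2, for the model over [Gamma]. *)
have two0 : 2%:R != 0 :> k by apply/negP => k2; have := char0 2%N; rewrite !inE k2.
split=> [U rho /aut_r_universal_matrix[u uU] Q|C rho Cc rg rif].
  split=> [/(max_quotient_listed q_neq0 uU) //|].
  case=> [QH|QH|QH|[qE QH]].
  - exact: model_max_quotient uU (listed_Zsq q_neq0) QH.
  - exact: model_max_quotient uU (listed_A0 q_neq0) QH.
  - by have [c cM] := listed_A0V q_neq0; apply: model_max_quotient uU cM QH.
  by have [c cM] := listed_Gamma two0 qE; apply: model_max_quotient uU cM QH.
have [H Hl HC] := inner_faithful_quotient q_neq0 Cc rg rif.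
case: Hl => [Hl|Hl|Hl|[qE Hl]].
- by constructor 1; apply: is_quotient_of_iso Hl HC.
- by constructor 2; apply: is_quotient_of_iso Hl HC.
- by constructor 3; apply: is_quotient_of_iso Hl HC.
by constructor 4; split=> //; apply: is_quotient_of_iso Hl HC.
Qed.
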